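(* Let $d\ge 1$, let $G$ be a compact abelian group with normalized Haar measure $\mu$, and let $\{\gamma_i\}_{i=0}^{\infty}$ be a $d$-dissociated system of characters of $G$. Then the polynomial chaos $B^d_\gamma=\{\gamma_{k_1}\cdots\gamma_{k_d} : k_1\le\dots\le k_d\}$ is a $\frac{2d}{d+1}$-Sidon system. That is, there is a constant $C>0$ such that for every $N$ and every polynomial $$Q={\sum}' A_{k_1,\ldots,k_d}\,\gamma_{k_1}(x)\cdots\gamma_{k_d}(x),\qquad A_{k_1,\ldots,k_d}\in\mathbb{C},$$ one has $$\Bigl({\sum}'|A_{k_1,\ldots,k_d}|^{\frac{2d}{d+1}}\Bigr)^{\frac{d+1}{2d}}\le C\,\|Q\|_{\infty},$$ where $C$ does not depend on the polynomial $Q$. Here the primed sum $\sum'$ runs over all non-decreasing sequences $0\le k_1\le\dots\le k_d\le N$ in which each index $j\in\{0,1,\ldots,N\}$ appears fewer than $m_j$ times, where $m_j=\inf\{m\in\mathbb{N}\cup\{+\infty\}:\gamma_j^m=1\}$.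
   Context: A character of a compact abelian group $G$ is a continuous homomorphism from $G$ to the unit circle. $\|\cdot\|_\infty$ is the norm of $L_\infty(G)$ with respect to normalized Haar measure. $m_j\in\mathbb{N}\cup\{+\infty\}$ is the order of the character $\gamma_j$ ($m_j=+\infty$ if no positive power of $\gamma_j$ is trivial). A finite set $\{\gamma_1,\ldots,\gamma_m\}$ of distinct characters of $G$ is called $d$-dissociated if it does not contain the trivial character and if any relation $\gamma_1^{k_1}\gamma_2^{k_2}\cdots\gamma_m^{k_m}\equiv 1$ with all $k_j\in\{-d,-(d-1),\ldots,0,\ldots,d-1,d\}$ implies $\gamma_1^{k_1}\equiv\gamma_2^{k_2}\equiv\dots\equiv\gamma_m^{k_m}\equiv1$. An infinite set of characters is $d$-dissociated if every finite subset of it is $d$-dissociated. In a $d$-dissociated system $\{\gamma_i\}$ the characters $\gamma_i$ are pairwise distinct. *)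

(* Defs.v *)
From HB Require Import structures.
From mathcomp Require Import all_boot all_order all_algebra complex.
From mathcomp Require Import all_classical all_reals all_analysis.
Set Implicit Arguments.
Unset Strict Implicit.
Unset Printing Implicit Defensive.
Import Order.TTheory GRing.Theory Num.Theory numFieldNormedType.Exports.
Local Open Scope classical_set_scope.
Local Open Scope ring_scope.

(* The library attaches the usual topology of the complex numbers R[i] to the
   alias R[i]^o.  The group law of G is written additively. *)
Notation cplx R := (R[i]%C^o) (only parsing).

(* The norm `|z| of R[i] takes values in R[i]; this is the same real number
   as an element of R. *)
Definition cmod (R : realType) (z : cplx R) : R := complex.Re `|z|.

(* Measurable types are pointed; the point of G comes from its zmodType
   structure. *)
Definition borelType (G : topologicalZmodType) : measurableType _ :=
  g_sigma_algebraType (@open G : set (set (G : zmodType))).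

Section Haar.
Variables (R : realType) (G : topologicalZmodType).

Definition is_haar (mu : probability (borelType G) R) : Prop :=
  [/\ forall (a : G) (A : set (borelType G)), measurable A ->
        mu [set a + x | x in (A : set G)] = mu A,
      forall A : set (borelType G), measurable A ->
        mu A = ereal_inf [set mu U | U in [set U : set G | open U /\ A `<=` U]]
    & forall U : set G, open U ->
        mu U =
        ereal_sup [set mu K | K in [set K : set G | compact K /\ K `<=` U]] ].

End Haar.

Section Characters.
Variables (R : realType) (G : topologicalZmodType).
Implicit Types chi : G -> cplx R.

Definition is_character chi : Prop :=
  [/\ continuous chi, forall x, `|chi x| = 1
    & forall x y, chi (x + y) = chi x * chi y].

(* The infimum of the empty set is +oo. *)
Definition char_order chi : \bar R :=
  ereal_inf [set n%:R%:E | n in [set n | (0 < n)%N /\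
                                         forall x, chi x ^+ n = 1]].

(* Meant for finite A: the product over an infinite A may be meaningless. *)
Definition dissociated_fin (d : nat) (A : set (G -> cplx R)) : Prop :=
  ~ A (cst 1) /\
  forall k : (G -> cplx R) -> int,
    (forall chi, A chi -> `|k chi| <= d%:Z) ->
    (forall x, \big[*%R/1]_(chi \in A) chi x ^ k chi = 1) ->
    forall chi, A chi -> forall x, chi x ^ k chi = 1.

Definition dissociated (d : nat) (B : set (G -> cplx R)) : Prop :=
  forall A, finite_set A -> A `<=` B -> dissociated_fin d A.

Definition dissociated_system (d : nat) (gamma : nat -> G -> cplx R) : Prop :=
  injective gamma /\ dissociated d (range gamma).

(* Multi-indices 0 <= k_1 <= ... <= k_d <= N in which every j occurs fewer
   than char_order (gamma j) times. *)
Definition chaos_index (gamma : nat -> G -> cplx R) (d N : nat)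
    (k : d.-tuple 'I_N.+1) : bool :=
  sorted leq (map val k) &&
  [forall j : 'I_N.+1,
     ((count_mem j k)%:R%:E < char_order (gamma j))%E].

Definition chaos_poly (gamma : nat -> G -> cplx R) (d N : nat)
    (a : d.-tuple 'I_N.+1 -> cplx R) (x : G) : cplx R :=
  \sum_(k : d.-tuple 'I_N.+1 | chaos_index gamma k)
     a k * \prod_(i < d) gamma (tnth k i) x.

End Characters.

(* Main.v *)
(* Sort the monomials of Q by type, that is by the number r of distinct factors
   and by their exponents p_1, ..., p_r, of sum d.

   Riesz products prod_j (1 + Re (z_j gamma_j^(-s_j))) are nonnegative kernels;
   testing Q against them and using dissociation turns the bound on Q into a
   bound for sums over sign patterns on the indices.  Distribute the indices at
   random into r groups and take s_j = p_g for j in group g.  Apart from the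
   resonances whose residual exponent at some index, the head, exceeds d (there
   dissociation says nothing), what remains is an r-linear form bounded by
   2^r |Q|.  Resonances are rare, since they are counted by another nonnegative
   kernel, so that each monomial of the given type survives with probability
   comparable to the product of its selection probabilities.  The
   Bohnenblust-Hille inequality (exponent 2r/(r+1)) and its mixed l^1(l^2) form
   are then available for the surviving coefficients.

   If no exponent dominates, the selection probabilities may be constants.
   Otherwise let p_1 be the largest exponent and tau the integer part of
   d/(d+1-p_1), the largest number of heads.  Indices of the first group that
   range over n values are to be selected with probability of order
   n^(-(tau-1)/(2 tau)).  On dyadic classes of coefficients and of degrees,
   interpolation between the two inequalities gives a weak type estimate of
   exponent 2 - 4/((r+1)(tau+1)), which is less than 2d/(d+1) because
   r tau <= d.  The pure powers gamma_j^d (r = 1) are tested against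
   z_j = delta |A_j|^(2d/(d+1)-1), up to phase and normalization; the error is
   of third order in delta and is absorbed. *)

Require Import Defs.
From HB Require Import structures.
From mathcomp Require Import all_boot all_order all_algebra complex.
From mathcomp Require Import all_classical all_reals all_analysis.
From mathcomp Require Import ess_sup_inf zify ring lra.
Set Implicit Arguments.
Unset Strict Implicit.
Unset Printing Implicit Defensive.
Import Order.TTheory GRing.Theory Num.Theory numFieldNormedType.Exports.
Local Open Scope ring_scope.

(** * Moduli and finite averages *)

(** Haar measure enters only through one fact: an open null set is empty, so the essential supremum
    bounds [Q] at every point. The rest is finite: an integral against a nonnegative kernel becomes
    an average over a finite list of points on which the nontrivial characters involved nearly
    cancel. The obstacle is that a minus sign at an index of multiplicity m in group g leaves the
    residue m + p_g, possibly above d. All heads turn out to lie in one group, each takes at least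
    d+1-p_g of the degree d, and homogeneity forces more plus signs than heads in that group. With t
    heads, one of them prescribed and the others ranging over n values, and t+1 plus signs, the cost
    is n^(t-1) theta^(2t) if each selection has probability theta. Boundedness for all t <= tau
    dictates theta of order n^(-(tau-1)/(2 tau)). The gap of exponents amounts to (r+1)(tau+1) <
    2(d+1), which holds for r, tau >= 2. For pure powers, r = 1 and tau = d give equality, so
    interpolation leaves no decay to sum; hence their separate treatment. *)

Section ComplexModulus.
Variable R : realType.
Implicit Types z w : R[i].

Lemma cmodE z : `|z| = (cmod z)%:C%C.
Proof. by rewrite /cmod normc_def. Qed.

Lemma cmod_ge0 z : 0 <= cmod z.
Proof. by rewrite -ler0c -cmodE normr_ge0. Qed.

Lemma cmodM z w : cmod (z * w) = cmod z * cmod w.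
Proof. by apply: complexI; rewrite -cmodE normrM !cmodE -rmorphM. Qed.

Lemma cmodD z w : cmod (z + w) <= cmod z + cmod w.
Proof. by rewrite -lecR rmorphD /= -!cmodE ler_normD. Qed.

Lemma cmodN z : cmod (- z) = cmod z.
Proof. by apply: complexI; rewrite -!cmodE normrN. Qed.

Lemma cmod0 : cmod (0 : R[i]) = 0.
Proof. by apply: complexI; rewrite -cmodE normr0. Qed.

Lemma cmod1 : cmod (1 : R[i]) = 1.
Proof. by apply: complexI; rewrite -cmodE normr1. Qed.

Lemma cmodJ z : cmod (z^*)%C = cmod z.
Proof. by apply: complexI; rewrite -!cmodE normcJ. Qed.

Lemma cmod_eq0 z : (cmod z == 0) = (z == 0).
Proof. by rewrite -[RHS]normr_eq0 cmodE -(inj_eq (@complexI R)). Qed.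

Lemma cmodX z n : cmod (z ^+ n) = cmod z ^+ n.
Proof. by apply: complexI; rewrite rmorphXn /= -!cmodE normrX. Qed.

Lemma cmodV z : cmod z^-1 = (cmod z)^-1.
Proof. by apply: complexI; rewrite fmorphV /= -!cmodE normfV. Qed.

Lemma cmod_real (a : R) : cmod (a%:C)%C = `|a|.
Proof. by apply: complexI; rewrite -cmodE normc_def /= expr0n addr0 sqrtr_sqr. Qed.

Lemma cmod_real_ge0 (a : R) : 0 <= a -> cmod (a%:C)%C = a.
Proof. by move=> ?; rewrite cmod_real ger0_norm. Qed.

Lemma cmod_prod (I : finType) (P : pred I) (F : I -> R[i]) :
  cmod (\prod_(i | P i) F i) = \prod_(i | P i) cmod (F i).
Proof. by apply: (big_morph (@cmod R)) => [z w|]; rewrite ?cmodM ?cmod1. Qed.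

Lemma cmod_sum (I : finType) (P : pred I) (F : I -> R[i]) :
  cmod (\sum_(i | P i) F i) <= \sum_(i | P i) cmod (F i).
Proof.
elim/big_rec2: _ => [|i a z _ h]; first by rewrite cmod0.
by rewrite (le_trans (cmodD _ _)) // lerD2l.
Qed.

Lemma cmod_Re z : `|complex.Re z| <= cmod z.
Proof. by rewrite -lecR -cmodE normc_ge_Re. Qed.

Lemma cmod_sqr z : (cmod z ^+ 2)%:C%C = z * (z^*)%C.
Proof. by rewrite rmorphXn /= -cmodE sqr_normc. Qed.

Lemma cmod_sqrE z : cmod z ^+ 2 = complex.Re z ^+ 2 + complex.Im z ^+ 2.
Proof. by apply: complexI; rewrite add_Re2_Im2 rmorphXn /= cmodE. Qed.

Definition phase z : R[i] := (z^*)%C / (cmod z)%:C%C.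

Lemma cmod_phase z : cmod (phase z) <= 1.
Proof.
rewrite /phase cmodM cmodV cmodJ cmod_real ger0_norm ?cmod_ge0 //.
have [->|n0] := eqVneq (cmod z) 0; first by rewrite mul0r.
by rewrite divff.
Qed.

Lemma mul_phase z : z * phase z = (cmod z)%:C%C.
Proof.
have [/eqP|n0] := eqVneq (cmod z) 0.
  by rewrite cmod_eq0 => /eqP ->; rewrite mul0r cmod0.
rewrite /phase mulrA -cmod_sqr -fmorphV -rmorphM; congr (_%:C%C).
by rewrite expr2 mulfK.
Qed.

End ComplexModulus.

(** * Finite averages in place of Haar integrals *)

Section Averages.
Variables (R : realType) (G : zmodType).
Implicit Types chi : G -> R[i].

Definition unimodular_hom chi :=
  (forall x, cmod (chi x) = 1) /\ (forall x y, chi (x + y) = chi x * chi y).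

Definition average (X : seq G) (f : G -> R[i]) : R[i] :=
  (size X)%:R^-1 * \sum_(x <- X) f x.

Lemma unimodular_hom0 chi : unimodular_hom chi -> chi 0 = 1.
Proof.
move=> [h1 h2]; have h0 : chi 0 != 0.
  by rewrite -cmod_eq0 h1 oner_eq0.
by apply: (mulfI h0); rewrite -h2 addr0 mulr1.
Qed.

Lemma unimodular_homMn chi x n : unimodular_hom chi -> chi (x *+ n) = chi x ^+ n.
Proof.
move=> h; elim: n => [|n IH]; first by rewrite mulr0n expr0 unimodular_hom0.
by rewrite mulrS (h.2) IH exprS.
Qed.

Lemma cmod_nat n : cmod (n%:R : R[i]) = n%:R.
Proof. by rewrite -(rmorph_nat (real_complex R)) cmod_real_ge0. Qed.

Lemma cmod_average (X : seq G) (f : G -> R[i]) (B : R) :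
  (0 < size X)%N -> (forall x, cmod (f x) <= B) -> cmod (average X f) <= B.
Proof.
move=> X0 fB; rewrite /average cmodM cmodV cmod_nat ler_pdivrMl ?ltr0n //.
have: cmod (\sum_(x <- X) f x) <= \sum_(x <- X) B.
  elim: X {X0} => [|x X IH]; first by rewrite !big_nil cmod0.
  by rewrite !big_cons (le_trans (cmodD _ _)) // lerD.
by rewrite big_const_seq count_predT iter_addr_0 mulr_natl.
Qed.

Lemma average_const (X : seq G) : (0 < size X)%N -> average X (cst 1) = 1.
Proof.
move=> X0; rewrite /average big_const_seq count_predT iter_addr_0.
by rewrite -[1 *+ _]/((size X)%:R) mulVf // pnatr_eq0 -lt0n.
Qed.

Lemma average_sum (J : finType) (P : pred J) X (F : J -> G -> R[i]) :
  average X (fun x => \sum_(j | P j) F j x) = \sum_(j | P j) average X (F j).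
Proof. by rewrite /average exchange_big /= mulr_sumr. Qed.

Lemma averageZ X a (f : G -> R[i]) :
  average X (fun x => a * f x) = a * average X f.
Proof. by rewrite /average -mulr_sumr mulrCA. Qed.

(** A homomorphism factors over the points x + n y, so a character that is small on average over [X]
    stays small. *)
Lemma average_translates X y L chi : unimodular_hom chi ->
  average [seq x + y *+ n | x <- X, n <- iota 0 L] chi =
  average X chi * (L%:R^-1 * \sum_(n < L) chi y ^+ n).
Proof.
move=> h; rewrite /average size_allpairs size_iota natrM invfM.
rewrite big_allpairs_dep /= -[RHS]mulrACA; congr (_ * _).
rewrite mulr_suml; apply: eq_bigr => x _.
rewrite mulr_sumr -(big_mkord predT (fun n => chi x * chi y ^+ n)) /index_iota subn0.
by apply: eq_bigr => n _; rewrite h.2 unimodular_homMn.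
Qed.

(** The geometric sum is at most 2 / |w - 1| whatever its length, so a long average is small. *)
Lemma geometric_average_small (w : R[i]) (eps : R) : cmod w = 1 -> w != 1 ->
  0 < eps -> exists2 L, (0 < L)%N & cmod (L%:R^-1 * \sum_(n < L) w ^+ n) <= eps.
Proof.
move=> w1 wn1 e0.
have c0 : 0 < cmod (w - 1).
  by rewrite lt_neqAle cmod_ge0 eq_sym cmod_eq0 subr_eq0 wn1.
pose L := (Num.truncn (2 / (cmod (w - 1) * eps))).+1.
have L0 : (0 : R) < L%:R by rewrite ltr0n.
have hL : 2 / (cmod (w - 1) * eps) < L%:R by rewrite truncnS_gt.
exists L => //; rewrite cmodM cmodV cmod_nat ler_pdivrMl //.
have : cmod (w - 1) * cmod (\sum_(n < L) w ^+ n) <= 2.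
  rewrite -cmodM -subrX1 (le_trans (cmodD _ _)) // cmodN cmod1 cmodX w1 expr1n.
  exact: lexx.
rewrite mulrC -ler_pdivlMr // => /le_trans; apply.
move: hL; rewrite ltr_pdivrMr ?mulr_gt0 // => /ltW hL.
by rewrite ler_pdivrMr // -mulrA [eps * _]mulrC.
Qed.

(** Characters are treated one at a time: a point y with chi(y) <> 1 provides a small geometric
    factor, and the averages of the characters already treated are only multiplied by a number of
    modulus at most 1. *)
Lemma average_kills_nontrivial (J : finType) (chi : J -> G -> R[i]) (eps : R) :
  (forall j, unimodular_hom (chi j)) -> 0 < eps ->
  exists2 X : seq G, (0 < size X)%N & forall j, ~ (forall x, chi j x = 1) ->
    cmod (average X (chi j)) <= eps.
Proof.
move=> hchi e0.
suff [X X0 hX] : exists2 X : seq G, (0 < size X)%N & forall j, j \in enum J ->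
    ~ (forall x, chi j x = 1) -> cmod (average X (chi j)) <= eps.
  by exists X => // j; apply: hX; rewrite mem_enum.
elim: (enum J) => [|j s [X X0 IH]]; first by exists [:: 0].
have [tj|ntj] := pselect (forall x, chi j x = 1).
  by exists X => // i; rewrite inE => /orP[/eqP ->|/IH].
have [y hy] : exists y, chi j y <> 1 by apply/existsNP.
have [L L0 hL] := geometric_average_small ((hchi j).1 y) (introN eqP hy) e0.
exists [seq x + y *+ n | x <- X, n <- iota 0 L].
  by rewrite size_allpairs size_iota muln_gt0 X0.
have b1 i : cmod (average X (chi i)) <= 1.
  by apply: cmod_average => // x; rewrite (hchi i).1.
move=> i; rewrite inE => /orP[/eqP ->|/IH hi] nti; rewrite average_translates // cmodM.
  by rewrite -[leRHS]mul1r ler_pM ?cmod_ge0.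
rewrite -[leRHS]mulr1 ler_pM ?cmod_ge0 ?hi // cmodM cmodV cmod_nat.
rewrite ler_pdivrMl ?ltr0n // mulr1 (le_trans (cmod_sum _ _)) //.
rewrite (eq_bigr (fun=> 1)) => [|n _]; first by rewrite sumr_const card_ord.
by rewrite cmodX (hchi i).1 expr1n.
Qed.

Lemma unimodular_homM chi psi : unimodular_hom chi -> unimodular_hom psi ->
  unimodular_hom (fun x => chi x * psi x).
Proof.
move=> [a1 a2] [b1 b2]; split=> [x|x y]; first by rewrite cmodM a1 b1 mulr1.
by rewrite a2 b2 mulrACA.
Qed.

(* The sum over trivial characters chi * psi plays the role of the Haar
   integral of f * g, with g >= 0. *)
Lemma positive_kernel_bound (S T : finType) (a : S -> R[i]) (b : T -> R[i])
    (chi : S -> G -> R[i]) (psi : T -> G -> R[i]) (B : R) :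
  (forall s, unimodular_hom (chi s)) -> (forall t, unimodular_hom (psi t)) ->
  (forall x, cmod (\sum_s a s * chi s x) <= B) ->
  (forall x, 0 <= \sum_t b t * psi t x) ->
  \sum_(t | `[< forall x, psi t x = 1 >]) b t = 1 ->
  cmod (\sum_s a s * \sum_(t | `[< forall x, chi s x * psi t x = 1 >]) b t) <= B.
Proof.
move=> hchi hpsi hB pos one.
have B0 : 0 <= B := le_trans (cmod_ge0 _) (hB 0).
set Ma := \sum_s \sum_t cmod (a s * b t).
set Mb := \sum_t cmod (b t).
have Ma0 : 0 <= Ma by do 2!apply: sumr_ge0 => ? _; exact: cmod_ge0.
have Mb0 : 0 <= Mb by apply: sumr_ge0 => ? _; exact: cmod_ge0.
apply/ler_addgt0Pr => e e0.
(* The total error will be eps (Ma + B Mb); the 1 only keeps the denominator positive. *)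
pose eps := e / (Ma + B * Mb + 1).
have D0 : 0 < Ma + B * Mb + 1 by rewrite ltr_pwDr // addr_ge0 // mulr_ge0.
have eps0 : 0 < eps by rewrite divr_gt0.
(* One list of points must serve both the products, for the average of f g, and the kernel alone,
   whose average has to be close to its mass 1. *)
pose J := (S * T + T)%type.
pose ch (j : J) : G -> R[i] :=
  match j with inl p => fun x => chi p.1 x * psi p.2 x | inr t => psi t end.
have hch j : unimodular_hom (ch j).
  by case: j => [[s t]|t] //=; apply: unimodular_homM.
have [X X0 hX] := average_kills_nontrivial hch eps0.
have approx (j : J) : cmod (average X (ch j) - (`[< forall x, ch j x = 1 >])%:R) <= eps.
  case: asboolP => [tj|ntj]; last by rewrite subr0 hX.
  rewrite (_ : ch j = cst 1) ?average_const // ?subrr ?cmod0 ?ltW //.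
  by apply/funext => x; rewrite tj.
set main := \sum_s _.
pose f x := \sum_s a s * chi s x; pose g x := \sum_t b t * psi t x.
have Eg : cmod (average X g - 1) <= eps * Mb.
  rewrite /g average_sum -one [X in _ - X]big_mkcond -sumrB (le_trans (cmod_sum _ _)) //.
  rewrite mulr_sumr; apply: ler_sum => t _; rewrite averageZ.
  have -> : (if `[< forall x, psi t x = 1 >] then b t else 0) =
            b t * (`[< forall x, psi t x = 1 >])%:R.
    by case: asboolP; rewrite ?mulr1 ?mulr0.
  by rewrite -mulrBr [leLHS]cmodM [leLHS]mulrC ler_wpM2r ?cmod_ge0 // (approx (inr t)).
have Efg : cmod (average X (fun x => f x * g x) - main) <= eps * Ma.
  have -> : (fun x => f x * g x) =
            (fun x => \sum_s \sum_t (a s * b t) * (chi s x * psi t x)).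
    apply/funext => x; rewrite /f /g mulr_suml; apply: eq_bigr => s _.
    by rewrite mulr_sumr; apply: eq_bigr => t _; rewrite mulrACA.
  rewrite average_sum -sumrB (le_trans (cmod_sum _ _)) // mulr_sumr.
  apply: ler_sum => s _; rewrite average_sum [X in _ - _ * X]big_mkcond /= mulr_sumr -sumrB.
  rewrite (le_trans (cmod_sum _ _)) // mulr_sumr; apply: ler_sum => t _.
  rewrite averageZ.
  have -> : a s * (if `[< forall x, chi s x * psi t x = 1 >] then b t else 0) =
            (a s * b t) * (`[< forall x, chi s x * psi t x = 1 >])%:R.
    by case: asboolP; rewrite ?mulr1 ?mulr0.
  by rewrite -mulrBr [leLHS]cmodM [leLHS]mulrC ler_wpM2r ?cmod_ge0 // (approx (inl (s, t))).
have Bfg : cmod (average X (fun x => f x * g x)) <= B * cmod (average X g).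
  rewrite /average !cmodM mulrCA ler_wpM2l ?cmod_ge0 //.
  (* Positivity of the kernel is used here: the modulus of its sum is the sum of its moduli. *)
  have -> : cmod (\sum_(x <- X) g x) = \sum_(x <- X) cmod (g x).
    apply: complexI; rewrite -cmodE ger0_norm ?sumr_ge0 //.
      rewrite rmorph_sum /=; apply: eq_bigr => x _.
      by rewrite -cmodE ger0_norm //; exact: pos.
    by move=> x _; exact: pos.
  elim: (X) => [|x Y IH]; first by rewrite !big_nil cmod0 mulr0.
  rewrite !big_cons mulrDr (le_trans (cmodD _ _)) // lerD // cmodM.
  by rewrite ler_wpM2r ?cmod_ge0 //; exact: hB.
have g1 : cmod (average X g) <= 1 + eps * Mb.
  rewrite -[average X g](addrNK 1) (le_trans (cmodD _ _)) // cmod1 addrC.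
  by rewrite lerD2l.
have -> : main = average X (fun x => f x * g x) - (average X (fun x => f x * g x) - main).
  by rewrite subKr.
rewrite (le_trans (cmodD _ _)) // cmodN (le_trans (lerD Bfg Efg)) //.
have h2 : B * cmod (average X g) <= B * (1 + eps * Mb) by rewrite ler_wpM2l.
have h3 : eps * (Ma + B * Mb + 1) = e by rewrite /eps divfK ?gt_eqF.
nra.
Qed.

End Averages.

(** * Transfer along positive kernels *)

Section Dissociate.
Variables (R : realType) (G : zmodType) (I : finType).
Variable u : I -> G -> R[i].
Hypothesis hu : forall j, unimodular_hom (u j).

Definition monomial (l : I -> int) (x : G) : R[i] := \prod_j u j x ^ l j.

Definition relation (l : I -> int) : bool := `[< forall x, monomial l x = 1 >].

Definition trivial_power (j : I) (n : int) : bool :=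
  `[< forall x, u j x ^ n = 1 >].

Lemma u_neq0 j x : u j x != 0.
Proof. by rewrite -cmod_eq0 (hu j).1 oner_eq0. Qed.

Lemma cmod_exprz (z : R[i]) (n : int) : cmod z = 1 -> cmod (z ^ n) = 1.
Proof.
move=> h; case: n => n; first by rewrite -exprnP cmodX h expr1n.
by rewrite NegzE -exprnN cmodV cmodX h expr1n invr1.
Qed.

Lemma conj_unimodular (z : R[i]) : cmod z = 1 -> (z^*)%C = z^-1.
Proof.
move=> h; have z0 : z != 0 by rewrite -cmod_eq0 h oner_eq0.
by apply: (mulfI z0); rewrite divff // -cmod_sqr h expr1n.
Qed.

Lemma monomial_hom l : unimodular_hom (monomial l).
Proof.
split=> [x|x y]; rewrite /monomial.
  by rewrite cmod_prod big1 // => j _; rewrite cmod_exprz ?(hu j).1.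
by rewrite -big_split; apply: eq_bigr => j _; rewrite (hu j).2 exprzMl // unitfE u_neq0.
Qed.

Lemma monomialD l m x : monomial (fun j => l j + m j) x = monomial l x * monomial m x.
Proof.
by rewrite -big_split; apply: eq_bigr => j _; rewrite expfzDr ?u_neq0.
Qed.

Lemma eq_relation l m : l =1 m -> relation l = relation m.
Proof. by move=> e; rewrite /relation (_ : l = m) //; apply/funext. Qed.

Variable d : nat.

Definition dissociate : Prop := forall l : I -> int,
  (forall j, `|l j| <= d%:Z) -> relation l -> forall j, trivial_power j (l j).

Hypothesis hdiss : dissociate.

(** Apply [positive_kernel_bound] to the product over j of [\sum_m c j m * u j x ^ (- v j m)]. If a
    choice [mu] of nonzero weight, not constantly [m0], had a trivial monomial, dissociation would
    make one of its nontrivial powers trivial; so the kernel has mass 1. *)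
Lemma riesz_transfer (M : finType) (m0 : M) (c : I -> M -> R[i]) (v : I -> M -> int)
    (S : finType) (a : S -> R[i]) (k : S -> I -> int) (B : R) :
  (forall j, c j m0 = 1) -> (forall j, v j m0 = 0) ->
  (forall j m, `|v j m| <= d%:Z) ->
  (forall j m, m != m0 -> c j m != 0 -> ~~ trivial_power j (v j m)) ->
  (forall j x, 0 <= \sum_m c j m * u j x ^ (- v j m)) ->
  (forall x, cmod (\sum_s a s * monomial (k s) x) <= B) ->
  cmod (\sum_s a s * \sum_(mu : {ffun I -> M} | relation (fun j => k s j - v j (mu j)))
     \prod_j c j (mu j)) <= B.
Proof.
move=> c0 v0 vd nt pos hB.
pose b (mu : {ffun I -> M}) := \prod_j c j (mu j).
pose psi (mu : {ffun I -> M}) := monomial (fun j => - v j (mu j)).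
have hpsi mu : unimodular_hom (psi mu) by exact: monomial_hom.
have hchi s : unimodular_hom (monomial (k s)) by exact: monomial_hom.
have hpos x : 0 <= \sum_mu b mu * psi mu x.
  rewrite (_ : \sum_mu _ = \prod_j \sum_m c j m * u j x ^ (- v j m)).
    by apply: prodr_ge0 => j _.
  rewrite bigA_distr_bigA; apply: eq_bigr => mu _.
  by rewrite /b /psi /monomial -big_split.
have hone : \sum_(mu | `[< forall x, psi mu x = 1 >]) b mu = 1.
  rewrite (bigD1 [ffun=> m0]) /=; last first.
    apply/asboolP => x; rewrite /psi /monomial big1 // => j _.
    by rewrite ffunE v0 oppr0 expr0z.
  rewrite {1}/b big1 => [|j _]; last by rewrite ffunE c0.
  rewrite big1 ?addr0 // => mu /andP[rmu nmu].
  have /existsP[j nj] : [exists j, mu j != m0].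
    apply: contraNT nmu; rewrite negb_exists => /forallP h.
    by apply/eqP/ffunP => j; rewrite ffunE; apply/eqP; rewrite -[_ == _]negbK.
  apply/eqP; apply/prodf_eq0; exists j => //; apply/negPn/negP => cj.
  have /negP := nt j _ nj cj; apply.
  have := @hdiss (fun j => - v j (mu j)).
  move=> /(_ _ _ j) h; have {h} /asboolP h : trivial_power j (- v j (mu j)).
    by apply: h => // i; rewrite normrN.
  by apply/asboolP => x; rewrite -[v j _]opprK -invr_expz h invr1.
have := positive_kernel_bound hchi hpsi hB hpos hone.
congr (cmod _ <= _); apply: eq_bigr => s _; congr (_ * _); apply: eq_bigl => mu.
rewrite /relation; congr asbool; apply/propext; split=> h x.
  by rewrite monomialD h.
by rewrite -(h x) monomialD.
Qed.

(** Divide the polynomial by the monomial of [s0], which has modulus 1, and take the mean, that is,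
    use the kernel 1: only [s0] survives. *)
Lemma coefficient_bound (S : finType) (a : S -> R[i]) (k : S -> I -> int) (B : R) s0 :
  (forall x, cmod (\sum_s a s * monomial (k s) x) <= B) ->
  (forall s, relation (fun j => k s j - k s0 j) -> s = s0) ->
  cmod (a s0) <= B.
Proof.
move=> hB inj.
have hB' x : cmod (\sum_s a s * monomial (fun j => k s j - k s0 j) x) <= B.
  have -> : \sum_s a s * monomial (fun j => k s j - k s0 j) x =
            (\sum_s a s * monomial (k s) x) * monomial (fun j => - k s0 j) x.
    by rewrite mulr_suml; apply: eq_bigr => s _; rewrite monomialD mulrA.
  by rewrite cmodM (monomial_hom _).1 mulr1.
have := @riesz_transfer _ tt (fun _ _ => 1) (fun _ _ => 0) _ a
  (fun s j => k s j - k s0 j) B.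
have h1 (j : I) (m : unit) : m != tt -> (1 : R[i]) != 0 -> ~~ trivial_power j 0 by case: m.
have h2 (j : I) x : 0 <= \sum_(m : unit) 1 * u j x ^ (- 0).
  by rewrite big_const card_unit /= oppr0 expr0z mulr1 addr0.
move=> /(_ _ _ _ h1 h2 hB') h; apply: le_trans (h _ _ _) => //.
rewrite (bigD1 s0) //= [X in _ + X]big1 => [|s ns]; last first.
  rewrite big_pred0 ?mulr0 // => mu; apply/negP => r.
  case/eqP: ns; apply: inj; rewrite (eq_relation (m := fun j => k s j - k s0 j - 0)) //.
  by move=> j; rewrite subr0.
rewrite addr0 (eq_bigl predT) => [|mu]; last first.
  by apply/asboolP => x; rewrite /monomial big1 // => j _; rewrite subrr subr0 expr0z.
rewrite (eq_bigr (fun=> 1)) => [|mu _]; last by rewrite big1.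
by rewrite sumr_const card_ffun card_unit exp1n mulr1.
Qed.

End Dissociate.

(** * Two Riesz products: one to count relations, one to test polynomials *)

Section SignKernels.
Variables (R : realType) (G : zmodType) (I : finType).
Variable u : I -> G -> R[i].
Hypothesis hu : forall j, unimodular_hom (u j).
Variable d : nat.
Hypothesis hdiss : dissociate u d.

Lemma big_option (T : finType) (A : Type) (idx : A) (op : Monoid.com_law idx)
    (F : option T -> A) :
  \big[op/idx]_m F m = op (F None) (\big[op/idx]_t F (Some t)).
Proof.
rewrite (bigD1 None) //=; congr (op _ _).
by rewrite (reindex_omap Some id) => [|[]] //=; apply: eq_bigl => t; rewrite eqxx.
Qed.

Lemma real_factor_ge0 (T : finType) (w : T -> R[i]) :
  \sum_t cmod (w t) <= 2^-1 -> 0 <= 1 + \sum_t (w t + (w t)^*%C).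
Proof.
move=> hw; have -> : 1 + \sum_t (w t + (w t)^*%C) =
    (1 + 2 * \sum_t complex.Re (w t))%:C%C.
  rewrite rmorphD rmorph1 rmorphM rmorph_nat rmorph_sum /= mulr_sumr.
  by congr (_ + _); apply: eq_bigr => t _; rewrite addcJ.
rewrite ler0c; have h : - \sum_t complex.Re (w t) <= 2^-1.
  apply: le_trans hw; rewrite -sumrN; apply: ler_sum => t _.
  by rewrite (le_trans _ (cmod_Re _)) // -normrN ler_norm.
lra.
Qed.

Definition move_value (m : option ('I_d * bool)) : int :=
  if m is Some (a, b) then (if b then a.+1%:Z else - a.+1%:Z) else 0.

(** The value 1/(2d) keeps the factor 1 + (1/d) (a sum of at most d real parts of powers)
    nonnegative; trivial powers get weight 0 so that the kernel keeps mass 1. *)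
Definition move_weight (j : I) (m : option ('I_d * bool)) : R :=
  if m is Some (a, b) then
    (if trivial_power u j a.+1 then 0 else (2 * d)%:R^-1) else 1.

Lemma move_weight_ge0 j m : 0 <= move_weight j m.
Proof. by case: m => [[a b]|] //=; case: ifP. Qed.

Lemma trivial_powerN j n : trivial_power u j (- n) = trivial_power u j n.
Proof.
apply/asboolP/asboolP => h x; last by rewrite -invr_expz h invr1.
by rewrite -[n]opprK -invr_expz h invr1.
Qed.

(* The weights are the coefficients of a nonnegative kernel, tested against the
   single monomial with exponents kappa. *)
Lemma count_relations (kappa : I -> int) : (0 < d)%N ->
  \sum_(nu : {ffun I -> option ('I_d * bool)} |
      relation u (fun j => kappa j - move_value (nu j)))
    \prod_j move_weight j (nu j) <= 1.
Proof.
move=> d0.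
have := @riesz_transfer _ _ _ u hu d hdiss (option ('I_d * bool)) None
  (fun j m => (move_weight j m)%:C%C) (fun _ => move_value) unit (fun=> 1) (fun=> kappa) 1.
rewrite big_const card_unit /= mul1r addr0 => h.
rewrite -[leLHS]cmod_real_ge0; last first.
  by apply: sumr_ge0 => nu _; apply: prodr_ge0 => j _; exact: move_weight_ge0.
rewrite rmorph_sum /=; under eq_bigr do rewrite rmorph_prod.
apply: h => [j|j|j|j|j x|x].
- by rewrite rmorph1.
- by [].
- case=> [[a b]|] //=.
  have ha : a.+1%:Z <= d%:Z by rewrite lez_nat ltn_ord.
  by case: b; rewrite ?normrN.
- case=> [[a b]|] //= _; case: ifP => [_|ht _]; first by rewrite rmorph0 eqxx.
  by case: b; rewrite ?trivial_powerN ht.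
- rewrite big_option oppr0 expr0z mulr1 rmorph1.
  have -> : \sum_t (move_weight j (Some t))%:C%C * u j x ^ (- move_value (Some t)) =
      \sum_a \sum_b (move_weight j (Some (a, b)))%:C%C *
        u j x ^ (- move_value (Some (a, b))).
    by rewrite pair_bigA; apply: eq_bigr => -[a b].
  under eq_bigr => a _.
    rewrite big_bool /= opprK.
    have -> : u j x ^ a.+1 = (u j x ^ (- a.+1%:Z))^*%C.
      by rewrite conj_unimodular ?cmod_exprz ?(hu j).1 // invr_expz opprK.
    rewrite -[X in _ + X * _]conjc_real -[X in _ + X](rmorphM (@conjc R)).
    over.
  apply: real_factor_ge0.
  have -> : (2^-1 : R) = \sum_(a < d) (2 * d)%:R^-1.
    rewrite sumr_const card_ord -[RHS]mulr_natr natrM invfM mulfVK //.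
    by rewrite pnatr_eq0 -lt0n.
  apply: ler_sum => a _.
  rewrite cmodM cmod_exprz ?(hu j).1 // mulr1 cmod_real_ge0; first by case: ifP.
  by case: ifP.
- by rewrite big_const card_unit /= addr0 mul1r (monomial_hom hu _).1.
Qed.

Definition sign_value (s : I -> nat) (j : I) (m : option bool) : int :=
  if m is Some b then (if b then (s j)%:Z else - (s j)%:Z) else 0.

Definition signed (z : R[i]) (m : option bool) : R[i] :=
  if m is Some b then (if b then z else (z^*)%C) else 1.

(** The numbers [halves m * signed z m] are the coefficients of 1, u^(-s) and u^s in 1 + Re (z
    u^(-s)). *)
Definition halves (m : option bool) : R[i] := if m is Some _ then 2^-1 else 1.

(** The bound is grouped by sign patterns, so that it reads as a polynomial in the z_j and their
    conjugates with coefficients independent of z; in this form the variables can be rotated. *)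
Lemma sign_transfer (s : I -> nat) (z : I -> R[i]) (S : finType) (a : S -> R[i])
    (k : S -> I -> int) (B : R) :
  (forall j, (s j <= d)%N) -> (forall j, cmod (z j) <= 1) ->
  (forall j, z j != 0 -> ~~ trivial_power u j (s j)) ->
  (forall x, cmod (\sum_t a t * monomial u (k t) x) <= B) ->
  cmod (\sum_(mu : {ffun I -> option bool})
     (\prod_j halves (mu j) *
      \sum_(t | relation u (fun j => k t j - sign_value s j (mu j))) a t) *
     \prod_j signed (z j) (mu j)) <= B.
Proof.
move=> sd z1 znt hB.
have := @riesz_transfer _ _ _ u hu d hdiss (option bool) None
  (fun j m => halves m * signed (z j) m) (sign_value s) S a k B.
set X := (X in cmod X <= B) => h.
set Y := (Y in cmod Y <= B); have -> : Y = X.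
  rewrite /X /Y; under [RHS]eq_bigr do rewrite mulr_sumr.
  under [LHS]eq_bigr do rewrite mulr_sumr mulr_suml.
  rewrite [LHS](exchange_big_dep predT) //=; apply: eq_bigr => t _.
  by apply: eq_bigr => mu _; rewrite big_split /= [_ * a t]mulrC -mulrA.
apply: h => // [j|j m|j m|j x].
- by rewrite /= mulr1.
- have sj : (s j)%:Z <= d%:Z by rewrite lez_nat.
  by case: m => [[|]|] //=; rewrite ?normrN.
- case: m => [b|] //= _ hz.
  have zj : z j != 0.
    by apply: contraNneq hz => ->; case: b; rewrite ?rmorph0 mulr0.
  by case: b {hz}; rewrite ?trivial_powerN znt.
- rewrite big_option /= oppr0 expr0z !mulr1 big_bool /= opprK.
  pose w := 2^-1 * z j * u j x ^ (- (s j)%:Z).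
  have -> : 2^-1 * ((z j)^*)%C * u j x ^ s j = (w^*)%C.
    have conjM (a1 b1 : R[i]) : ((a1 * b1)^*)%C = (a1^*)%C * (b1^*)%C by exact: (rmorphM (@conjc R)).
    rewrite /w !conjM conjc_inv conjc_nat.
    by rewrite [X in _ = _ * _ * X]conj_unimodular ?cmod_exprz ?(hu j).1 // invr_expz opprK.
  have := @real_factor_ge0 unit (fun=> w).
  rewrite !big_const card_unit /= !addr0; apply.
  rewrite /w !cmodM cmod_exprz ?(hu j).1 // mulr1 cmodV cmod_nat.
  by rewrite ler_piMr.
Qed.

End SignKernels.

(** * Extraction of the part of degree one in each group *)

Section Homogeneous.
Variables (R : realType) (I : finType) (r : nat) (sigma : I -> option 'I_r).

(** Rotating all variables of group g by one phase multiplies the term of [mu] by that phase to the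
    power (plus signs) - (minus signs) in the group; the condition asks for the power 1. *)
Definition homogeneous (mu : {ffun I -> option bool}) : bool :=
  [forall g, #|[set j | (sigma j == Some g) && (mu j == Some true)]| ==
             #|[set j | (sigma j == Some g) && (mu j == Some false)]|.+1].

(** A 2^n-th root of -1 has order exactly 2^(n+1): a smaller order, being a power of 2, would divide
    2^n. *)
Lemma primitive_root_exists n : exists2 M, (n < M)%N &
  exists2 w : R[i], cmod w = 1 & M.-primitive_root w.
Proof.
pose M := (2 ^ n.+1)%N; pose w : R[i] := (2 ^ n).-root (-1).
have p0 : (0 < 2 ^ n)%N by rewrite expn_gt0.
have w1 : w ^+ (2 ^ n) = -1 by rewrite /w rootCK.
have wM : w ^+ M = 1 by rewrite /M expnSr exprM w1 sqrrN expr1n.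
have M0 : (0 < M)%N by rewrite expn_gt0.
exists M; first by rewrite (ltn_trans (ltnSn n)) // ltn_expl.
exists w.
  have : cmod w ^+ M = 1 by rewrite -cmodX wM cmod1.
  by move/eqP; rewrite pexpr_eq1 ?cmod_ge0 // => /eqP.
have [m pm mM] := prim_order_exists M0 wM.
have [t tn em] := dvdn_pfactor m n.+1 (isT : prime 2) mM.
have [tn'|h] := leqP t n; last first.
  by rewrite /M (_ : n.+1 = t) -?em //; apply/eqP; rewrite eqn_leq h tn.
have : w ^+ (2 ^ n) = 1.
  by apply/eqP; rewrite -(prim_order_dvd pm) em dvdn_exp2l.
by rewrite w1 => /eqP; rewrite eq_sym -subr_eq0 opprK -(natrD _ 1 1) pnatr_eq0.
Qed.

Lemma signedM (z w : R[i]) m : signed (z * w) m = signed z m * signed w m.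
Proof. by case: m => [[|]|] /=; rewrite ?rmorphM ?mulr1. Qed.

Lemma signed1 m : signed (1 : R[i]) m = 1.
Proof. by case: m => [[]|] //; exact: conjc1. Qed.

(** Finite Fourier inversion: averaging over rotations of the groups by M-th roots of unity, against
    the inverse of their product, keeps exactly the terms of degree one in every group. *)
Lemma homogeneous_projection (w : {ffun I -> option bool} -> R[i]) (z : I -> R[i]) (B : R) :
  (forall rot : 'I_r -> R[i], (forall g, cmod (rot g) = 1) ->
    cmod (\sum_mu w mu * \prod_j signed ((if sigma j is Some g then rot g else 1) * z j) (mu j))
      <= B) ->
  cmod (\sum_(mu | homogeneous mu) w mu * \prod_j signed (z j) (mu j)) <= B.
Proof.
(* M exceeds all |plus - minus - 1| <= |I| + 1, so no nonzero exponent vanishes modulo M. *)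
move=> hB; have [M hM [ze ze1 pM]] := primitive_root_exists (2 * #|I|).+2.
have M0 : (0 < M)%N by rewrite (leq_ltn_trans _ hM).
have ze0 : ze != 0 by rewrite -cmod_eq0 ze1 oner_eq0.
pose pl (mu : {ffun I -> option bool}) g := #|[set j | (sigma j == Some g) && (mu j == Some true)]|.
pose mi (mu : {ffun I -> option bool}) g := #|[set j | (sigma j == Some g) && (mu j == Some false)]|.
pose q mu g : int := (pl mu g)%:Z - (mi mu g)%:Z - 1.
pose P (a : {ffun 'I_r -> 'I_M}) := \sum_mu w mu *
  \prod_j signed ((if sigma j is Some g then ze ^+ a g else 1) * z j) (mu j).
have prodrot (a : {ffun 'I_r -> 'I_M}) (mu : {ffun I -> option bool}) :
    \prod_j signed (if sigma j is Some g then ze ^+ a g else 1) (mu j) =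
    \prod_g (ze ^ ((pl mu g)%:Z - (mi mu g)%:Z)) ^+ a g.
  rewrite (partition_big sigma predT) //= big_option /= big1 ?mul1r; last first.
    by move=> j /eqP ->; rewrite signed1.
  apply: eq_bigr => g _.
  rewrite (eq_bigr (fun j => signed (ze ^+ a g) (mu j))) => [|j /eqP -> //].
  rewrite (partition_big (fun j => mu j) predT) //= big_option /= big1 ?mul1r; last first.
    by move=> j /andP[_ /eqP ->].
  rewrite big_bool /=.
  rewrite [X in X * _](eq_bigr (fun=> ze ^+ a g)) => [|j /andP[_ /eqP ->] //].
  rewrite [X in _ * X](eq_bigr (fun=> ze ^- a g)) => [|j /andP[_ /eqP ->] /=]; last first.
    by rewrite conj_unimodular // cmodX ze1 expr1n.
  rewrite !prodr_const expfzDr // exprMn -!exprnP -exprnN !exprVn -!exprM.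
  by rewrite /pl /mi !cardsE ![(a g * _)%N]mulnC.
pose W (mu : {ffun I -> option bool}) : R[i] := w mu * \prod_j signed (z j) (mu j).
have key : \sum_(a : {ffun 'I_r -> 'I_M}) (\prod_g ze ^- (a g)) * P a =
    (M ^ r)%:R * \sum_(mu | homogeneous mu) W mu.
  rewrite /P; under eq_bigr do rewrite mulr_sumr.
  rewrite exchange_big /= [in RHS]big_mkcond mulr_sumr; apply: eq_bigr => nu _.
  have -> : \sum_(a : {ffun 'I_r -> 'I_M}) (\prod_g ze ^- (a g)) * (w nu *
      \prod_j signed ((if sigma j is Some g then ze ^+ a g else 1) * z j) (nu j)) =
      W nu * \prod_g \sum_(a < M) (ze ^ q nu g) ^+ a.
    rewrite bigA_distr_bigA mulr_sumr; apply: eq_bigr => a _.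
    under [X in _ * (_ * X)]eq_bigr do rewrite signedM.
    rewrite big_split /= prodrot.
    transitivity (W nu * ((\prod_g ze ^- a g) *
      \prod_g (ze ^ ((pl nu g)%:Z - (mi nu g)%:Z)) ^+ a g)); first by rewrite /W; ring.
    congr (_ * _); rewrite -big_split; apply: eq_bigr => g _ /=.
    rewrite /q (expfzDr _ (-1)) // exprMn mulrC; congr (_ * _).
    by rewrite -exprVn -exprN1.
  have geo g : \sum_(a < M) (ze ^ q nu g) ^+ a =
      if pl nu g == (mi nu g).+1 then M%:R else 0.
    case: ifP => [/eqP e|ne].
      rewrite (eq_bigr (fun=> 1)) => [|a _]; first by rewrite sumr_const card_ord.
      by rewrite /q e (_ : _ - _ - 1 = 0) ?expr0z ?expr1n //; lia.
    have qn : ze ^ q nu g != 1.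
      have bp : (pl nu g <= #|I|)%N by exact: max_card.
      have bm : (mi nu g <= #|I|)%N by exact: max_card.
      have nz (n : nat) : (0 < n < M)%N -> ze ^+ n != 1.
        by case/andP=> n0 nM; rewrite -(prim_order_dvd pM) gtnNdvd.
      have [q0|q0] := lerP 0 (q nu g).
        have -> : q nu g = `|q nu g|%N%:Z by lia.
        by rewrite -exprnP nz //; move: ne q0; rewrite /q => /eqP; lia.
      have -> : q nu g = - `|q nu g|%N%:Z by lia.
      rewrite -invr_expz invr_eq1 -exprnP nz //; move: q0; rewrite /q; lia.
    have z1 : (ze ^ q nu g - 1) * \sum_(a < M) (ze ^ q nu g) ^+ a = 0.
      by rewrite -subrX1 exprnP exprzAC -exprnP (prim_expr_order pM) exp1rz subrr.
    by move/eqP: z1; rewrite mulf_eq0 subr_eq0 (negPf qn) => /eqP.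
  rewrite (eq_bigr (fun g => if pl nu g == (mi nu g).+1 then M%:R else 0)) => [|g _] //.
  case: ifP => [/forallP h|/negbT].
    rewrite (eq_bigr (fun=> M%:R)) => [|g _]; last by rewrite (h g).
    by rewrite prodr_const card_ord -natrX mulrC.
  rewrite negb_forall => /existsP[g hg].
  by rewrite mulr0 (bigD1 g) //= (negPf hg) mul0r mulr0.
have Mr0 : 0 < (M ^ r)%:R :> R by rewrite ltr0n expn_gt0 M0.
have : cmod (\sum_(a : {ffun 'I_r -> 'I_M}) (\prod_g ze ^- (a g)) * P a) <= (M ^ r)%:R * B.
  rewrite (le_trans (cmod_sum _ _)) // (le_trans (ler_sum _ (G := fun=> B) _)) //.
    move=> a _; rewrite cmodM cmod_prod big1 ?mul1r => [|g _].
      by apply: hB => g; rewrite cmodX ze1 expr1n.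
    by rewrite cmodV cmodX ze1 expr1n invr1.
  by rewrite sumr_const card_ffun !card_ord mulr_natl.
by rewrite key cmodM cmod_nat ler_pM2l.
Qed.

End Homogeneous.

(** * Bounds for multilinear forms *)

Section FiniteInequalities.
Variable R : realType.

Lemma cauchy_schwarz_sum (T : finType) (P : pred T) (x y : T -> R) :
  (\sum_(i | P i) x i * y i) ^+ 2 <=
  (\sum_(i | P i) x i ^+ 2) * (\sum_(i | P i) y i ^+ 2).
Proof.
have : 0 <= \sum_(i | P i) \sum_(j | P j) (x i * y j - x j * y i) ^+ 2.
  by apply: sumr_ge0 => i _; apply: sumr_ge0 => j _; exact: sqr_ge0.
have -> : \sum_(i | P i) \sum_(j | P j) (x i * y j - x j * y i) ^+ 2 =
    2 * ((\sum_(i | P i) x i ^+ 2) * (\sum_(i | P i) y i ^+ 2)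
         - (\sum_(i | P i) x i * y i) ^+ 2).
  rewrite (eq_bigr (fun i => \sum_(j | P j) x i ^+ 2 * y j ^+ 2 +
     \sum_(j | P j) y i ^+ 2 * x j ^+ 2 -
     2 * (\sum_(j | P j) (x i * y i) * (x j * y j)))) => [|i _]; last first.
    rewrite mulr_sumr -big_split /= -sumrB; apply: eq_bigr => j _; ring.
  by rewrite sumrB big_split /= -mulr_sumr -!big_distrlr /=; ring.
by rewrite pmulr_rge0 // subr_ge0.
Qed.

Lemma sqrt_cauchy_schwarz (T : finType) (P : pred T) (x y : T -> R) :
  \sum_(i | P i) x i * y i <=
  Num.sqrt (\sum_(i | P i) x i ^+ 2) * Num.sqrt (\sum_(i | P i) y i ^+ 2).
Proof.
have s0 (z : T -> R) : 0 <= \sum_(i | P i) z i ^+ 2.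
  by apply: sumr_ge0 => i _; exact: sqr_ge0.
rewrite -sqrtrM //; apply: le_trans (ler_norm _) _.
by rewrite -sqrtr_sqr ler_wsqrtr // cauchy_schwarz_sum.
Qed.

End FiniteInequalities.

(** * Khintchine's inequality for Walsh polynomials of bounded degree *)

Section Khintchine.
Variables (R : realType) (I : finType).
Implicit Types (e : {ffun I -> bool}) (U V : {set I}).

Definition walsh U e : R := \prod_(j in U) (-1) ^+ e j.

Definition mean (F : {ffun I -> bool} -> R) : R :=
  (2 ^+ #|I|)^-1 * \sum_e F e.

Definition flip (j : I) e : {ffun I -> bool} := [ffun i => (i == j) (+) e i].

Lemma flipK j : involutive (flip j).
Proof. by move=> e; apply/ffunP => i; rewrite !ffunE addKb. Qed.

Lemma mean_flip j F : mean F = mean (fun e => F (flip j e)).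
Proof. by rewrite /mean (reindex_inj (inv_inj (flipK j))). Qed.

Lemma meanD F H : mean (fun e => F e + H e) = mean F + mean H.
Proof. by rewrite /mean big_split mulrDr. Qed.

Lemma meanZ a F : mean (fun e => a * F e) = a * mean F.
Proof. by rewrite /mean -mulr_sumr mulrCA. Qed.

Lemma mean_const a : mean (fun=> a) = a.
Proof.
by rewrite /mean sumr_const card_ffun card_bool -[a *+ _]mulr_natl natrX mulKf.
Qed.

Lemma ler_mean F H : (forall e, F e <= H e) -> mean F <= mean H.
Proof.
by move=> h; rewrite /mean ler_wpM2l ?invr_ge0 ?exprn_ge0 // ler_sum.
Qed.

Lemma eq_mean F H : F =1 H -> mean F = mean H.
Proof. by move=> h; rewrite /mean; congr (_ * _); apply: eq_bigr. Qed.

Lemma mean_ge0 F : (forall e, 0 <= F e) -> 0 <= mean F.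
Proof. by move=> h; rewrite -(mean_const 0) ler_mean. Qed.

Lemma mean_cauchy_schwarz F H :
  mean (fun e => F e * H e) ^+ 2 <= mean (fun e => F e ^+ 2) * mean (fun e => H e ^+ 2).
Proof.
rewrite /mean exprMn [leRHS]mulrACA -[X in _ <= X * _]expr2 ler_wpM2l ?sqr_ge0 //.
exact: cauchy_schwarz_sum.
Qed.

Lemma walsh_flip j U e : j \notin U -> walsh U (flip j e) = walsh U e.
Proof.
move=> jU; apply: eq_bigr => i iU; rewrite ffunE.
by rewrite (_ : (i == j) = false) //; apply: contraNF jU => /eqP <-.
Qed.

Lemma walshU1 j U e : j \notin U -> walsh (j |: U) e = (-1) ^+ e j * walsh U e.
Proof. by move=> jU; rewrite /walsh big_setU1. Qed.

Lemma sum_subset_setU1 (A : nmodType) j V (F : {set I} -> A) : j \notin V ->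
  \sum_(U : {set I} | U \subset j |: V) F U =
  \sum_(U : {set I} | U \subset V) F U + \sum_(U : {set I} | U \subset V) F (j |: U).
Proof.
move=> jV; rewrite (bigID (fun U => j \in U)) /= [LHS]addrC; congr (_ + _).
  apply: eq_bigl => U; apply/andP/idP => [[/fintype.subsetP s jU]|s].
    apply/fintype.subsetP => i iU; have := s i iU; rewrite in_setU1 => /orP[/eqP e|//].
    by rewrite e in iU; rewrite iU in jU.
  by rewrite finset.subsetU ?s ?orbT //; split=> //; apply: contra jV => /(fintype.subsetP s).
rewrite (reindex_onto (fun U => j |: U) (fun U => U :\ j)) /=; last first.
  by move=> U /andP[_ jU]; rewrite finset.setD1K.
apply: eq_bigl => U; rewrite in_setU1 eqxx andbT; apply/andP/idP.
  case=> [s /eqP e]; apply/fintype.subsetP => i iU.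
  have : i \in (j |: U) :\ j by rewrite e.
  by rewrite in_setD1 => /andP[ij iu]; have := fintype.subsetP s i iu; rewrite in_setU1 (negPf ij).
move=> s; have jU : j \notin U by apply: contra jV => /(fintype.subsetP s).
by rewrite finset.setUS // finset.setU1K // eqxx.
Qed.

Definition walsh_sum V (a : {set I} -> R) e : R :=
  \sum_(U : {set I} | U \subset V) a U * walsh U e.

Lemma walsh_sumU1 j V a e : j \notin V ->
  walsh_sum (j |: V) a e =
  walsh_sum V a e + (-1) ^+ e j * walsh_sum V (fun U => a (j |: U)) e.
Proof.
move=> jV; rewrite /walsh_sum sum_subset_setU1 //; congr (_ + _).
rewrite mulr_sumr; apply: eq_bigr => U s.
have jU : j \notin U by apply: contra jV; exact: (fintype.subsetP s).
by rewrite walshU1 // mulrCA.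
Qed.

Lemma walsh_sum_flip j V a e : j \notin V ->
  walsh_sum V a (flip j e) = walsh_sum V a e.
Proof.
move=> jV; apply: eq_bigr => U s; rewrite walsh_flip //.
by apply: contra jV; exact: (fintype.subsetP s).
Qed.

(** Induction on V: splitting off the sign at j writes the sum as g + eps_j h, and averaging over
    eps_j leaves E g^4 + 6 E g^2 h^2 + E h^4. As h has degree one less, Cauchy-Schwarz gives 3 E g^2
    h^2 <= 9^m A B for the squared norms A of g and B of h, which completes the square. *)
Lemma bonami m V a : (forall U, (m < #|U|)%N -> a U = 0) ->
  mean (fun e => walsh_sum V a e ^+ 2) = \sum_(U : {set I} | U \subset V) a U ^+ 2 /\
  mean (fun e => walsh_sum V a e ^+ 4) <=
    9 ^+ m * (\sum_(U : {set I} | U \subset V) a U ^+ 2) ^+ 2.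
Proof.
move: {2}#|V| (erefl #|V|) => n.
elim: n m V a => [|n IH] m V a hV ha.
  have {hV}-> : V = finset.set0 by apply/eqP; rewrite -cards_eq0 hV.
  have E e : walsh_sum finset.set0 a e = a finset.set0.
    rewrite /walsh_sum (big_pred1 finset.set0) => [|U]; last by rewrite finset.subset0.
    by rewrite /walsh big_set0 mulr1.
  rewrite (big_pred1 finset.set0) => [|U]; last by rewrite finset.subset0.
  rewrite (eq_mean (H := fun=> a finset.set0 ^+ 2)) => [|e]; last by rewrite E.
  rewrite [X in X <= _](eq_mean (H := fun=> a finset.set0 ^+ 4)) => [|e]; last by rewrite E.
  rewrite !mean_const -exprM; split=> //.
  by rewrite ler_peMl ?exprn_even_ge0 // exprn_ege1 // ler1n.
have [j jV] : exists j, j \in V by apply/finset.set0Pn; rewrite -card_gt0 hV.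
rewrite -(finset.setD1K jV); set V' := V :\ j.
have jV' : j \notin V' by rewrite in_setD1 eqxx.
have cV' : #|V'| = n by move: hV; rewrite (cardsD1 j) jV => -[].
(* Cutting off the sets that contain j leaves the sum over subsets of V' unchanged and makes the
   degree bound hold for all U, as the induction hypothesis demands. *)
pose b U := if j \in U then 0 else a (j |: U).
pose g := walsh_sum V' a; pose h := walsh_sum V' b.
have E e : walsh_sum (j |: V') a e = g e + (-1) ^+ e j * h e.
  rewrite walsh_sumU1 //; congr (_ + _ * _); apply: eq_bigr => U s.
  by rewrite /b ifF //; apply: contraNF jV' => /(fintype.subsetP s).
have Ef e : walsh_sum (j |: V') a (flip j e) = g e - (-1) ^+ e j * h e.
  by rewrite E /g /h !walsh_sum_flip // ffunE eqxx /= signrN mulNr.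
have s2 e : ((-1) ^+ e j : R) ^+ 2 = 1 by rewrite sqrr_sign.
have Sb : \sum_(U : {set I} | U \subset j |: V') a U ^+ 2 =
   \sum_(U : {set I} | U \subset V') a U ^+ 2 + \sum_(U : {set I} | U \subset V') b U ^+ 2.
  rewrite sum_subset_setU1 //; congr (_ + _); apply: eq_bigr => U s.
  by rewrite /b ifF //; apply: contraNF jV' => /(fintype.subsetP s).
have [g2 g4] := IH m V' a cV' ha.
have m2 : mean (fun e => walsh_sum (j |: V') a e ^+ 2) =
    mean (fun e => g e ^+ 2) + mean (fun e => h e ^+ 2).
  apply: (@mulfI _ 2) => //; rewrite mulr2n mulrDl mul1r {2}(mean_flip j) -meanD -meanD -meanZ.
  by apply: eq_mean => e; rewrite E Ef; have := s2 e; set x := (-1) ^+ _ => sx; ring: sx.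
have m4 : mean (fun e => walsh_sum (j |: V') a e ^+ 4) =
    mean (fun e => g e ^+ 4) + 6 * mean (fun e => g e ^+ 2 * h e ^+ 2) + mean (fun e => h e ^+ 4).
  apply: (@mulfI _ 2) => //; rewrite mulr2n mulrDl mul1r {2}(mean_flip j) -meanD -meanZ -!meanD -meanZ.
  by apply: eq_mean => e; rewrite E Ef; have := s2 e; set x := (-1) ^+ _ => sx; ring: sx.
case: m ha g4 => [|m] ha g4.
  have b0 U : b U = 0.
    rewrite /b; case: ifP => // /negbT jU; apply: ha.
    by rewrite cardsU1 jU.
  have h0 e : h e = 0 by rewrite /h /walsh_sum big1 // => U _; rewrite b0 mul0r.
  rewrite m2 m4 Sb [X in _ + X = _ + _](eq_mean (H := fun=> 0)) => [|e]; last by rewrite h0 expr0n.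
  rewrite [X in _ + _ * X + _](eq_mean (H := fun=> 0)) => [|e]; last by rewrite h0 expr0n mulr0.
  rewrite [X in _ + _ + X <= _](eq_mean (H := fun=> 0)) => [|e]; last by rewrite h0 expr0n.
  rewrite [X in _ = _ + X]big1 => [|U _]; last by rewrite b0 expr0n.
  rewrite [X in (_ + X) ^+ 2]big1 => [|U _]; last by rewrite b0 expr0n.
  by rewrite !mean_const mulr0 !addr0.
have hb U : (m < #|U|)%N -> b U = 0.
  move=> mU; rewrite /b; case: ifP => // /negbT jU; apply: ha.
  by rewrite cardsU1 jU.
have [h2 h4] := IH m V' b cV' hb.
rewrite m2 m4 Sb g2 h2; split=> //.
set A := \sum_(U : {set I} | _) a U ^+ 2 in g4 *.
set B := \sum_(U : {set I} | _) b U ^+ 2 in h4 *.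
have A0 : 0 <= A by apply: sumr_ge0 => U _; exact: sqr_ge0.
have B0 : 0 <= B by apply: sumr_ge0 => U _; exact: sqr_ge0.
have q0 : 0 <= 9 ^+ m :> R by rewrite exprn_ge0.
have hX : 3 * mean (fun e => g e ^+ 2 * h e ^+ 2) <= 9 ^+ m.+1 * (A * B).
  have X0 : 0 <= mean (fun e => g e ^+ 2 * h e ^+ 2).
    by apply: mean_ge0 => e; rewrite mulr_ge0 ?sqr_ge0.
  have r0 : 0 <= 9 ^+ m.+1 * (A * B) by rewrite mulr_ge0 ?exprn_ge0 // mulr_ge0.
  rewrite -ler_sqr ?nnegrE //; last by rewrite mulr_ge0.
  have cs := mean_cauchy_schwarz (fun e => g e ^+ 2) (fun e => h e ^+ 2).
  have e4 (f : {ffun I -> bool} -> R) : mean (fun e => (f e ^+ 2) ^+ 2) = mean (fun e => f e ^+ 4).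
    by apply: eq_mean => e; rewrite -exprM.
  rewrite !e4 in cs.
  have : mean (fun e => g e ^+ 4) * mean (fun e => h e ^+ 4) <=
     (9 ^+ m.+1 * A ^+ 2) * (9 ^+ m * B ^+ 2).
    by apply: ler_pM => //; apply: mean_ge0 => e; rewrite exprn_even_ge0.
  move=> le2; rewrite exprMn.
  apply: le_trans (_ : 3 ^+ 2 * ((9 ^+ m.+1 * A ^+ 2) * (9 ^+ m * B ^+ 2)) <= _).
    by rewrite ler_wpM2l // (le_trans cs).
  by rewrite le_eqVlt; apply/orP; left; apply/eqP; rewrite !(exprS 9 m); ring.
rewrite (exprS 9 m) in g4; rewrite (exprS 9 m) in hX; rewrite (exprS 9 m).
have : 9 ^+ m * B ^+ 2 <= 9 * 9 ^+ m * B ^+ 2.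
  by rewrite ler_wpM2r ?sqr_ge0 // ler_peMl // ler1n.
lra.
Qed.

(** Bounds a first moment from below by second and fourth moments, in place of Hoelder's inequality.
    With y = x/t it says y (1 - y + y^3/4) >= 0. *)
Lemma l1_ge_l2_l4 (x t : R) : 0 <= x -> 0 < t -> x ^+ 2 / t - x ^+ 4 / (4 * t ^+ 3) <= x.
Proof.
move=> x0 t0; rewrite -subr_ge0.
have tn : t != 0 by rewrite gt_eqF.
have -> : x - (x ^+ 2 / t - x ^+ 4 / (4 * t ^+ 3)) =
   x * ((1 - (x / t) / 2) ^+ 2 + (x / t) ^+ 2 * ((x / t) - 1) / 4).
  by field.
rewrite mulr_ge0 //; have : 0 <= x / t by rewrite divr_ge0 // ltW.
set y := x / t => y0.
have : 0 <= y * (y - 1) ^+ 2 by rewrite mulr_ge0 ?sqr_ge0.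
nra.
Qed.

Lemma khintchine_real m a : (forall U, (m < #|U|)%N -> a U = 0) ->
  Num.sqrt (\sum_U a U ^+ 2) <= 4 / 3 * 3 ^+ m * mean (fun e => `|\sum_U a U * walsh U e|).
Proof.
move=> ha; have [m2 m4] := bonami finset.setT ha.
have eT (F : {set I} -> R) : \sum_(U : {set I} | U \subset finset.setT) F U = \sum_U F U.
  by apply: eq_bigl => U; rewrite finset.subsetT.
rewrite !eT in m2 m4; set V := \sum_U a U ^+ 2 in m2 m4 *.
set M := mean _; have V0 : 0 <= V by apply: sumr_ge0 => U _; exact: sqr_ge0.
have M0 : 0 <= M by apply: mean_ge0.
have [->|Vn] := eqVneq V 0; first by rewrite sqrtr0 mulr_ge0 // mulr_ge0 // exprn_ge0.
set s := Num.sqrt V; have s0 : 0 < s by rewrite sqrtr_gt0 lt_neqAle eq_sym Vn.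
have sV : s ^+ 2 = V by rewrite sqr_sqrtr.
(* This t makes the fourth-moment term a quarter of the second-moment term. *)
pose t := 3 ^+ m * s; have t30 : 0 < 3 ^+ m :> R by rewrite exprn_gt0.
have t0 : 0 < t by rewrite mulr_gt0.
have : V / t - 9 ^+ m * V ^+ 2 / (4 * t ^+ 3) <= M.
  apply: le_trans (_ : mean (fun e => (walsh_sum finset.setT a e) ^+ 2) / t -
    mean (fun e => (walsh_sum finset.setT a e) ^+ 4) / (4 * t ^+ 3) <= _).
    by rewrite m2 lerB // ler_wpM2r // invr_ge0 mulr_ge0 // exprn_ge0 // ltW.
  rewrite ![_ / _]mulrC -!meanZ -mulN1r -meanZ -meanD; apply: ler_mean => e.
  rewrite /walsh_sum eT; set x := \sum_U _.
  have := @l1_ge_l2_l4 `|x| t (normr_ge0 _) t0.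
  have x2 : `|x| ^+ 2 = x ^+ 2 by rewrite real_normK ?num_real.
  have -> : `|x| ^+ 4 = x ^+ 4 by rewrite (exprM _ 2 2) x2 -exprM.
  by rewrite x2 mulN1r ![_^-1 * _]mulrC.
have -> : V / t - 9 ^+ m * V ^+ 2 / (4 * t ^+ 3) = 3 / 4 * (s / 3 ^+ m).
  rewrite -sV /t (_ : 9 ^+ m = (3 ^+ m) ^+ 2); last first.
    by rewrite -exprM mulnC exprM; congr (_ ^+ _); ring.
  by field; rewrite !gt_eqF.
move=> h; have : s = 4 / 3 * 3 ^+ m * (3 / 4 * (s / 3 ^+ m)).
  by field; rewrite gt_eqF.
by move=> ->; rewrite ler_wpM2l // mulr_ge0 // ltW.
Qed.

Lemma sqrtD_le (x y : R) : 0 <= x -> 0 <= y ->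
  Num.sqrt (x + y) <= Num.sqrt x + Num.sqrt y.
Proof.
move=> x0 y0; rewrite -[leRHS]ger0_norm ?addr_ge0 ?sqrtr_ge0 // -sqrtr_sqr ler_wsqrtr //.
by rewrite sqrrD !sqr_sqrtr // addrAC lerDl mulrn_wge0 // mulr_ge0 ?sqrtr_ge0.
Qed.

(** Real and imaginary parts are estimated separately; 2 (4/3) is below 3. *)
Lemma khintchine m (a : {set I} -> R[i]) : (forall U, (m < #|U|)%N -> a U = 0) ->
  Num.sqrt (\sum_U cmod (a U) ^+ 2) <=
  3 ^+ m.+1 * mean (fun e => cmod (\sum_U a U * (walsh U e)%:C%C)).
Proof.
move=> ha; set f := fun e => \sum_U a U * (walsh U e)%:C%C.
have f0 : 0 <= mean (fun e => cmod (f e)) by apply: mean_ge0 => e; exact: cmod_ge0.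
have hre : Num.sqrt (\sum_U (complex.Re (a U)) ^+ 2) <= 4 / 3 * 3 ^+ m * mean (fun e => cmod (f e)).
  have := @khintchine_real m (fun U => complex.Re (a U)).
  move=> /(_ _)/le_trans; apply=> [U /ha -> //|].
  rewrite ler_wpM2l ?mulr_ge0 ?exprn_ge0 //; apply: ler_mean => e.
  apply: le_trans (cmod_Re _); rewrite le_eqVlt; apply/orP; left; apply/eqP; congr (`|_|).
  rewrite /f (raddf_sum (@complex.Re R)); apply: eq_bigr => U _.
  by case: (a U) => x y /=; rewrite mulr0 subr0.
have him : Num.sqrt (\sum_U (complex.Im (a U)) ^+ 2) <= 4 / 3 * 3 ^+ m * mean (fun e => cmod (f e)).
  have := @khintchine_real m (fun U => complex.Im (a U)).
  move=> /(_ _)/le_trans; apply=> [U /ha -> //|].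
  rewrite ler_wpM2l ?mulr_ge0 ?exprn_ge0 //; apply: ler_mean => e.
  have -> : cmod (f e) = cmod (f e * - 'i%C).
    rewrite cmodM cmodN -[LHS]mulr1; congr (_ * _).
    by apply: complexI; rewrite -cmodE normc_def /= expr0n expr1n add0r sqrtr1.
  apply: le_trans (cmod_Re _); rewrite le_eqVlt; apply/orP; left; apply/eqP; congr (`|_|).
  rewrite mulrN raddfN /= ReiNIm opprK /f (raddf_sum (@complex.Im R)); apply: eq_bigr => U _.
  by case: (a U) => x y /=; rewrite mulr0 add0r.
rewrite (eq_bigr (fun U => complex.Re (a U) ^+ 2 + complex.Im (a U) ^+ 2)) => [|U _]; last first.
  exact: cmod_sqrE.
rewrite big_split; apply: le_trans (sqrtD_le _ _) _.
- by apply: sumr_ge0 => U _; exact: sqr_ge0.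
- by apply: sumr_ge0 => U _; exact: sqr_ge0.
apply: le_trans (lerD hre him) _; rewrite -mulrDl ler_wpM2r // exprS.
have : 0 <= 3 ^+ m :> R by rewrite exprn_ge0.
lra.
Qed.

End Khintchine.

Section GeometricMean.
Variable R : realType.

(** Replacing both bases by the larger one already suffices; the sharp weights are dispensable. *)
Lemma weighted_geometric_mean_le (x w s : R) : 0 <= x -> 0 <= w -> 0 <= s <= 1 ->
  x `^ (1 - s) * w `^ s <= x + w.
Proof.
move=> x0 w0 /andP[s0 s1].
have [->|xn] := eqVneq x 0.
  have [e|ne] := eqVneq (1 - s) 0.
    by rewrite e powRr0 mul1r add0r (_ : s = 1) ?powRr1 //; lra.
  by rewrite powR0 // mul0r add0r.
have [->|wn] := eqVneq w 0.
  have [->|ne] := eqVneq s 0; first by rewrite powRr0 mulr1 subr0 powRr1 // addr0.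
  by rewrite powR0 // mulr0 addr0.
have self (t : R) : 0 <= t -> t != 0 -> t `^ (1 - s) * t `^ s = t.
  by move=> t0 tn; rewrite -powRD ?tn ?implybT // subrK powRr1.
have s1' : 0 <= 1 - s by lra.
have [xw|/ltW wx] := lerP x w.
  apply: le_trans (_ : w `^ (1 - s) * w `^ s <= _); last by rewrite self // lerDr.
  by rewrite ler_wpM2r ?powR_ge0 // ge0_ler_powR.
apply: le_trans (_ : x `^ (1 - s) * x `^ s <= _); last by rewrite self // lerDl.
by rewrite ler_wpM2l ?powR_ge0 // ge0_ler_powR.
Qed.

End GeometricMean.

Lemma bin_leq_exp n k : ('C(n, k) <= n ^ k)%N.
Proof.
have h : (n ^_ k <= n ^ k)%N.
  elim: k => [|k IH]; first by rewrite ffactn0.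
  by rewrite ffactnSr expnSr leq_mul // leq_subr.
by apply: leq_trans h; rewrite -bin_ffact leq_pmulr ?fact_gt0.
Qed.

(** * The Bohnenblust-Hille inequality and its mixed norm form *)

Section MultilinearForms.
Variables (R : realType) (I : finType) (r : nat) (sigma : I -> option 'I_r).
Implicit Types U : {set I}.

(** Monomials of an r-linear form, with one variable from each group, are encoded by their sets of
    indices. *)
Definition transversal U : bool :=
  [forall j in U, sigma j != None] &&
  [forall g, #|[set j in U | sigma j == Some g]| == 1%N].

Lemma card_transversal U : transversal U -> #|U| = r.
Proof.
case/andP=> /forall_inP act /forallP one.
rewrite -sum1_card (partition_big sigma predT) //= big_option /=.
rewrite big1 => [|j /andP[/act + /eqP e]]; last by rewrite e eqxx.
rewrite add0n (eq_bigr (fun=> 1%N)) => [|g _]; first by rewrite sum1_card card_ord.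
rewrite sum1_card -(eqP (one g)); apply: eq_card => j; by rewrite !inE.
Qed.

Lemma transversal_inj U i j g : transversal U -> i \in U -> j \in U ->
  sigma i = Some g -> sigma j = Some g -> i = j.
Proof.
case/andP=> _ /forallP/(_ g)/cards1P[x hx] iU jU si sj.
have : i \in [set j in U | sigma j == Some g] by rewrite inE iU si eqxx.
have : j \in [set j in U | sigma j == Some g] by rewrite inE jU sj eqxx.
by rewrite hx !inE => /eqP -> /eqP ->.
Qed.

Lemma sum_transversal (A : nmodType) (g : 'I_r) (F : {set I} -> A) :
  \sum_(i | sigma i == Some g) \sum_(U | transversal U && (i \in U)) F U =
  \sum_(U | transversal U) F U.
Proof.
rewrite (exchange_big_dep transversal) /=; last by move=> i U _ /andP[].
apply: eq_bigr => U tU; have /andP[_ /forallP/(_ g)/eqP one] := tU.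
rewrite (eq_bigl (fun i => i \in [set j in U | sigma j == Some g])) => [|i].
  by rewrite sumr_const one.
by rewrite inE tU andbC.
Qed.

Variable a : {set I} -> R[i].

Definition form (z : I -> R[i]) : R[i] :=
  \sum_(U | transversal U) a U * \prod_(j in U) z j.

Variable B : R.
Hypothesis hB : forall z, (forall j, cmod (z j) <= 1) -> cmod (form z) <= B.

Lemma form_bound_ge0 : 0 <= B.
Proof. by apply: le_trans (cmod_ge0 _) (hB (z := fun=> 0) _) => j; rewrite cmod0. Qed.

(** For fixed i the coefficients of the sets through i form a Walsh polynomial of degree r - 1 in
    the other groups. Khintchine compares its l2 norm with a mean over signs, and for each choice of
    signs suitable phases in group g align the values. *)
Lemma mixed_norm_bound (g : 'I_r) :
  \sum_(i | sigma i == Some g)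
     Num.sqrt (\sum_(U | transversal U && (i \in U)) cmod (a U) ^+ 2) <= 3 ^+ r * B.
Proof.
pose b i U := if (i \notin U) && transversal (i |: U) then a (i |: U) else 0.
pose f i (e : {ffun I -> bool}) := \sum_U b i U * (walsh R U e)%:C%C.
have reb i (A : nmodType) (F : {set I} -> A) :
    \sum_(U | transversal U && (i \in U)) F U =
    \sum_(U : {set I} | (i \notin U) && transversal (i |: U)) F (i |: U).
  rewrite (reindex_onto (fun U => i |: U) (fun U => U :\ i)) /=; last first.
    by move=> U /andP[_ iU]; rewrite finset.setD1K.
  apply: eq_bigl => U; rewrite in_setU1 eqxx andbT andbC; congr (_ && _).
  apply/eqP/idP => [<-|iU]; last by rewrite finset.setU1K.
  by rewrite in_setD1 eqxx.
have step1 i : sigma i == Some g ->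
    Num.sqrt (\sum_(U | transversal U && (i \in U)) cmod (a U) ^+ 2) <=
    3 ^+ r * mean (fun e => cmod (f i e)).
  move=> _; have r0 : (0 < r)%N by case: (r) g => [[]|].
  rewrite reb -[r in 3 ^+ r](prednK r0).
  have := @khintchine R I r.-1 (b i).
  rewrite (_ : \sum_(U | _) _ = \sum_U cmod (b i U) ^+ 2); last first.
    rewrite [LHS]big_mkcond; apply: eq_bigr => U _; rewrite /b.
    by case: ifP => // _; rewrite cmod0 expr0n.
  apply=> U hU; rewrite /b; case: ifP => // /andP[iU /card_transversal].
  by rewrite cardsU1 iU => h; move: hU; rewrite -h ltnn.
apply: le_trans (ler_sum _ step1) _; rewrite -mulr_sumr ler_wpM2l ?exprn_ge0 //.
have -> : \sum_(i | sigma i == Some g) mean (fun e => cmod (f i e)) =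
    mean (fun e => \sum_(i | sigma i == Some g) cmod (f i e)).
  by rewrite /mean -mulr_sumr exchange_big.
rewrite -(mean_const I B); apply: ler_mean => e.
pose z j := if sigma j == Some g then phase (f j e) else ((-1) ^+ e j)%:C%C.
have z1 j : cmod (z j) <= 1.
  rewrite /z; case: ifP => _; first exact: cmod_phase.
  by rewrite cmod_real normrX normrN1 expr1n.
have := hB z1; rewrite /form -(sum_transversal g).
have -> : \sum_(i | sigma i == Some g) \sum_(U | transversal U && (i \in U))
    a U * \prod_(j in U) z j = (\sum_(i | sigma i == Some g) cmod (f i e))%:C%C.
  rewrite rmorph_sum /=; apply: eq_bigr => i si; rewrite reb -mul_phase.
  rewrite {1}/f mulr_suml [RHS](bigID (fun U => (i \notin U) && transversal (i |: U))) /=.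
  rewrite [X in _ = _ + X]big1 ?addr0 => [|U /negPf hU]; last by rewrite /b hU !mul0r.
  apply: eq_bigr => U hU; rewrite /b hU -mulrA; congr (_ * _).
  have /andP[iU tU] := hU; rewrite big_setU1 //= mulrC; congr (_ * _); last by rewrite /z si.
  rewrite /walsh rmorph_prod; apply: eq_bigr => j jU; rewrite /z ifF //.
  apply: contraNF iU => /eqP sj.
  rewrite (transversal_inj tU (i := i) (j := j) _ _ (eqP si) sj) //.
    by rewrite in_setU1 eqxx.
  by rewrite in_setU1 jU orbT.
by rewrite cmod_real_ge0 //; apply: sumr_ge0 => i _; exact: cmod_ge0.
Qed.

(** The factor r sums over the groups, 3^r comes from [mixed_norm_bound], and the root bounds the l2
    norm of the weights charged to one index. *)
Definition bohnenblust_hille_constant : R :=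
  r%:R * 3 ^+ r * Num.sqrt (1 + r%:R ^+ r.-1).

(** Normalize to a probability y on the transversal sets, with marginals alpha. Then T^(1/q) is the
    sum of the |a_U| y_U^((1-1/r)/2). Charge each U to an index j of smallest alpha_j and apply
    Cauchy-Schwarz for each j: one factor is the mixed norm, the other is bounded because few sets
    are charged to j. *)
Lemma bohnenblust_hille : (0 < r)%N ->
  \sum_(U | transversal U) cmod (a U) `^ (2 * r%:R / (r%:R + 1)) <=
  (bohnenblust_hille_constant * B) `^ (2 * r%:R / (r%:R + 1)).
Proof.
move=> r0; set q := 2 * r%:R / (r%:R + 1) : R.
have rR : (0 : R) < r%:R by rewrite ltr0n.
have q0 : 0 < q by rewrite divr_gt0 ?mulr_gt0 // addr_gt0.
set T := \sum_(U | _) _; have T0 : 0 <= T by apply: sumr_ge0 => U _; exact: powR_ge0.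
have K0 : 0 <= bohnenblust_hille_constant.
  by rewrite !mulr_ge0 ?sqrtr_ge0 ?exprn_ge0 // ltW.
have [->|Tn] := eqVneq T 0; first exact: powR_ge0.
have Tp : 0 < T by rewrite lt_neqAle eq_sym Tn.
suff h : T `^ q^-1 <= bohnenblust_hille_constant * B.
  rewrite -[T]powRr1 // -(mulVf (lt0r_neq0 q0)) powRrM.
  by rewrite ge0_ler_powR ?nnegrE ?powR_ge0 ?mulr_ge0 ?form_bound_ge0 // ltW.
pose y U := cmod (a U) `^ q / T.
have y0 U : 0 <= y U by rewrite divr_ge0 ?powR_ge0.
have y1 : \sum_(U | transversal U) y U = 1 by rewrite -mulr_suml divff.
pose alpha j := \sum_(U | transversal U && (j \in U)) y U.
have al0 j : 0 <= alpha j by apply: sumr_ge0.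
have sal : \sum_j alpha j = r%:R.
  rewrite /alpha (exchange_big_dep transversal) /=; last by move=> j U _ /andP[].
  rewrite (eq_bigr (fun U => r%:R * y U)) => [|U tU]; first by rewrite -mulr_sumr y1 mulr1.
  rewrite (eq_bigl (fun j => j \in U)) => [|j]; last by rewrite tU.
  by rewrite sumr_const card_transversal // mulr_natl.
pose reg j U := [&& transversal U, j \in U, a U != 0 & [forall i in U, alpha j <= alpha i]].
pose v U := y U `^ ((1 - r%:R^-1) / 2).
have v2 U : v U ^+ 2 = y U `^ (1 - r%:R^-1).
  by rewrite -powR_mulrn ?powR_ge0 // -powRrM divfK.
(* y^(1-1/r) is a weighted geometric mean of y/alpha_j and alpha_j^(r-1). The first sums to at most
   1. The second is outweighed by a count: sets charged to j consist of indices with marginal at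
   least alpha_j, and there are at most r/alpha_j of these. *)
have regv j : \sum_(U | reg j U) v U ^+ 2 <= 1 + r%:R ^+ r.-1.
  have [aj0|ajn] := eqVneq (alpha j) 0.
    rewrite big_pred0 ?addr_ge0 ?exprn_ge0 ?ltW // => U.
    apply/negP => /and4P[tU jU aU _].
    have : y U <= alpha j.
      by rewrite /alpha (bigD1 U) ?tU //= lerDl sumr_ge0.
    rewrite aj0 leNgt /y divr_gt0 // powR_gt0 // lt_neqAle cmod_ge0 andbT eq_sym cmod_eq0.
    by rewrite aU.
  have ajp : 0 < alpha j by rewrite lt_neqAle eq_sym ajn al0.
  apply: le_trans (_ : \sum_(U | reg j U) (y U / alpha j + alpha j ^+ r.-1) <= _).
    apply: ler_sum => U _; rewrite v2.
    have := @weighted_geometric_mean_le R (y U / alpha j) (alpha j ^+ r.-1) r%:R^-1.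
    move=> /(_ _ _ _)/le_trans; rewrite -(ler_pM2l ltr01) !mul1r.
    have -> : (y U / alpha j) `^ (1 - r%:R^-1) * (alpha j ^+ r.-1) `^ r%:R^-1 = y U `^ (1 - r%:R^-1).
      rewrite -powR_mulrn // -powRrM.
      have -> : r.-1%:R * r%:R^-1 = 1 - r%:R^-1 :> R.
        by rewrite -subn1 natrB // mulrBl divff ?gt_eqF // mul1r.
      by rewrite -[in RHS](divfK ajn (y U)) [RHS]powRM // divr_ge0.
    apply=> //; first by rewrite divr_ge0.
      by rewrite exprn_ge0.
    by rewrite invr_ge0 ltW //= invf_le1 // ler1n.
  rewrite big_split /= lerD //.
    rewrite -mulr_suml ler_pdivrMr // mul1r /alpha.
    rewrite [leRHS](bigID (reg j)) /= (eq_bigl (reg j)) ?lerDl ?sumr_ge0 // => U.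
    by rewrite /reg; case: (transversal U); case: (j \in U).
  rewrite sumr_const -[_ *+ _]mulr_natl.
  pose X := [set i | alpha j <= alpha i].
  have cX : #|X|%:R * alpha j <= r%:R.
    rewrite -sal (bigID (fun i => i \in X)) /= -[leLHS]addr0 lerD ?sumr_ge0 //.
    by rewrite mulr_natl -sumr_const; apply: ler_sum => i; rewrite inE.
  have cR : (#|reg j| <= #|X| ^ r.-1)%N.
    apply: leq_trans (bin_leq_exp _ _); rewrite -cards_draws.
    rewrite -(card_in_imset (f := fun U => U :\ j) (D := reg j)); last first.
      move=> U V /and4P[_ jU _ _] /and4P[_ jV _ _] e.
      by rewrite -(finset.setD1K jU) -(finset.setD1K jV) e.
    apply/subset_leq_card/fintype.subsetP => W /imsetP[U /and4P[tU jU _ /forall_inP hU] ->].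
    rewrite inE; apply/andP; split.
      by apply/fintype.subsetP => i; rewrite in_setD1 inE => /andP[_ /hU].
    by have := card_transversal tU; rewrite (cardsD1 j) jU => <-.
  apply: le_trans (_ : (#|X|%:R * alpha j) ^+ r.-1 <= _).
    rewrite exprMn ler_wpM2r ?exprn_ge0 // -natrX ler_nat //.
  by rewrite lerXn2r // nnegrE // ?mulr_ge0 // ltW.
have Tq : T `^ q^-1 = \sum_(U | transversal U) cmod (a U) * v U.
  have q1 : q^-1 + (1 - r%:R^-1) / 2 = 1.
    by rewrite /q; field; rewrite !gt_eqF // addr_gt0.
  rewrite -[LHS]mulr1 -y1 mulr_sumr; apply: eq_bigr => U _.
  have [a0|an] := eqVneq (cmod (a U)) 0.
    by rewrite /y a0 powR0 ?gt_eqF // !mul0r mulr0.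
  have yp : y U != 0 by rewrite mulf_neq0 ?invr_neq0 // powR_eq0 negb_and an.
  rewrite -{1}[y U]powRr1 // -{1}q1 powRD ?yp ?implybT // mulrA; congr (_ * _).
  by rewrite -powRM // mulrC divfK // -powRrM mulfV ?gt_eqF // powRr1 ?cmod_ge0.
rewrite Tq.
have cover : \sum_(U | transversal U) cmod (a U) * v U <=
    \sum_j \sum_(U | reg j U) cmod (a U) * v U.
  rewrite (exchange_big_dep transversal) /=; last by move=> j U _ /and4P[].
  apply: ler_sum => U tU; have [a0|an] := eqVneq (a U) 0.
    rewrite a0 cmod0 mul0r sumr_ge0 // => j _; exact: mul0r.
  have [i iU] : exists i, i \in U.
    by apply/finset.set0Pn; rewrite -card_gt0 card_transversal.
  have := @arg_minP _ _ _ i (fun j => j \in U) alpha iU.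
  case=> j jU hj; rewrite (bigD1 j) /=; last first.
    by rewrite /reg tU jU an; apply/forall_inP => k kU; apply: hj.
  by rewrite lerDl sumr_ge0 // => k _; rewrite mulr_ge0 ?cmod_ge0 ?powR_ge0.
apply: le_trans cover _.
pose X j := Num.sqrt (\sum_(U | transversal U && (j \in U)) cmod (a U) ^+ 2).
have h1 j : \sum_(U | reg j U) cmod (a U) * v U <= X j * Num.sqrt (1 + r%:R ^+ r.-1).
  apply: le_trans (sqrt_cauchy_schwarz _ _ _) _.
  apply: ler_pM; rewrite ?sqrtr_ge0 // ler_wsqrtr //.
  rewrite [leLHS]big_mkcond [leRHS]big_mkcond; apply: ler_sum => U _.
  by case: ifP => [/and4P[-> -> _ _] //|_]; case: ifP => _ //; exact: sqr_ge0.
apply: le_trans (ler_sum _ (fun j _ => h1 j)) _; rewrite -mulr_suml.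
rewrite /bohnenblust_hille_constant mulrAC ler_wpM2r ?sqrtr_ge0 //.
rewrite (partition_big sigma predT) //= big_option /=.
rewrite big1 ?add0r => [|j /eqP sj]; last first.
  rewrite /X big_pred0 ?sqrtr0 // => U; apply/negP => /andP[/andP[/forall_inP h _] jU].
  by have := h j jU; rewrite sj.
rewrite -mulrA mulr_natl -[r in _ *+ r]card_ord -sumr_const.
by apply: ler_sum => g _; exact: mixed_norm_bound.
Qed.

End MultilinearForms.

(** * Errors of a random selection *)

Section GoodSelections.
Variables (R : realType) (G : zmodType) (I : finType).
Variable u : I -> G -> R[i].
Hypothesis hu : forall j, unimodular_hom (u j).
Variable d : nat.
Hypothesis hdiss : dissociate u d.
Variables (K : finType) (mult : K -> I -> nat) (A : K -> R[i]) (B : R).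
Hypothesis hsum : forall k, (\sum_j mult k j)%N = d.
Hypothesis hord : forall k j n, (0 < n <= mult k j)%N -> ~~ trivial_power u j n.
Hypothesis hinj : forall k k', mult k =1 mult k' -> k = k'.
Hypothesis hB : forall x, cmod (\sum_k A k * monomial u (fun j => (mult k j)%:Z) x) <= B.

Lemma mult_leq k j : (mult k j <= d)%N.
Proof. by rewrite -(hsum k) (bigD1 j) //= leq_addr. Qed.

(** The differences are at most d, so dissociation makes every power trivial; a nonzero difference
    would give a trivial power no larger than one of the two multiplicities, against [hord]. *)
Lemma chaos_relation_inj k k0 :
  relation u (fun j => (mult k j)%:Z - (mult k0 j)%:Z) -> k = k0.
Proof.
move=> rel; apply: hinj => j.
have h i : `|(mult k i)%:Z - (mult k0 i)%:Z| <= d%:Z.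
  by have := mult_leq k i; have := mult_leq k0 i; lia.
have := hdiss h rel j => tj; apply/eqP; rewrite eqn_leq; apply/andP; split.
  rewrite leqNgt; apply/negP => lt.
  have /negP[] : ~~ trivial_power u j (mult k j - mult k0 j)%N by apply: (@hord k j); lia.
  by rewrite -subzn // ltnW.
rewrite leqNgt; apply/negP => lt.
have /negP[] : ~~ trivial_power u j (mult k0 j - mult k j)%N by apply: (@hord k0 j); lia.
by rewrite -subzn ?(ltnW lt) // -trivial_powerN opprB.
Qed.

Lemma chaos_coefficient_bound k : cmod (A k) <= B.
Proof.
apply: (@coefficient_bound _ _ _ u hu d hdiss K A (fun k j => (mult k j)%:Z)) => // s.
exact: chaos_relation_inj.
Qed.

Variables (r : nat) (p : 'I_r -> nat).
Hypothesis p_gt0 : forall g, (0 < p g)%N.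
Hypothesis p_sum : (\sum_g p g)%N = d.

Lemma p_leq g : (p g <= d)%N.
Proof. by rewrite -p_sum (bigD1 g) //= leq_addr. Qed.

Lemma p_leq2 g h : g != h -> (p g + p h <= d)%N.
Proof.
by move=> gh; rewrite -p_sum (bigD1 g) //= leq_add2l (bigD1 h) 1?eq_sym //= leq_addr.
Qed.

(** All powers up to [p g] are required to be nontrivial, because differences between [p g] and a
    multiplicity will occur as exponents. *)
Definition eligible (j : I) (g : 'I_r) : bool :=
  [forall n : 'I_(p g).+1, (0 < n)%N ==> ~~ trivial_power u j n].

Lemma eligibleP j g n : eligible j g -> (0 < n <= p g)%N -> ~~ trivial_power u j n.
Proof.
move=> /forallP h /andP[n0 np].
by have := h (Ordinal (n := (p g).+1) (m := n) np); rewrite n0.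
Qed.

Implicit Types (sigma : {ffun I -> option 'I_r}) (mu : {ffun I -> option bool}).

Definition freq sigma (j : I) : nat := if sigma j is Some g then p g else 0.

Definition active sigma (j : I) : bool := if sigma j is Some g then eligible j g else false.

(* sigma distributes the indices into groups, None meaning unused; mu is a term
   of the Riesz product with exponents freq sigma. *)
Definition residue sigma k mu (j : I) : int :=
  (mult k j)%:Z - sign_value (freq sigma) j (mu j).

Definition resonance sigma k mu : bool :=
  [&& relation u (residue sigma k mu), homogeneous sigma mu &
      [forall j, (mu j != None) ==> active sigma j]].

(* Dissociation controls only the relations with exponents at most d; the
   residue exceeds d only at heads. *)
Definition bad sigma (i : I) : bool :=
  [exists k, [exists mu, resonance sigma k mu && (d%:Z < residue sigma k mu i)]].

Definition good sigma (j : I) : bool := active sigma j && ~~ bad sigma j.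

Lemma freq_leq sigma j : (freq sigma j <= d)%N.
Proof. by rewrite /freq; case: (sigma j) => // g; exact: p_leq. Qed.

Lemma homogeneous_sum sigma mu : homogeneous sigma mu ->
  (\sum_(j | mu j == Some true) freq sigma j =
   d + \sum_(j | mu j == Some false) freq sigma j)%N.
Proof.
move=> /forallP hom.
have E b : (\sum_(j | mu j == Some b) freq sigma j =
    \sum_g #|[set j | (sigma j == Some g) && (mu j == Some b)]| * p g)%N.
  rewrite (partition_big sigma predT) //= big_option /= big1 ?add0n; last first.
    by move=> j /andP[_ /eqP e]; rewrite /freq e.
  apply: eq_bigr => g _; rewrite (eq_bigr (fun=> p g)) => [|j /andP[_ /eqP e]].
    rewrite sum_nat_const; congr (_ * _)%N; apply: eq_card => j.
    by rewrite [in RHS]inE andbC.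
  by rewrite /freq e.
rewrite !E -[X in (X + _)%N]p_sum -big_split /=; apply: eq_bigr => g _.
by rewrite (eqP (hom g)) mulSn.
Qed.

Lemma resonance_without_heads sigma k mu : resonance sigma k mu ->
  (forall j, residue sigma k mu j <= d%:Z) ->
  (forall j, mu j != Some false) /\
  (forall j, mult k j = if mu j == Some true then freq sigma j else 0%N).
Proof.
case/and3P=> rel hom /forallP act le_d.
have bnd j : `|residue sigma k mu j| <= d%:Z.
  have := le_d j; rewrite /residue; have := freq_leq sigma j.
  by rewrite /sign_value; case: (mu j) => [[|]|]; lia.
have tr := hdiss bnd rel.
have elig j n : mu j != None -> (0 < n <= freq sigma j)%N -> ~~ trivial_power u j n.
  move=> mj; have := implyP (act j) mj; rewrite /active /freq.
  by case: (sigma j) => // g; exact: eligibleP.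
have none j : mu j = None -> mult k j = 0%N.
  move=> mj; have := tr j; rewrite /residue mj /= subr0 => h.
  apply/eqP; rewrite -leqn0 leqNgt; apply/negP => lt.
  by have := @hord k j (mult k j); rewrite lt leqnn h => /(_ isT).
have plus j : mu j = Some true -> mult k j = freq sigma j.
  move=> mj; have := tr j; rewrite /residue mj /= => h.
  apply/eqP; rewrite eqn_leq; apply/andP; split; rewrite leqNgt; apply/negP => lt.
    have /negP[] : ~~ trivial_power u j (mult k j - freq sigma j)%N by apply: (@hord k j); lia.
    by rewrite -subzn // ltnW.
  have /negP[] : ~~ trivial_power u j (freq sigma j - mult k j)%N.
    by apply: elig; [rewrite mj | lia].
  by rewrite -subzn ?(ltnW lt) // -trivial_powerN opprB.
have sumk : (\sum_j mult k j = \sum_(j | mu j == Some true) freq sigma j +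
     \sum_(j | mu j == Some false) mult k j)%N.
  rewrite (partition_big mu predT) //= big_option /= big1 ?add0n; last first.
    by move=> j /eqP /none.
  by rewrite big_bool /=; congr (_ + _)%N; apply: eq_bigr => j /eqP /plus.
have := homogeneous_sum hom; move: sumk; rewrite hsum => -> e.
have z0 : (\sum_(j | mu j == Some false) freq sigma j = 0)%N by lia.
have nf j : mu j != Some false.
  apply/negP => mj; have : freq sigma j = 0%N.
    by apply/eqP; rewrite -leqn0 -z0 (bigD1 j) //= leq_addr.
  have := implyP (act j); rewrite (eqP mj) => /(_ isT).
  by rewrite /active /freq; case: (sigma j) => // g _ pg; have := p_gt0 g; rewrite pg.
split=> // j; case: eqP => [/plus //|]; have := nf j.
by case E : (mu j) => [[|]|] // _ _; rewrite none.
Qed.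

Definition plus_sign (U : {set I}) : {ffun I -> option bool} :=
  [ffun j => if j \in U then Some true else None].

Lemma plus_sign_inj : injective plus_sign.
Proof.
move=> U V /ffunP h; apply/setP => j; have := h j; rewrite !ffunE.
by case: (j \in U); case: (j \in V).
Qed.

Lemma homogeneous_plus_sign sigma (U : {set I}) : (forall j, j \in U -> sigma j != None) ->
  homogeneous sigma (plus_sign U) = transversal sigma U.
Proof.
move=> act; rewrite /homogeneous /transversal.
have -> : [forall j in U, sigma j != None] by apply/forall_inP.
apply: eq_forallb => g; congr (_ == _).
  by apply: eq_card => j; rewrite !inE ffunE andbC; case: (j \in U).
apply/eqP; rewrite eqSS cards_eq0; apply/eqP/setP => j.
by rewrite !inE ffunE; case: (j \in U); rewrite andbF.
Qed.

(** By [hinj] at most one k contributes; the sum avoids a choice. *)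
Definition coefficient_on sigma (U : {set I}) : R[i] :=
  \sum_(k | [forall j, mult k j == if j \in U then freq sigma j else 0%N]) A k.

(** Of the homogeneous part only plus patterns on transversal sets remain, since a good index is
    never a head; each of the r signs carries a factor 1/2, whence 2^r. *)
Lemma good_form_bound sigma (z : I -> R[i]) :
  (forall j, cmod (z j) <= 1) -> (forall j, z j != 0 -> good sigma j) ->
  cmod (form sigma (coefficient_on sigma) z) <= 2 ^+ r * B.
Proof.
move=> z1 zg.
pose w mu := \prod_j halves R (mu j) *
   \sum_(k | relation u (residue sigma k mu)) A k.
have bw : cmod (\sum_(mu | homogeneous sigma mu) w mu * \prod_j signed (z j) (mu j)) <= B.
  apply: homogeneous_projection => rot rot1.
  apply: (@sign_transfer _ _ _ u hu d hdiss (freq sigma)) => // j.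
  - exact: freq_leq.
  - by case: (sigma j) => [g|]; rewrite cmodM ?rot1 ?cmod1 mul1r.
  - rewrite mulf_eq0 negb_or => /andP[_ /zg/andP[]].
    rewrite /active /freq; case: (sigma j) => // g hg _.
    by apply: eligibleP hg _; rewrite p_gt0 leqnn.
suff E : form sigma (coefficient_on sigma) z =
    2 ^+ r * \sum_(mu | homogeneous sigma mu) w mu * \prod_j signed (z j) (mu j).
  by rewrite E cmodM cmodX cmod_nat ler_wpM2l // exprn_ge0.
(* If no used variable is 0, the pattern lives on good indices; a monomial in relation with it would
   be a resonance without heads, hence with plus signs only. *)
have vanish mu : homogeneous sigma mu -> mu \notin [set plus_sign U | U in transversal sigma] ->
    w mu * \prod_j signed (z j) (mu j) = 0.
  move=> hom nim.
  have [/existsP[j /andP[mj zj]]|] := boolP [exists j, (mu j != None) && (z j == 0)].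
    have s0 : signed (0 : R[i]) (mu j) = 0.
      by case: (mu j) mj => [[|]|] // _; exact: conjc0.
    apply/eqP; rewrite mulf_eq0; apply/orP; right; apply/prodf_eq0.
    by exists j => //; rewrite (eqP zj) s0.
  rewrite negb_exists => /forallP supp.
  have sg j : mu j != None -> good sigma j.
    by move=> mj; apply: zg; have := supp j; rewrite mj.
  rewrite {1}/w [X in _ * X * _]big_pred0 ?mulr0 ?mul0r // => k; apply/negP => rel.
  have res : resonance sigma k mu.
    by rewrite /resonance rel hom; apply/forallP => j; apply/implyP => /sg/andP[].
  have le_d j : residue sigma k mu j <= d%:Z.
    rewrite leNgt; apply/negP => hd.
    have mj : mu j != None.
      apply/eqP => mj; move: hd; rewrite /residue mj /=; have := mult_leq k j; lia.
    case/andP: (sg j mj) => _ /negP; apply.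
    by apply/existsP; exists k; apply/existsP; exists mu; rewrite res.
  have [nf _] := resonance_without_heads res le_d.
  case/negP: nim; pose U := [set j | mu j == Some true].
  have eU : mu = plus_sign U.
    apply/ffunP => j; rewrite ffunE inE; have := nf j.
    by case: (mu j) => [[|]|].
  apply/imsetP; exists U => //; change (is_true (transversal sigma U)).
  rewrite -homogeneous_plus_sign -?eU // => j.
  rewrite inE => /eqP mj; have := sg j; rewrite mj => /(_ isT)/andP[].
  by rewrite /active; case: (sigma j).
rewrite (bigID (fun mu => mu \in [set plus_sign U | U in transversal sigma])) /=.
rewrite [X in _ + X]big1 ?addr0 => [|mu /andP[]]; last exact: vanish.
rewrite (eq_bigl (fun mu => mu \in [set plus_sign U | U in transversal sigma])); last first.
  move=> mu; rewrite andbC; case: imsetP => //= -[U]; rewrite -[U \in _]/(transversal sigma U) => tU ->.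
  by rewrite homogeneous_plus_sign //; case/andP: tU => /forall_inP.
rewrite big_imset /=; last by move=> U V _ _; exact: plus_sign_inj.
rewrite mulr_sumr; apply: eq_bigr => U; rewrite -?[U \in _]/(transversal sigma U) => tU.
have prodE : \prod_j signed (z j) (plus_sign U j) = \prod_(j in U) z j.
  by rewrite [RHS]big_mkcond; apply: eq_bigr => j _; rewrite ffunE; case: ifP.
rewrite prodE mulrA.
have [/existsP[j /andP[jU zj]]|] := boolP [exists j, (j \in U) && (z j == 0)].
  by rewrite (_ : \prod_(i in U) z i = 0) ?mulr0 //; apply/eqP/prodf_eq0; exists j.
rewrite negb_exists => /forallP supp.
have sg j : j \in U -> good sigma j.
  by move=> mj; apply: zg; have := supp j; rewrite mj.
congr (_ * _); rewrite /w.
have -> : \prod_j halves R (plus_sign U j) = 2^-1 ^+ r.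
  rewrite -(card_transversal tU) -prodr_const [RHS]big_mkcond.
  by apply: eq_bigr => j _; rewrite ffunE; case: ifP.
rewrite mulrA -exprMn divff // expr1n mul1r; apply: eq_bigl => k.
apply/forallP/idP => [mk|rel].
  apply/asboolP => x; rewrite /monomial big1 // => j _.
  rewrite /residue (eqP (mk j)) ffunE; case: ifP => _ /=; first by rewrite subrr expr0z.
  by rewrite subr0 expr0z.
have res : resonance sigma k (plus_sign U).
  rewrite /resonance rel homogeneous_plus_sign; last by case/andP: tU => /forall_inP.
  rewrite tU; apply/forallP => j; apply/implyP; rewrite ffunE.
  by case: ifP => // /sg/andP[].
have le_d j : residue sigma k (plus_sign U) j <= d%:Z.
  rewrite /residue ffunE; have := mult_leq k j; case: ifP => _ /=; lia.
have [_ h] := resonance_without_heads res le_d.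
by move=> j; rewrite h ffunE; case: (j \in U).
Qed.

Definition good_coefficient sigma (U : {set I}) : R[i] :=
  if [forall j in U, good sigma j] then coefficient_on sigma U else 0.

Lemma good_coefficient_bound sigma (z : I -> R[i]) : (forall j, cmod (z j) <= 1) ->
  cmod (form sigma (good_coefficient sigma) z) <= 2 ^+ r * B.
Proof.
move=> z1; pose z' j := if good sigma j then z j else 0.
have -> : form sigma (good_coefficient sigma) z = form sigma (coefficient_on sigma) z'.
  apply: eq_bigr => U _; rewrite /good_coefficient; case: ifP => [/forall_inP h|/negbT].
    by congr (_ * _); apply: eq_bigr => j jU; rewrite /z' h.
  rewrite negb_forall => /existsP[j]; rewrite negb_imply => /andP[jU bj].
  by rewrite mul0r (bigD1 j) //= /z' (negPf bj) mul0r mulr0.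
apply: good_form_bound => j; rewrite /z'; first by case: ifP; rewrite ?cmod0.
by case: ifP => //; rewrite eqxx.
Qed.

End GoodSelections.

(** * Rarity of resonances under a random distribution of the indices *)

Section RandomSelection.
Variables (R : realType) (G : zmodType) (I : finType).
Variable u : I -> G -> R[i].
Hypothesis hu : forall j, unimodular_hom (u j).
Variable d : nat.
Hypothesis d_gt0 : (0 < d)%N.
Hypothesis hdiss : dissociate u d.
Variables (K : finType) (mult : K -> I -> nat).
Hypothesis hsum : forall k, (\sum_j mult k j)%N = d.
Hypothesis hord : forall k j n, (0 < n <= mult k j)%N -> ~~ trivial_power u j n.
Variables (r : nat) (p : 'I_r -> nat).
Hypothesis p_gt0 : forall g, (0 < p g)%N.
Hypothesis p_sum : (\sum_g p g)%N = d.
Implicit Types (sigma : {ffun I -> option 'I_r}) (mu : {ffun I -> option bool}).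

Lemma mult_leq2 k i j : i != j -> (mult k i + mult k j <= d)%N.
Proof.
by move=> ij; rewrite -(hsum k) (bigD1 i) //= leq_add2l (bigD1 j) 1?eq_sym //= leq_addr.
Qed.

Definition heads sigma k mu : {set I} := [set j | d%:Z < residue mult p sigma k mu j].

Lemma headP sigma k mu j : resonance u mult p sigma k mu -> j \in heads sigma k mu ->
  exists g, [/\ sigma j = Some g, mu j = Some false & (d < mult k j + p g)%N].
Proof.
case/and3P=> _ _ /forallP act; rewrite inE /residue.
have mj := mult_leq hsum k j; have aj := act j.
case E : (mu j) aj => [[|]|] /=; try lia.
rewrite /active /freq; case: (sigma j) => // g _ h; exists g; split => //; lia.
Qed.

Section Heads.
Variables (sigma : {ffun I -> option 'I_r}) (k : K) (mu : {ffun I -> option bool}).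
Variables (i : I) (g0 : 'I_r).
Hypotheses (res : resonance u mult p sigma k mu) (iH : i \in heads sigma k mu).
Hypothesis sig0 : sigma i = Some g0.

(** Distinct heads i and j in different groups g and h would give mult_i + p_g > d and mult_j + p_h
    > d, whereas the two multiplicities, and likewise the two exponents, add up to at most d. *)
Lemma heads_same_group j : j \in heads sigma k mu -> sigma j = Some g0.
Proof.
move=> jH; have [g [sg _ lt]] := headP res jH; have [g' [sg' _ lt']] := headP res iH.
move: sg'; rewrite sig0 => -[eg]; subst g'.
have [eg|gg] := eqVneq g g0; first by rewrite sg eg.
have ij : i != j.
  by apply: contraNneq gg => ij; move: sg; rewrite -ij sig0 => -[->].
have := mult_leq2 k ij; have := p_leq2 p_sum gg; lia.
Qed.

Lemma heads_mult j : j \in heads sigma k mu -> (d.+1 - p g0 <= mult k j)%N.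
Proof.
move=> jH; have [g [sg _ lt]] := headP res jH.
move: sg; rewrite (heads_same_group jH) => -[eg]; subst g; lia.
Qed.

Lemma card_heads : (#|heads sigma k mu| * (d.+1 - p g0) <= d)%N.
Proof.
rewrite -[X in (_ <= X)%N](hsum k) -sum_nat_const.
rewrite [X in (_ <= X)%N](bigID (fun j => j \in heads sigma k mu)) /=.
by rewrite (leq_trans _ (leq_addr _ _)) // leq_sum // => j; exact: heads_mult.
Qed.

(** A head takes at least d+1-p of the degree. Hence the residue at a plus sign of its group is
    negative and at least -p, so by eligibility its power is nontrivial: such an index always shows
    in the relation. *)
Lemma plus_mult j : sigma j = Some g0 -> mu j = Some true -> (mult k j < p g0)%N.
Proof.
move=> sj mj; have [g [_ mi _]] := headP res iH.
have ij : i != j by apply/eqP => ij; move: mj; rewrite -ij mi.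
have := mult_leq2 k ij; have := heads_mult iH; have := p_leq p_sum g0; lia.
Qed.

Lemma card_heads_plus :
  (#|heads sigma k mu| < #|[set j | (sigma j == Some g0) && (mu j == Some true)]|)%N.
Proof.
have /and3P[_ /forallP/(_ g0)/eqP -> _] := res.
rewrite ltnS subset_leq_card //; apply/fintype.subsetP => j jH.
have [g [_ mj _]] := headP res jH.
by rewrite inE mj eqxx andbT (heads_same_group jH) eqxx.
Qed.

End Heads.

Variables (omega : I -> 'I_r -> R) (theta : 'I_r -> R) (V : 'I_r -> {set I}) (delta : R).
Hypothesis omega_ge0 : forall j g, 0 <= omega j g.
Hypothesis omega_le : forall j g, omega j g <= theta g.
Hypothesis omega_V : forall j g, j \notin V g -> omega j g = 0.
Hypothesis theta_gt0 : forall g, 0 < theta g.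
Hypothesis theta_sum : \sum_g theta g <= (8 * d)%:R^-1.
(** Here t is a number of heads allowed by [card_heads]; theta^(2t) accounts for t-1 further heads
    and t+1 plus signs. *)
Hypothesis theta_small : forall g t, (0 < t)%N -> (t * (d.+1 - p g) <= d)%N ->
  #|V g|%:R ^+ t.-1 * theta g ^+ (2 * t) <= delta.

Definition prob (j : I) (o : option 'I_r) : R :=
  if o is Some g then omega j g else 1 - \sum_g omega j g.

Definition weight sigma : R := \prod_j prob j (sigma j).

Definition expect (F : {ffun I -> option 'I_r} -> R) : R := \sum_sigma weight sigma * F sigma.

Lemma d8_gt0 : 0 < (8 * d)%:R :> R.
Proof. by rewrite ltr0n muln_gt0. Qed.

Lemma theta_le g : theta g <= (8 * d)%:R^-1.
Proof.
by apply: le_trans theta_sum; rewrite (bigD1 g) //= lerDl sumr_ge0 // => h _; exact: ltW.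
Qed.

Lemma omega_sum_le j : \sum_g omega j g <= (8 * d)%:R^-1.
Proof. by apply: le_trans theta_sum; apply: ler_sum => g _. Qed.

Lemma d8_inv_le1 : (8 * d)%:R^-1 <= 1 :> R.
Proof. by rewrite invf_le1 ?d8_gt0 // ler1n muln_gt0. Qed.

Lemma prob_ge0 j o : 0 <= prob j o.
Proof.
case: o => [g|] /=; first exact: omega_ge0.
by rewrite subr_ge0 (le_trans (omega_sum_le j)) // d8_inv_le1.
Qed.

Lemma weight_ge0 sigma : 0 <= weight sigma.
Proof. by apply: prodr_ge0 => j _; exact: prob_ge0. Qed.

Lemma prob_sum j : \sum_o prob j o = 1.
Proof. by rewrite big_option /= addrC addrCA subrr addr0. Qed.

Lemma expect_prod (f : I -> option 'I_r -> R) :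
  expect (fun sigma => \prod_j f j (sigma j)) = \prod_j \sum_o prob j o * f j o.
Proof.
by rewrite bigA_distr_bigA; apply: eq_bigr => sigma _; rewrite /weight -big_split.
Qed.

Lemma ler_expect F H : (forall sigma, F sigma <= H sigma) -> expect F <= expect H.
Proof. by move=> h; apply: ler_sum => sigma _; rewrite ler_wpM2l ?weight_ge0. Qed.

Lemma expect_sum (T : finType) (P : pred T) (F : T -> {ffun I -> option 'I_r} -> R) :
  expect (fun sigma => \sum_(t | P t) F t sigma) = \sum_(t | P t) expect (F t).
Proof. by rewrite /expect exchange_big /=; apply: eq_bigr => s _; rewrite mulr_sumr. Qed.

Lemma expectZ c F : expect (fun sigma => c * F sigma) = c * expect F.
Proof. by rewrite /expect mulr_sumr; apply: eq_bigr => s _; rewrite mulrCA. Qed.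

Lemma expect_const c : expect (fun=> c) = c.
Proof.
have h : \sum_sigma weight sigma = 1.
  transitivity (\prod_(j : I) \sum_o prob j o); first by rewrite bigA_distr_bigA.
  by rewrite big1 // => j _; exact: prob_sum.
by rewrite /expect -mulr_suml h mul1r.
Qed.

Variable e : 'I_r -> I.
Hypothesis e_inj : injective e.
Hypothesis omega_e : forall g, omega (e g) g = theta g.

Definition selects sigma : bool := [forall g, sigma (e g) == Some g].

Lemma expect_selects : expect (fun sigma => (selects sigma)%:R) = \prod_g theta g.
Proof.
pose f j (o : option 'I_r) : R := \prod_(g | e g == j) (o == Some g)%:R.
rewrite (_ : expect _ = expect (fun sigma => \prod_j f j (sigma j))); last first.
  apply: eq_bigr => sigma _; congr (_ * _); rewrite /f.
  rewrite (exchange_big_dep predT) //= /selects.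
  rewrite (eq_bigr (fun g => (sigma (e g) == Some g)%:R)) => [|g _]; last first.
    by rewrite (big_pred1 (e g)) // => j; rewrite eq_sym.
  case: forallP => [h|/existsNP[g /negP/negPf h]]; first by rewrite big1 // => g _; rewrite h.
  by rewrite (bigD1 g) //= h mul0r.
rewrite expect_prod.
pose t j : R := \prod_(g | e g == j) theta g.
rewrite (eq_bigr t) => [|j _]; last first.
  rewrite /t /f; case: (pickP (fun g => e g == j)) => [g /eqP eg|none].
    have eqg (F : 'I_r -> R) : \prod_(h | e h == j) F h = F g.
      by rewrite (big_pred1 g) // => h; rewrite -eg /= (inj_eq e_inj).
    rewrite eqg (eq_bigr (fun o => prob j o * (o == Some g)%:R)) => [|o _]; last by rewrite eqg.
    rewrite (bigD1 (Some g)) //= eqxx mulr1 -eg omega_e.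
    by rewrite big1 ?addr0 // => o /negPf ->; rewrite mulr0.
  rewrite [RHS]big_pred0 //; under eq_bigr do rewrite big_pred0 // mulr1.
  exact: prob_sum.
rewrite /t (exchange_big_dep predT) //=; apply: eq_bigr => g _.
by rewrite (big_pred1 (e g)) // => j; rewrite eq_sym.
Qed.

Section BadEvent.
Variable g0 : 'I_r.
Let i := e g0.

Let L : R := ((8 * d)%:R * theta g0)^-1.
Let eta : R := (8 * d)%:R^-1.

Let L_gt0 : 0 < L.
Proof. by rewrite invr_gt0 mulr_gt0 ?d8_gt0. Qed.

Let L_ge1 : 1 <= L.
Proof.
by rewrite invf_ge1 ?mulr_gt0 ?d8_gt0 // mulrC -ler_pdivlMr ?d8_gt0 // mul1r theta_le.
Qed.

Let eta_gt0 : 0 < eta. Proof. by rewrite invr_gt0 d8_gt0. Qed.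

(** The last clause reflects that all heads lie in group g0, so no other prescribed index is a
    head. *)
Definition head_set (H : {set I}) : bool :=
  [&& i \in H, (#|H| * (d.+1 - p g0) <= d)%N & [forall g, (e g \in H) ==> (g == g0)]].

Definition head_values (H : {set I}) (kappa : {ffun I -> 'I_(2 * d).+1}) : bool :=
  [forall j, (j \notin H) ==> (kappa j == ord0)].

Definition body_values (H : {set I}) (kappa : {ffun I -> 'I_(2 * d).+1})
    (nu : {ffun I -> option ('I_d * bool)}) : bool :=
  [forall j in H, nu j == None] &&
  [forall j, if nu j is Some (a, b) then ~~ trivial_power u j a.+1 else true].

Definition body_relation (kappa : {ffun I -> 'I_(2 * d).+1})
    (nu : {ffun I -> option ('I_d * bool)}) : bool :=
  relation u (fun j => (kappa j)%:Z - move_value (nu j)).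

(* Exponential-moment weight: at least |H| + 1 indices of the support of nu
   must fall in group g0 and at most d of them in no group. *)
Definition factor (H : {set I}) (nu : {ffun I -> option ('I_d * bool)}) (j : I)
    (o : option 'I_r) : R :=
  if j \in codom e then [exists g, (j == e g) && (o == Some g)]%:R
  else if j \in H then (o == Some g0)%:R
  else if nu j == None then 1
  else if o == Some g0 then L else if o == None then eta else 1.

Lemma factor_ge0 H nu j o : 0 <= factor H nu j o.
Proof. by rewrite /factor; do !case: ifP => _ //; exact: ltW. Qed.

Lemma move_exists (l : int) : `|l| <= d%:Z ->
  exists m : option ('I_d * bool), move_value m = - l /\ (l != 0 -> m != None).
Proof.
case: l => [[|n]|n] ln; first by exists None.
  have nd : (n < d)%N by lia.
  by exists (Some (Ordinal nd, false)).
have nd : (n < d)%N by lia.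
by exists (Some (Ordinal nd, true)); rewrite NegzE opprK.
Qed.

(** A resonance is recorded by data that no longer mention k and mu: the heads, their residues, and
    elsewhere a move opposite to the residue, or none if its power is trivial. What results is a
    relation with moves of size at most d, to which [count_relations] applies. *)
Lemma bad_certificate sigma : selects sigma -> bad u d mult p sigma i ->
  exists H kappa nu, [/\ head_set H, head_values H kappa, body_values H kappa nu,
    body_relation kappa nu & L ^+ #|H|.+1 * eta ^+ d <= \prod_j factor H nu j (sigma j)].
Proof.
move=> /forallP sel /existsP[k /existsP[mu /andP[res hi]]].
have sig0 : sigma i = Some g0 by apply/eqP; exact: sel.
pose H := heads sigma k mu.
have iH : i \in H by rewrite inE.
pose lam := residue mult p sigma k mu.
have lam_le j : lam j <= (2 * d)%:Z.
  rewrite /lam /residue; have := mult_leq hsum k j; have := freq_leq p_sum sigma j.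
  by rewrite /sign_value; case: (mu j) => [[|]|]; lia.
have lam_body j : j \notin H -> `|lam j| <= d%:Z.
  rewrite inE -leNgt /lam /residue; have := freq_leq p_sum sigma j.
  by rewrite /sign_value; case: (mu j) => [[|]|]; lia.
have lam_head j : j \in H -> 0 <= lam j by rewrite inE -/(lam j); lia.
pose kappa : {ffun I -> 'I_(2 * d).+1} := [ffun j => if j \in H then inord `|lam j|%N else ord0].
have kappaE j : (kappa j)%:Z = if j \in H then lam j else 0.
  rewrite ffunE; case: ifP => // jH.
  have := lam_le j; have := lam_head j jH => l0 l2; rewrite inordK; lia.
have ex j : exists m : option ('I_d * bool),
    [/\ j \in H -> m = None,
        if m is Some (a, b) then ~~ trivial_power u j a.+1 else true,
        j \notin H -> trivial_power u j (lam j + move_value m) &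
        j \notin H -> ~~ trivial_power u j (lam j) -> m != None].
  have [jH|jH] := boolP (j \in H); first by exists None.
  have [tj|ntj] := boolP (trivial_power u j (lam j)).
    by exists None; split => //; rewrite /= addr0.
  have [m [em nm]] := move_exists (lam_body j jH); exists m; split => //.
  - case: m em nm => [[a b]|] //= em _; move: ntj.
    rewrite -[lam j]opprK -em; case: (b); by rewrite ?opprK ?trivial_powerN.
  - by move=> _; rewrite em subrr; apply/asboolP.
  - move=> _ _; apply: nm; apply: contraNneq ntj => ->; exact/asboolP.
have [nuf nuP] := fin_all_exists ex.
pose nu := [ffun j => nuf j].
exists H, kappa, nu; split.
- rewrite /head_set iH (card_heads res iH sig0); apply/forallP => g; apply/implyP => eg.
  have := heads_same_group res iH sig0 eg.
  by have /eqP -> := sel g => -[->].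
- by apply/forallP => j; apply/implyP => /negPf jH; rewrite ffunE jH.
- apply/andP; split.
    by apply/forall_inP => j jH; rewrite ffunE; have [-> //] := nuP j.
  apply/forallP => j; rewrite ffunE; have [_ + _ _] := nuP j.
  by case: (nuf j) => [[]|].
- have /and3P[/asboolP rel _ _] := res; apply/asboolP => x; rewrite -(rel x) /monomial.
  apply: eq_bigr => j _; rewrite kappaE ffunE -/(lam j); have [h1 _ h3 _] := nuP j.
  case: ifP => [jH|/negbT jH]; first by rewrite h1 // subr0.
  have /asboolP/(_ x) := h3 jH; rewrite expfzDr ?(u_neq0 hu) // => h.
  by rewrite sub0r -invr_expz -[LHS]mulr1 -h mulrCA mulVf ?mulr1 // expfz_neq0 ?(u_neq0 hu).
(* Y and N are the moved indices in group g0 and in no group. Every plus sign of g0 yields an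
   element of Y, so |Y| > |H|; an index of N has positive multiplicity, so |N| <= d. *)
pose Y := [set j | [&& j \notin codom e, j \notin H, nu j != None & sigma j == Some g0]].
pose N := [set j | [&& j \notin codom e, j \notin H, nu j != None & sigma j == None]].
have inY j : (j \in Y) = [&& j \notin codom e, j \notin H, nu j != None & sigma j == Some g0].
  by rewrite finset.in_set.
have inN j : (j \in N) = [&& j \notin codom e, j \notin H, nu j != None & sigma j == None].
  by rewrite finset.in_set.
have fE j : factor H nu j (sigma j) = L ^+ (j \in Y) * eta ^+ (j \in N).
  rewrite /factor inY inN; case: ifP => [/codomP[g ->]|jc] /=.
    rewrite (_ : [exists _, _]) ?mulr1 //; apply/existsP; exists g.
    by rewrite eqxx sel.
  case: ifP => [jH|jH] /=.
    by rewrite (heads_same_group res iH sig0 jH) eqxx mulr1.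
  case: eqP => [_|_] /=; first by rewrite mulr1.
  case: eqP => [->|_] /=; first by rewrite mulr1.
  by case: eqP => _; rewrite mul1r.
rewrite (eq_bigr _ (fun j _ => fE j)) big_split /=.
have pw (x : R) (S : {set I}) : \prod_j x ^+ (j \in S) = x ^+ #|S|.
  by rewrite -prodr_const [RHS]big_mkcond; apply: eq_bigr => j _; case: (j \in S).
rewrite !pw.
have cY : (#|H| < #|Y|)%N.
  apply: leq_trans (card_heads_plus res iH sig0) _; apply/subset_leq_card/fintype.subsetP => j.
  rewrite finset.in_set => /andP[/eqP sj /eqP mj]; rewrite inY.
  have lt := plus_mult res iH sig0 sj mj.
  have jH : j \notin H.
    rewrite inE -leNgt -/(lam j) /lam /residue mj /= /freq sj; lia.
  rewrite sj eqxx andbT; apply/and3P; split => //.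
    apply/negP => /codomP[g ej]; move: (sel g); rewrite -ej sj => /eqP[eg].
    by move: jH; rewrite ej -eg iH.
  rewrite ffunE; have [_ _ _ h4] := nuP j; apply: h4 => //.
  rewrite /lam /residue mj /= /freq sj.
  have el : eligible u p j g0.
    have /and3P[_ _ /forallP/(_ j)] := res; rewrite mj /=.
    by rewrite /active sj.
  have := @eligibleP _ _ _ _ _ _ _ _ (p g0 - mult k j)%N el; rewrite -subzn ?(ltnW lt) //.
  by rewrite -trivial_powerN opprB; apply; rewrite subn_gt0 lt leq_subr.
have cN : (#|N| <= d)%N.
  rewrite -[d](hsum k) -sum1_card.
  rewrite [X in (_ <= X)%N](bigID (fun j => j \in N)) /= (leq_trans _ (leq_addr _ _)) //.
  apply: leq_sum => j; rewrite inN => /and4P[_ jH + /eqP sj].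
  rewrite ffunE lt0n; apply: contra => /eqP mk.
  have mj : mu j = None.
    have /and3P[_ _ /forallP/(_ j)] := res; rewrite /active sj.
    by case: (mu j).
  have [_ nt h3 _] := nuP j; move: nt (h3 jH); rewrite /lam /residue mj mk /= subr0 add0r.
  case: (nuf j) => [[a b]|] //= /negP nt; case: b => //; by rewrite trivial_powerN.
apply: ler_pM; rewrite ?exprn_ge0 ?(ltW L_gt0) ?(ltW eta_gt0) //.
  exact: ler_weXn2l.
by apply: ler_wiXn2l => //; [exact: ltW | exact: d8_inv_le1].
Qed.


Let r_leq : (r <= d)%N.
Proof.
rewrite -p_sum -[X in (X <= _)%N]card_ord -sum1_card; exact: leq_sum.
Qed.

Let head_set_card H : head_set H -> (0 < #|H| <= d)%N.
Proof.
case/and3P=> iH hH _; apply/andP; split; first by apply/card_gt0P; exists i.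
apply: leq_trans hH; rewrite leq_pmulr // subn_gt0 ltnS; exact: p_leq p_sum _.
Qed.

Definition head_weight (H : {set I}) : R :=
  if H :\ i \subset V g0 then theta g0 ^+ #|H|.-1 else 0.

(** The factor 2d at the prescribed indices only offsets the weight 1/(2d) on the right when [nu]
    moves such an index. *)
Lemma factor_mean_le H kappa nu j : head_set H -> body_values H kappa nu ->
  \sum_o prob j o * factor H nu j o <=
  (\prod_(g | e g == j) (theta g * (2 * d)%:R)) *
  (if j \in H :\ i then (if j \in V g0 then theta g0 else 0) else 1) *
  move_weight u j (nu j).
Proof.
move=> /and3P[iH _ /forallP hH] /andP[/forall_inP nuH /forallP nut].
have d2 : 0 < (2 * d)%:R :> R by rewrite ltr0n muln_gt0.
have mw : move_weight u j (nu j) = if nu j == None then 1 else (2 * d)%:R^-1.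
  by have := nut j; case: (nu j) => [[a b]|] //= /negPf ->.
have [/codomP[g ->]|jc] := boolP (j \in codom e).
  rewrite (big_pred1 g) => [|h]; last by rewrite /= (inj_eq e_inj).
  rewrite (_ : (e g \in H :\ i) = false) ?mulr1; last first.
    rewrite in_setD1; apply/negP => /andP[gi gH].
    by move: (implyP (hH g) gH) gi => /eqP ->; rewrite eqxx.
  rewrite (bigD1 (Some g)) //= big1 => [|o og]; last first.
    rewrite /factor codom_f (_ : [exists _, _] = false) ?mulr0 //.
    apply/existsP => -[h /andP[/eqP/e_inj gh]]; by rewrite -gh (negPf og).
  rewrite addr0 omega_e /factor codom_f (_ : [exists _, _]); last first.
    by apply/existsP; exists g; rewrite !eqxx.
  rewrite -mulrA ler_wpM2l ?(ltW (theta_gt0 g)) //.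
  have := nut (e g); case: (nu (e g)) => [[a b]|] /= => [/negPf ->|_].
    by rewrite divff // gt_eqF.
  by rewrite mulr1 ler1n muln_gt0.
rewrite [X in X * _ * _]big_pred0 ?mul1r => [|g]; last first.
  by apply: contraNF jc => /eqP <-; exact: codom_f.
have ji : j != i by apply: contraNneq jc => ->; exact: codom_f.
rewrite in_setD1 ji /= mw /factor (negPf jc).
case: ifP => [jH|_].
  rewrite (nuH j jH) mulr1 (bigD1 (Some g0)) //= eqxx mulr1 big1 => [|o /negPf ->]; last exact: mulr0.
  by rewrite addr0; case: ifPn => [_|/omega_V -> //]; exact: omega_le.
case: ifP => _ /=; first by rewrite mulr1; under eq_bigr do rewrite mulr1; rewrite prob_sum.
rewrite mul1r big_option /= [X in _ + X](bigD1 g0) //= eqxx.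
have e1 : (1 - \sum_g omega j g) * eta <= eta.
  by rewrite ler_piMl ?(ltW eta_gt0) // lerBlDr lerDl sumr_ge0.
have e2 : omega j g0 * L <= eta.
  apply: le_trans (_ : theta g0 * L <= _); first by rewrite ler_wpM2r ?(ltW L_gt0).
  by rewrite /L invfM mulrCA divff ?mulr1 // gt_eqF.
have e3 : \sum_(g | g != g0) omega j g * (if Some g == Some g0 then L else 1) <= eta.
  apply: le_trans (omega_sum_le j); rewrite [leRHS](bigD1 g0) //= -[leLHS]add0r lerD //.
  apply: ler_sum => g /negPf gg; rewrite (_ : (Some g == Some g0) = (g == g0)) // gg mulr1 //.
have : (2 * d)%:R^-1 = 4 * eta.
  by rewrite /eta !natrM; field; rewrite pnatr_eq0 -lt0n.
move=> ->; have := eta_gt0; lra.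
Qed.

Lemma factor_expect_le H kappa nu : head_set H -> body_values H kappa nu ->
  expect (fun sigma => \prod_j factor H nu j (sigma j)) <=
  (2 * d)%:R ^+ d * (\prod_g theta g) * head_weight H * \prod_j move_weight u j (nu j).
Proof.
move=> hH hnu; rewrite expect_prod.
apply: le_trans (_ : \prod_j ((\prod_(g | e g == j) (theta g * (2 * d)%:R)) *
  (if j \in H :\ i then (if j \in V g0 then theta g0 else 0) else 1) *
  move_weight u j (nu j)) <= _).
  apply: ler_prod => j _; apply/andP; split; last exact: factor_mean_le hH hnu.
  by apply: sumr_ge0 => o _; rewrite mulr_ge0 ?prob_ge0 ?factor_ge0.
rewrite !big_split /= ler_wpM2r //.
  by apply: prodr_ge0 => j _; exact: move_weight_ge0.
have -> : \prod_j (if j \in H :\ i then (if j \in V g0 then theta g0 else 0) else 1) =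
    head_weight H.
  rewrite -big_mkcond /= /head_weight; case: ifP => [/fintype.subsetP s|/negbT].
    rewrite (eq_bigr (fun=> theta g0)) => [|j /s -> //]; rewrite prodr_const.
    by case/and3P: hH => iH _ _; rewrite (cardsD1 i H) iH.
  by case/subsetPn => j jH /negPf jV; rewrite (bigD1 j) //= jV mul0r.
rewrite ler_wpM2r //.
  by rewrite /head_weight; case: ifP => // _; rewrite exprn_ge0 ?ltW.
rewrite (exchange_big_dep predT) //=.
rewrite (eq_bigr (fun g => theta g * (2 * d)%:R)) => [|g _]; last first.
  by rewrite (big_pred1 (e g)) // => j; rewrite eq_sym.
rewrite big_split /= prodr_const card_ord [leRHS]mulrC ler_wpM2l //.
  by apply: prodr_ge0 => g _; exact: ltW.
by rewrite ler_weXn2l // ler1n muln_gt0.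
Qed.

(** In order: the factors 2d at the prescribed indices, eta^(-d), the part of L^(-(t+1)) without
    theta, the choices of residues at the heads, and the possible numbers of heads. *)
Definition selection_constant : R :=
  (2 * d)%:R ^+ d * (8 * d)%:R ^+ d * (8 * d)%:R ^+ d.+1 * (2 * d).+1%:R ^+ d * d.+1%:R.

(** Markov's inequality over certificates. In expectation the sum over [nu] is at most 1 by
    [count_relations], there are at most (2d+1)^|H| values at the heads, and at most |V g0|^(t-1)
    sets of t heads through the given index; [theta_small] concludes. *)
Lemma expect_bad :
  expect (fun sigma => (selects sigma && bad u d mult p sigma i)%:R) <=
  selection_constant * delta * \prod_g theta g.
Proof.
pose W (H : {set I}) : R := (L ^+ #|H|.+1 * eta ^+ d)^-1.
have W0 H : 0 < W H by rewrite invr_gt0 mulr_gt0 ?exprn_gt0.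
have th0 : 0 <= \prod_g theta g by apply: prodr_ge0 => g _; exact: ltW.
apply: le_trans (_ : expect (fun sigma => \sum_(H | head_set H)
   \sum_(kappa | head_values H kappa) \sum_(nu | body_values H kappa nu && body_relation kappa nu)
      W H * \prod_j factor H nu j (sigma j)) <= _).
  apply: ler_expect => sigma.
  have pos H (nu : {ffun I -> option ('I_d * bool)}) : 0 <= W H * \prod_j factor H nu j (sigma j).
    by rewrite mulr_ge0 ?(ltW (W0 H)) // prodr_ge0 // => j _; exact: factor_ge0.
  case: andP => [[sel bd]|_]; last by do 3!apply: sumr_ge0 => ? _.
  have [H [kappa [nu [h1 h2 h3 h4 h5]]]] := bad_certificate sel bd.
  rewrite (bigD1 H) //= (bigD1 kappa) //= (bigD1 nu) ?h3 //= -!addrA.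
  apply: ler_wpDr; last by rewrite ler_pdivlMl ?mulr1 // mulr_gt0 ?exprn_gt0.
  by rewrite !addr_ge0 //; do ?[apply: sumr_ge0 => ? _].
rewrite expect_sum.
apply: le_trans (_ : \sum_(H | head_set H) (W H *
    ((2 * d)%:R ^+ d * (\prod_g theta g) * head_weight H) * (2 * d).+1%:R ^+ d) <= _).
  apply: ler_sum => H hH; rewrite expect_sum.
  apply: le_trans (_ : \sum_(kappa | head_values H kappa)
    W H * ((2 * d)%:R ^+ d * (\prod_g theta g) * head_weight H) <= _).
    apply: ler_sum => kappa _; rewrite expect_sum.
    have C0 : 0 <= (2 * d)%:R ^+ d * (\prod_g theta g) * head_weight H.
      rewrite mulr_ge0 //; first by rewrite mulr_ge0 // exprn_ge0.
      by rewrite /head_weight; case: ifP => // _; rewrite exprn_ge0 ?ltW.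
    apply: le_trans (_ : \sum_(nu | body_values H kappa nu && body_relation kappa nu)
        W H * ((2 * d)%:R ^+ d * (\prod_g theta g) * head_weight H *
          \prod_j move_weight u j (nu j)) <= _).
      apply: ler_sum => nu /andP[hnu _]; rewrite expectZ ler_wpM2l ?(ltW (W0 H)) //.
      exact: factor_expect_le hH hnu.
    rewrite -mulr_sumr -mulr_sumr ler_wpM2l ?(ltW (W0 H)) // ler_piMr //.
    apply: le_trans (count_relations hu hdiss (fun j => (kappa j)%:Z) d_gt0).
    rewrite [leLHS]big_mkcond [leRHS]big_mkcond /=; apply: ler_sum => nu _.
    rewrite /body_relation; case: (body_values _ _ _) => //=; case: ifP => // _.
    by apply: prodr_ge0 => j _; exact: move_weight_ge0.
  rewrite sumr_const -[leLHS]mulr_natr ler_wpM2l //.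
    rewrite mulr_ge0 ?(ltW (W0 H)) // mulr_ge0 //; first by rewrite mulr_ge0 // exprn_ge0.
    by rewrite /head_weight; case: ifP => // _; rewrite exprn_ge0 ?ltW.
  rewrite -natrX ler_nat; apply: leq_trans (_ : (2 * d).+1 ^ #|H| <= _)%N; last first.
    by case/andP: (head_set_card hH) => _ ?; rewrite leq_pexp2l.
  rewrite -[(2 * d).+1 in X in (_ <= X)%N]card_ord -(card_pffun_on ord0).
  apply/subset_leq_card/fintype.subsetP => kappa /forallP hk.
  apply/pffun_onP; split; last by [].
  by apply/fintype.subsetP => j; rewrite inE; apply: contraNT => jH; exact: (implyP (hk j) jH).
pose cst1 : R := (2 * d)%:R ^+ d * (8 * d)%:R ^+ d * (8 * d)%:R ^+ d.+1 * (2 * d).+1%:R ^+ d.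
have c0 : 0 <= cst1 by rewrite !mulr_ge0 ?exprn_ge0.
apply: le_trans (_ : \sum_(H | head_set H && (H :\ i \subset V g0))
    (cst1 * (\prod_g theta g)) * theta g0 ^+ (2 * #|H|) <= _).
  rewrite [leLHS](bigID (fun H => H :\ i \subset V g0)) /= [X in _ + X]big1 ?addr0; last first.
    by move=> H /andP[_ /negPf hV]; rewrite /head_weight hV !mulr0 mul0r.
  apply: ler_sum => H /andP[hH hV]; rewrite /head_weight hV /W /L /eta.
  case/andP: (head_set_card hH) => H0 Hd.
  have -> : (((8 * d)%:R * theta g0)^-1 ^+ #|H|.+1 * (8 * d)%:R^-1 ^+ d)^-1 *
      ((2 * d)%:R ^+ d * (\prod_g theta g) * theta g0 ^+ #|H|.-1) * (2 * d).+1%:R ^+ d =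
      (2 * d)%:R ^+ d * (8 * d)%:R ^+ d * (8 * d)%:R ^+ #|H|.+1 * (2 * d).+1%:R ^+ d *
      (\prod_g theta g) * (theta g0 ^+ #|H|.+1 * theta g0 ^+ #|H|.-1).
    by rewrite !exprVn invfM !invrK exprMn; ring.
  rewrite -exprD (_ : #|H|.+1 + #|H|.-1 = 2 * #|H|)%N; last by lia.
  rewrite ler_wpM2r ?exprn_ge0 ?(ltW (theta_gt0 _)) // ler_wpM2r //.
  rewrite ler_wpM2r ?exprn_ge0 // ler_wpM2l ?mulr_ge0 ?exprn_ge0 //.
  by rewrite ler_weXn2l // ler1n muln_gt0.
rewrite -mulr_sumr.
have -> : selection_constant * delta * \prod_g theta g =
    (cst1 * \prod_g theta g) * (d.+1%:R * delta) by rewrite /selection_constant -/cst1; ring.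
rewrite ler_wpM2l ?mulr_ge0 //.
rewrite (partition_big (fun H : {set I} => inord #|H| : 'I_d.+1) predT) //=.
rewrite mulr_natl -[d.+1 in leRHS]card_ord -sumr_const.
apply: ler_sum => t _.
pose D := [pred H : {set I} | (head_set H && (H :\ i \subset V g0)) && ((inord #|H| : 'I_d.+1) == t)].
have Dt H : H \in D -> #|H| = t.
  case/andP=> /andP[/head_set_card/andP[_ hd] _] /eqP <-; by rewrite inordK.
have [H0 H0D|none] := pickP (mem D); last first.
  (* Without head sets of size t only delta >= 0 is needed; the case of one head provides it. *)
  rewrite big_pred0 //; have := theta_small (g := g0) (t := 1%N) isT.
  have -> : (1 * (d.+1 - p g0) <= d)%N by have := p_gt0 g0; lia.
  by move=> /(_ isT); apply: le_trans; rewrite mulr_ge0 ?exprn_ge0 // ltW.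
rewrite (eq_bigr (fun=> theta g0 ^+ (2 * t))) => [|H /Dt <- //].
rewrite sumr_const -[leLHS]mulr_natl.
have /andP[/andP[/[dup] /head_set_card/andP[h0 _] /and3P[_ hp _] _] _] := H0D.
rewrite (Dt _ H0D) in h0 hp.
apply: le_trans (theta_small h0 hp).
rewrite ler_wpM2r ?exprn_ge0 ?(ltW (theta_gt0 _)) // -natrX ler_nat.
apply: leq_trans (bin_leq_exp _ _); rewrite -cards_draws.
rewrite -(card_in_imset (f := fun U => U :\ i) (D := D)); last first.
  move=> A B /andP[/andP[/and3P[iA _ _] _] _] /andP[/andP[/and3P[iB _ _] _] _] eAB.
  by rewrite -(finset.setD1K iA) -(finset.setD1K iB) eAB.
apply/subset_leq_card/fintype.subsetP => Z /imsetP[H HD ->].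
have /andP[/andP[/and3P[iH _ _] hV] _] := HD.
by rewrite finset.in_set hV -(Dt _ HD) (cardsD1 i H) iH /=.
Qed.

End BadEvent.
Definition alive sigma : bool :=
  selects sigma && [forall g, ~~ bad u d mult p sigma (e g)].

(** Union bound over the r prescribed indices: badness costs at most half of the selection
    probability. *)
Lemma expect_alive : r%:R * (selection_constant * delta) <= 2^-1 ->
  2^-1 * \prod_g theta g <= expect (fun sigma => (alive sigma)%:R).
Proof.
move=> small; have th0 : 0 <= \prod_g theta g by apply: prodr_ge0 => g _; exact: ltW.
have h : expect (fun sigma => (selects sigma)%:R) <=
    expect (fun sigma => (alive sigma)%:R +
      \sum_g (selects sigma && bad u d mult p sigma (e g))%:R).
  apply: ler_expect => sigma; rewrite /alive; case: (selects sigma) => /=; last first.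
    by rewrite addr_ge0 // sumr_ge0.
  have [_|] := boolP [forall g, ~~ bad u d mult p sigma (e g)]; first by rewrite lerDl sumr_ge0.
  rewrite negb_forall => /existsP[g]; rewrite negbK => bg.
  by rewrite add0r (bigD1 g) //= bg lerDl sumr_ge0.
rewrite expect_selects in h.
have E F H : expect (fun sigma => F sigma + H sigma) = expect F + expect H.
  by rewrite /expect -big_split; apply: eq_bigr => s _; rewrite mulrDr.
rewrite E expect_sum in h.
have h2 : \sum_g expect (fun sigma => (selects sigma && bad u d mult p sigma (e g))%:R) <=
    r%:R * (selection_constant * delta) * \prod_g theta g.
  rewrite -mulrA mulr_natl -[r in _ *+ r]card_ord -sumr_const.
  by apply: ler_sum => g _; exact: expect_bad.
have : r%:R * (selection_constant * delta) * \prod_g theta g <= 2^-1 * \prod_g theta g.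
  by rewrite ler_wpM2r.
lra.
Qed.

End RandomSelection.

(** * Estimates averaged over the random selections *)

Section TypeEstimates.
Variables (R : realType) (G : zmodType) (I : finType).
Variable u : I -> G -> R[i].
Hypothesis hu : forall j, unimodular_hom (u j).
Variable d : nat.
Hypothesis d_gt0 : (0 < d)%N.
Hypothesis hdiss : dissociate u d.
Variables (K : finType) (mult : K -> I -> nat) (A : K -> R[i]) (B : R).
Hypothesis hsum : forall k, (\sum_j mult k j)%N = d.
Hypothesis hord : forall k j n, (0 < n <= mult k j)%N -> ~~ trivial_power u j n.
Hypothesis hinj : forall k k', mult k =1 mult k' -> k = k'.
Hypothesis hB : forall x, cmod (\sum_k A k * monomial u (fun j => (mult k j)%:Z) x) <= B.
Variables (r : nat) (p : 'I_r -> nat).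
Hypothesis p_gt0 : forall g, (0 < p g)%N.
Hypothesis p_sum : (\sum_g p g)%N = d.
Implicit Types sigma : {ffun I -> option 'I_r}.

Definition arranged (k : K) (e : 'I_r -> I) : Prop :=
  [/\ injective e, forall g, mult k (e g) = p g & forall j, j \notin codom e -> mult k j = 0%N].

Variables (theta : 'I_r -> R) (V : 'I_r -> {set I}) (delta : R).
Hypothesis theta_gt0 : forall g, 0 < theta g.
Hypothesis theta_sum : \sum_g theta g <= (8 * d)%:R^-1.
Hypothesis theta_small : forall g t, (0 < t)%N -> (t * (d.+1 - p g) <= d)%N ->
  #|V g|%:R ^+ t.-1 * theta g ^+ (2 * t) <= delta.
Hypothesis delta_small : r%:R * (selection_constant R d * delta) <= 2^-1.
Variables (S : {set K}) (e : K -> 'I_r -> I).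
Hypothesis S_arranged : forall k, k \in S -> arranged k (e k).
Hypothesis S_V : forall k g, k \in S -> e k g \in V g.

Let omega j g : R := if (j \in V g) && eligible u p j g then theta g else 0.

Let omega_ge0 j g : 0 <= omega j g.
Proof. by rewrite /omega; case: ifP => _ //; exact: ltW. Qed.

Let omega_le j g : omega j g <= theta g.
Proof. by rewrite /omega; case: ifP => _ //; exact: ltW. Qed.

Let omega_V j g : j \notin V g -> omega j g = 0.
Proof. by rewrite /omega => /negPf ->. Qed.

Let eligible_e k g : k \in S -> eligible u p (e k g) g.
Proof.
move=> kS; have [_ mk _] := S_arranged kS.
apply/forallP => n; apply/implyP => n0; apply: (hord (k := k)).
by rewrite mk n0 -ltnS ltn_ord.
Qed.

Let live k := alive u d mult p (e k).

Let live_prob k : k \in S ->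
  2^-1 * \prod_g theta g <= expect omega (fun sigma => (live k sigma)%:R).
Proof.
move=> kS; have [ei _ _] := S_arranged kS.
apply: (expect_alive hu d_gt0 hdiss hsum p_gt0 p_sum (V := V) (delta := delta)) => //.
by move=> g; rewrite /omega S_V // eligible_e.
Qed.

Let support k : {set I} := [set e k g | g in 'I_r].

Let live_mult k sigma : k \in S -> live k sigma ->
  forall j, mult k j = if j \in support k then freq p sigma j else 0%N.
Proof.
move=> kS /andP[/forallP sel _] j; have [_ mk m0] := S_arranged kS.
case: ifP => [/imsetP[g _ ->]|/negbT jU].
  by rewrite mk /freq (eqP (sel g)).
apply: m0; apply: contra jU => /codomP[g ->]; exact: imset_f.
Qed.

(** Under a fixed sigma the exponents of a live monomial are read off from the groups of its
    indices. *)
Let support_inj sigma k k' : k \in S -> k' \in S -> live k sigma -> live k' sigma ->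
  support k = support k' -> k = k'.
Proof.
move=> kS kS' lk lk' eU; apply: hinj => j.
by rewrite (live_mult kS lk) (live_mult kS' lk') eU.
Qed.

Let live_transversal k sigma : k \in S -> live k sigma -> transversal sigma (support k).
Proof.
move=> kS /andP[/forallP sel _]; have [ei _ _] := S_arranged kS.
apply/andP; split; first by apply/forall_inP => j /imsetP[g _ ->]; rewrite (eqP (sel g)).
apply/forallP => g; apply/cards1P; exists (e k g); apply/setP => j; rewrite !inE.
apply/andP/eqP => [[/imsetP[h _ ->]]|->]; last by rewrite imset_f.
by rewrite (eqP (sel h)) => /eqP[->].
Qed.

Let live_coefficient k sigma : k \in S -> live k sigma ->
  good_coefficient u d mult A p sigma (support k) = A k.
Proof.
move=> kS lk; have /andP[/forallP sel /forallP nb] := lk.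
rewrite /good_coefficient ifT; last first.
  apply/forall_inP => j /imsetP[g _ ->]; rewrite /good nb andbT /active (eqP (sel g)).
  exact: eligible_e.
rewrite /coefficient_on (big_pred1 k) // => k'.
apply/forallP/eqP => [h|-> j]; last by rewrite (live_mult kS lk).
by apply: hinj => j; rewrite (eqP (h j)) (live_mult kS lk).
Qed.

Let Z0 : 0 <= 2^-1 * \prod_g theta g.
Proof. by rewrite mulr_ge0 // prodr_ge0 // => g _; exact: ltW. Qed.

(** Each k of S is live with probability at least half the product of the theta g, so a bound on the
    live part valid for every sigma bounds that multiple of the whole sum. *)
Let averaging (F : K -> R) (X : R) : (forall k, 0 <= F k) ->
  (forall sigma, \sum_(k in S | live k sigma) F k <= X) ->
  2^-1 * \prod_g theta g * \sum_(k in S) F k <= X.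
Proof.
move=> F0 hX; rewrite -[X](expect_const omega).
apply: le_trans (_ : expect omega (fun sigma => \sum_(k in S) F k * (live k sigma)%:R) <= _).
  rewrite expect_sum mulr_sumr; apply: ler_sum => k kS.
  by rewrite expectZ mulrC ler_wpM2l // live_prob.
apply: (ler_expect d_gt0 omega_ge0 omega_le theta_sum) => sigma.
apply: le_trans (hX sigma); rewrite [leRHS]big_mkcondr; apply: ler_sum => k kS.
by case: ifP; rewrite ?mulr1 ?mulr0.
Qed.

Let form_le sigma z : (forall j, cmod (z j) <= 1) ->
  cmod (form sigma (good_coefficient u d mult A p sigma) z) <= 2 ^+ r * B.
Proof. exact: good_coefficient_bound. Qed.

Let B_ge0 : 0 <= B.
Proof. by apply: le_trans (cmod_ge0 _) (hB 0). Qed.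

Let r_gt0 : (0 < r)%N.
Proof.
rewrite lt0n; apply/negP => /eqP r0; have := d_gt0.
by rewrite -p_sum big1 // => g; have := ltn_ord g; rewrite [X in (_ < X)%N]r0.
Qed.

Lemma arranged_power_sum :
  2^-1 * \prod_g theta g * \sum_(k in S) cmod (A k) `^ (2 * r%:R / (r%:R + 1)) <=
  (bohnenblust_hille_constant R r * (2 ^+ r * B)) `^ (2 * r%:R / (r%:R + 1)).
Proof.
apply: averaging => [k|sigma]; first exact: powR_ge0.
apply: le_trans (bohnenblust_hille (@form_le sigma) r_gt0).
rewrite (eq_bigr (fun k => cmod (good_coefficient u d mult A p sigma (support k))
  `^ (2 * r%:R / (r%:R + 1)))) => [|k /andP[kS lk]]; last by rewrite live_coefficient.
rewrite -(big_imset (h := support) (fun U => cmod (good_coefficient u d mult A p sigma U)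
  `^ (2 * r%:R / (r%:R + 1))) (A := [pred k | (k \in S) && live k sigma])) /=; last first.
  by move=> k k' /andP[kS lk] /andP[kS' lk']; exact: (support_inj kS kS' lk lk').
rewrite [leLHS]big_mkcond [leRHS]big_mkcond; apply: ler_sum => U _.
case: ifP => [/imsetP[k /andP[kS lk] ->]|_]; first by rewrite live_transversal.
by case: ifP => // _; exact: powR_ge0.
Qed.

(** Weak type form of the mixed norm. The n_i live monomials with index i in group g satisfy alpha
    n_i <= sqrt(D) alpha sqrt(n_i), and alpha sqrt(n_i) is at most the l2 norm through i. The
    constant is 3^r from the mixed norm times 2^r from the form. *)
Lemma arranged_count (g : 'I_r) (alpha D : R) : 0 <= alpha -> 0 <= D ->
  (forall k, k \in S -> alpha <= cmod (A k)) ->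
  (forall i, #|[set k in S | e k g == i]|%:R <= D) ->
  alpha * (2^-1 * \prod_h theta h * #|S|%:R) <= Num.sqrt D * (6 ^+ r * B).
Proof.
move=> al0 D0 hal hD; rewrite mulrCA.
have -> : #|S|%:R = \sum_(k in S) 1 :> R by rewrite sumr_const.
rewrite [alpha * _]mulr_sumr mulr1; apply: averaging => // sigma.
apply: le_trans (_ : Num.sqrt D * \sum_(i | sigma i == Some g)
    Num.sqrt (\sum_(U | transversal sigma U && (i \in U))
    cmod (good_coefficient u d mult A p sigma U) ^+ 2) <= _); last first.
  rewrite ler_wpM2l ?sqrtr_ge0 //; apply: le_trans (mixed_norm_bound (@form_le sigma) g) _.
  by rewrite mulrA -exprMn -natrM.
rewrite (partition_big (fun k => e k g) (fun i => sigma i == Some g)) /=; last first.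
  by move=> k /andP[_ /andP[/forallP sel _]].
rewrite mulr_sumr; apply: ler_sum => i si.
pose T := [set k in S | live k sigma & e k g == i].
have -> : \sum_(k | (k \in S) && live k sigma && (e k g == i)) alpha = alpha * #|T|%:R.
  by rewrite mulr_natr -sumr_const; apply: eq_bigl => k; rewrite finset.in_set andbA.
have TD : #|T|%:R <= D.
  apply: le_trans (hD i); rewrite ler_nat subset_leq_card //; apply/fintype.subsetP => k.
  by rewrite !finset.in_set => /and3P[-> _ ->].
apply: le_trans (_ : Num.sqrt D * (alpha * Num.sqrt #|T|%:R) <= _).
  rewrite mulrCA ler_wpM2l // -{1}(sqr_sqrtr (ler0n R #|T|)) expr2.
  by rewrite ler_wpM2r ?sqrtr_ge0 // ler_wsqrtr.
rewrite ler_wpM2l ?sqrtr_ge0 //.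
rewrite -[alpha](ger0_norm al0) -sqrtr_sqr -sqrtrM ?sqr_ge0 // ler_wsqrtr //.
have TS k : k \in T -> k \in S /\ live k sigma by rewrite finset.in_set => /and3P[].
rewrite mulr_natr -sumr_const.
apply: le_trans (_ : \sum_(k in T) cmod (good_coefficient u d mult A p sigma (support k)) ^+ 2 <= _).
  apply: ler_sum => k kT; have [kS lk] := TS k kT.
  by rewrite live_coefficient // lerXn2r ?nnegrE ?cmod_ge0 ?hal.
rewrite -(big_imset (h := support) (fun U => cmod (good_coefficient u d mult A p sigma U) ^+ 2)
   (A := T)) /=; last first.
  by move=> k k' /TS[kS lk] /TS[kS' lk']; exact: (support_inj kS kS' lk lk').
rewrite [leLHS]big_mkcond [leRHS]big_mkcond; apply: ler_sum => U _.
case: ifP => [/imsetP[k kT ->]|_]; last by case: ifP => // _; exact: sqr_ge0.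
have [kS lk] := TS k kT; rewrite live_transversal //= ifT //.
by move: kT; rewrite finset.in_set => /and3P[_ _ /eqP <-]; rewrite imset_f.
Qed.

End TypeEstimates.

Section ChaosData.
Variables (R : realType) (G : zmodType) (d : nat).

(* mult k j is the exponent of u j in the monomial with coefficient A k. *)
Record chaos (I : finType) (u : I -> G -> R[i]) (K : finType) (mult : K -> I -> nat)
    (A : K -> R[i]) (B : R) : Prop := Chaos {
  chaos_hom : forall j, unimodular_hom (u j);
  chaos_dissociate : dissociate u d;
  chaos_sum : forall k, (\sum_j mult k j)%N = d;
  chaos_order : forall k j n, (0 < n <= mult k j)%N -> ~~ trivial_power u j n;
  chaos_inj : forall k k', mult k =1 mult k' -> k = k';
  chaos_bound : forall x, cmod (\sum_k A k * monomial u (fun j => (mult k j)%:Z) x) <= B }.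

End ChaosData.

(** * Interpolation of exponents and dyadic summation *)

Section Powers.
Variable R : realType.
Implicit Types x y : R.

Lemma powRD_gt0 x a b : 0 < x -> x `^ (a + b) = x `^ a * x `^ b.
Proof. by move=> x0; rewrite powRD // (gt_eqF x0) implybT. Qed.

Lemma powRV_gt0 x a : 0 < x -> a != 0 -> (x `^ a) `^ a^-1 = x.
Proof. by move=> x0 a0; rewrite -powRrM divff // powRr1 // ltW. Qed.

Lemma powR_exprn x n z : 0 <= x -> (x ^+ n) `^ z = (x `^ z) ^+ n.
Proof.
move=> x0; elim: n => [|n IH]; first by rewrite !expr0 powR1.
by rewrite !exprS powRM ?exprn_ge0 // IH.
Qed.

Lemma powR_prod (T : finType) (F : T -> R) z : (forall t, 0 <= F t) ->
  (\prod_t F t) `^ z = \prod_t F t `^ z.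
Proof.
move=> F0; elim: (index_enum T) => [|t s IH]; first by rewrite !big_nil powR1.
by rewrite !big_cons powRM ?IH // prodr_ge0.
Qed.

(** Raise the first bound to the power l = 2a - kappa and the second to 1 - l: the exponents of D
    add up to kappa/2. With kappa = 0 the variable D would disappear; a positive kappa leaves the
    decay needed to sum over dyadic degrees. *)
Lemma interpolation_bound (N D X C1 C2 a kappa q : R) :
  0 < N -> 0 < D -> 0 < X -> 0 < C1 -> 0 < C2 -> a < 1 -> 0 <= 2 * a - kappa <= 1 ->
  N `^ (1 - a) * D `^ (a - 2^-1) <= C1 * X ->
  N `^ (1 - a) * D `^ a <= C2 * X `^ q ->
  N <= (C1 `^ (2 * a - kappa) * C2 `^ (1 - (2 * a - kappa))) `^ (1 - a)^-1 *
       X `^ ((2 * a - kappa + q * (1 - (2 * a - kappa))) / (1 - a)) *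
       D `^ (- (kappa / (2 * (1 - a)))).
Proof.
move=> N0 D0 X0 C10 C20 a1; set l := 2 * a - kappa => /andP[l0 l1] h1 h2.
have b0 : 0 < 1 - a by lra.
have l1' : 0 <= 1 - l by lra.
have p0 x z : 0 < x -> 0 <= x `^ z by move=> ?; rewrite powR_ge0.
have h : N `^ (1 - a) <= C1 `^ l * C2 `^ (1 - l) * X `^ (l + q * (1 - l)) * D `^ (- (kappa / 2)).
  have := ge0_ler_powR l0 _ _ h1; rewrite !nnegrE
    (mulr_ge0 (powR_ge0 _ _) (powR_ge0 _ _)) (mulr_ge0 (ltW C10) (ltW X0)) => /(_ isT isT) e1.
  have := ge0_ler_powR l1' _ _ h2; rewrite !nnegrE
    (mulr_ge0 (powR_ge0 _ _) (powR_ge0 _ _)) (mulr_ge0 (ltW C20) (powR_ge0 _ _)) => /(_ isT isT) e2.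
  have := ler_pM (powR_ge0 _ _) (powR_ge0 _ _) e1 e2.
  have mX (C z s : R) : 0 < C -> (C * X `^ z) `^ s = C `^ s * X `^ (z * s).
    by move=> C0; rewrite powRM ?powR_ge0 ?powRrM // ltW.
  rewrite -{1}[X]powRr1 ?(ltW X0) // !mX // mul1r.
  rewrite !powRM ?powR_ge0 // -!powRrM => e3.
  rewrite powRN ler_pdivlMr ?powR_gt0 //.
  have -> : N `^ (1 - a) * D `^ (kappa / 2) = N `^ ((1 - a) * l) * D `^ ((a - 2^-1) * l) *
      (N `^ ((1 - a) * (1 - l)) * D `^ (a * (1 - l))).
    rewrite mulrACA -!powRD_gt0 //; by congr (_ `^ _ * _ `^ _); rewrite /l; field.
  apply: le_trans e3 _; rewrite le_eqVlt; apply/orP; left; apply/eqP.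
  by rewrite mulrACA -powRD_gt0.
have bi : 0 <= (1 - a)^-1 by rewrite invr_ge0 ltW.
have := ge0_ler_powR bi _ _ h; rewrite !nnegrE !mulr_ge0 ?powR_ge0 // => /(_ isT isT).
rewrite powRV_gt0 ?gt_eqF // => /le_trans; apply.
rewrite powRM ?mulr_ge0 ?powR_ge0 // [leLHS]mulrC powRM ?mulr_ge0 ?powR_ge0 // mulrC.
rewrite -!powRrM le_eqVlt; apply/orP; left; apply/eqP; congr (_ * _ * _ `^ _).
by field; rewrite gt_eqF.
Qed.

(** At kappa = 0 the exponent is 2 - 4/((r+1)(tau+1)). It is below 2d/(d+1) because r + tau <= r tau
    <= d when both are at least 2; the gap leaves room for a positive kappa. *)
Lemma exponent_gap (d r tau : nat) : (1 < tau)%N -> (r * tau <= d)%N -> (1 < r)%N ->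
  let a := (tau%:R - 1) / (2 * tau%:R) : R in
  let q := 2 * r%:R / (r%:R + 1) : R in
  exists2 kappa, 0 < kappa <= 2 * a &
    (2 * a - kappa + q * (1 - (2 * a - kappa))) / (1 - a) < (2 * d)%:R / (d + 1)%:R.
Proof.
move=> t1 rt r1 a q.
have t0 : (1 : R) < tau%:R by rewrite ltr1n.
have r0 : (1 : R) < r%:R by rewrite ltr1n.
have d0 : (0 : R) < d%:R by rewrite ltr0n; lia.
have gap : (r%:R + 1) * (tau%:R + 1) < 2 * (d%:R + 1) :> R.
  rewrite -!(natrD _ _ 1) -!natrM ltr_nat; nia.
set P : R := (2 * d)%:R / (d + 1)%:R.
have eP : P = 2 * d%:R / (d%:R + 1) by rewrite /P natrM natrD.
pose E0 := 2 * a + q * (1 - 2 * a).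
have a1 : 0 < 1 - a.
  have -> : 1 - a = (tau%:R + 1) / (2 * tau%:R) by rewrite /a; field; lra.
  by rewrite divr_gt0 //; lra.
have a0 : 0 < a by rewrite /a divr_gt0 //; lra.
have gap2 : E0 < P * (1 - a).
  rewrite -subr_gt0.
  have -> : P * (1 - a) - E0 = (2 * (d%:R + 1) - (r%:R + 1) * (tau%:R + 1)) /
      (tau%:R * (d%:R + 1) * (r%:R + 1)).
    by rewrite /E0 /q /a eP; field; rewrite !gt_eqF //; lra.
  by rewrite divr_gt0 ?mulr_gt0 //; lra.
have q1 : q - 1 < 1.
  by rewrite /q ltrBlDr ltr_pdivrMr; lra.
have half0 : 0 < (P * (1 - a) - E0) / 2 by lra.
have a2 : 0 < 2 * a by lra.
(* The numerator grows with slope q - 1 < 1 in kappa, so half of the slack can be spent. *)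
exists (Num.min (2 * a) ((P * (1 - a) - E0) / 2)).
  by rewrite lt_min ge_min lexx a2 half0.
set kappa := Num.min _ _.
have k0 : 0 < kappa by rewrite lt_min a2 half0.
have k1 : kappa <= (P * (1 - a) - E0) / 2 by rewrite ge_min lexx orbT.
rewrite ltr_pdivrMr //; move: gap2 k1; rewrite /E0; nra.
Qed.

Lemma geometric_layers (T : finType) (S : {set T}) (level : T -> nat) (F : T -> R) (C rho : R) :
  0 <= C -> 0 <= rho < 1 ->
  (forall l, \sum_(t in S | level t == l) F t <= C * rho ^+ l) ->
  \sum_(t in S) F t <= C / (1 - rho).
Proof.
move=> C0 /andP[rho0 rho1] h; pose n := (\max_(t : T) level t).+1.
rewrite (partition_big (fun t => inord (level t) : 'I_n) predT) //=.
apply: le_trans (_ : \sum_(l < n) C * rho ^+ l <= _).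
  apply: ler_sum => l _; apply: le_trans (h l); rewrite le_eqVlt; apply/orP; left; apply/eqP.
  apply: eq_bigl => t; congr (_ && _); rewrite -val_eqE /= inordK // ltnS.
  exact: leq_bigmax.
rewrite -mulr_sumr ler_wpM2l // -[leRHS]mul1r ler_pdivlMr; last by lra.
have := subrX1 rho n; have : 0 <= rho ^+ n by rewrite exprn_ge0.
nra.
Qed.

End Powers.

Section Rate.
Variables (R : realType) (d : nat).
Hypothesis d_gt0 : (0 < d)%N.

(** The first summand yields [rate_sum], the bound 1/(8d) on the total selection probability; the
    second yields [rate_small], the smallness of bad events with delta = rate^2. *)
Definition rate : R := ((8 * d * d)%:R + 2 * d%:R * selection_constant R d)^-1.

Let dd1 : 1 <= (8 * d * d)%:R :> R.
Proof. by rewrite ler1n !muln_gt0 d_gt0. Qed.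

Let sel0 : 0 <= selection_constant R d.
Proof. by rewrite !mulr_ge0 ?exprn_ge0. Qed.

Let den1 : 1 <= (8 * d * d)%:R + 2 * d%:R * selection_constant R d.
Proof. by rewrite (le_trans dd1) // lerDl !mulr_ge0. Qed.

Lemma rate_gt0 : 0 < rate.
Proof. by rewrite invr_gt0 (lt_le_trans ltr01). Qed.

Lemma rate_le1 : rate <= 1.
Proof. by rewrite invf_le1 // (lt_le_trans ltr01). Qed.

Lemma rate_sum r : (r <= d)%N -> r%:R * rate <= (8 * d)%:R^-1.
Proof.
move=> rd; apply: le_trans (_ : d%:R * rate <= _).
  by rewrite ler_wpM2r ?(ltW rate_gt0) // ler_nat.
rewrite ler_pdivrMr ?(lt_le_trans ltr01) // ler_pdivlMl ?ltr0n ?muln_gt0 //.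
by rewrite [(8 * d * d)%:R]natrM lerDl !mulr_ge0.
Qed.

Lemma rate_small r : (r <= d)%N -> r%:R * (selection_constant R d * rate ^+ 2) <= 2^-1.
Proof.
move=> rd; have c0 := rate_gt0; have c1 := rate_le1.
apply: le_trans (_ : (d%:R * selection_constant R d * rate) * rate <= _).
  rewrite mulrA expr2 mulrA -!mulrA ler_wpM2r ?ler_nat //.
  by rewrite !mulr_ge0 // ltW.
apply: le_trans (_ : d%:R * selection_constant R d * rate <= _).
  by rewrite ler_piMr // !mulr_ge0 // ltW.
rewrite ler_pdivrMr ?(lt_le_trans ltr01) //; have := dd1; lra.
Qed.

End Rate.

(** * Monomials of a fixed type *)

Section TypeBounds.
Variables (R : realType) (G : zmodType) (d : nat).
Hypothesis d_gt0 : (0 < d)%N.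
Variables (r : nat) (p : 'I_r -> nat).
Hypothesis p_gt0 : forall g, (0 < p g)%N.
Hypothesis p_sum : (\sum_g p g)%N = d.

Let P : R := (2 * d)%:R / (d + 1)%:R.
Let q : R := 2 * r%:R / (r%:R + 1).
Let c : R := rate R d.

Let c_gt0 : 0 < c. Proof. exact: rate_gt0. Qed.

Let r_gt0 : (0 < r)%N.
Proof.
rewrite lt0n; apply/negP => /eqP r0; have := d_gt0.
by rewrite -p_sum big1 // => g; have := ltn_ord g; rewrite [X in (_ < X)%N]r0.
Qed.

Let r_leq : (r <= d)%N.
Proof. by rewrite -p_sum -[X in (X <= _)%N]card_ord -sum1_card; exact: leq_sum. Qed.

Let q_gt0 : 0 < q.
Proof. by rewrite divr_gt0 ?mulr_gt0 ?ltr0n ?ltr_wpDl. Qed.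

Let q_le_P : q <= P.
Proof.
have rR : (0 : R) < r%:R by rewrite ltr0n.
have rd : r%:R <= d%:R :> R by rewrite ler_nat.
rewrite /q /P natrM natrD ler_pdivrMr; last by lra.
rewrite mulrAC ler_pdivlMr; last by lra.
nra.
Qed.

Let BH : R := bohnenblust_hille_constant R r * 2 ^+ r.

Let BH_gt0 : 0 < BH.
Proof.
rewrite mulr_gt0 ?exprn_gt0 // !mulr_gt0 ?ltr0n ?exprn_gt0 // sqrtr_gt0 ltr_wpDr ?exprn_ge0.
Qed.

(** The constant is fixed before the family of characters, so it cannot depend on their number. *)
Definition type_bounded : Prop := exists2 C : R, 0 < C &
  forall (I : finType) (u : I -> G -> R[i]) (K : finType) (mult : K -> I -> nat)
    (A : K -> R[i]) (B : R), chaos d u mult A B ->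
  forall (S : {set K}) (e : K -> 'I_r -> I), (forall k, k \in S -> arranged mult p k (e k)) ->
  \sum_(k in S) cmod (A k) `^ P <= C * B `^ P.

(** At most one head is possible, so constant probabilities satisfy [theta_small]. The exponent q of
    the resulting estimate is raised to P by means of |A_k| <= B. *)
Lemma flat_type_bounded : (forall g, (d < 2 * (d.+1 - p g))%N) -> type_bounded.
Proof.
move=> flat; exists (2 * c ^- r * BH `^ q) => [|I u K mult A B [hu hdi hs ho hi hB] S e ar].
  by rewrite !mulr_gt0 ?powR_gt0 ?invr_gt0 ?exprn_gt0.
have B0 : 0 <= B by apply: le_trans (cmod_ge0 _) (hB 0).
have AB k : cmod (A k) <= B := chaos_coefficient_bound hu hdi hs ho hi hB k.
have small (g : 'I_r) t : (0 < t)%N -> (t * (d.+1 - p g) <= d)%N ->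
    #|[set: I]|%:R ^+ t.-1 * c ^+ (2 * t) <= c ^+ 2.
  move=> t0 ht; have -> : t = 1%N by have := flat g; nia.
  by rewrite expr0 mul1r.
have sumc : \sum_(g < r) c <= (8 * d)%:R^-1.
  rewrite sumr_const card_ord -[c *+ r]mulr_natl; exact: rate_sum.
have := arranged_power_sum hu d_gt0 hdi hs ho hi hB p_gt0 p_sum
  (theta := fun=> c) (V := fun=> [set: I]) (fun=> c_gt0) sumc small (rate_small R d_gt0 r_leq)
  ar (fun k g _ => finset.in_setT _).
have eP : q + (P - q) = P by rewrite addrC subrK.
rewrite prodr_const card_ord -/q mulrA -/BH powRM ?(ltW BH_gt0) // => h.
apply: le_trans (_ : (\sum_(k in S) cmod (A k) `^ q) * B `^ (P - q) <= _).
  rewrite mulr_suml; apply: ler_sum => k _.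
  have [->|An] := eqVneq (cmod (A k)) 0.
    by rewrite powR0 ?mulr_ge0 ?powR_ge0 // gt_eqF // (lt_le_trans q_gt0).
  have Ap : 0 < cmod (A k) by rewrite lt_neqAle eq_sym An cmod_ge0.
  rewrite -[leLHS]/(cmod (A k) `^ P) -[in leLHS]eP powRD_gt0 // ler_wpM2l ?powR_ge0 //.
  by rewrite ge0_ler_powR ?nnegrE ?subr_ge0 ?cmod_ge0.
have [B00|Bn] := eqVneq B 0.
  have -> : \sum_(k in S) cmod (A k) `^ q = 0.
    apply: big1 => k _; rewrite (_ : cmod (A k) = 0) ?powR0 ?gt_eqF //.
    by apply/eqP; rewrite eq_le cmod_ge0 -B00 AB.
  by rewrite mul0r !mulr_ge0 ?powR_ge0 ?invr_ge0 ?exprn_ge0 ?ltW.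
have Bp : 0 < B by rewrite lt_neqAle eq_sym Bn.
rewrite -[in leRHS]eP [in leRHS]powRD_gt0 // mulrA ler_wpM2r ?powR_ge0 //.
move: h; rewrite -mulrA ler_pdivrMl // -ler_pdivlMl ?exprn_gt0 // => /le_trans; apply.
by rewrite mulrCA !mulrA.
Qed.

(** * Types with one dominating exponent *)

Section Steep.
Variable g1 : 'I_r.
Hypothesis others_flat : forall g, g != g1 -> (d < 2 * (d.+1 - p g))%N.
Let tau := (d %/ (d.+1 - p g1))%N.
Hypothesis tau_gt1 : (1 < tau)%N.
Let a : R := (tau%:R - 1) / (2 * tau%:R).

Let tauR : 1 < tau%:R :> R. Proof. by rewrite ltr1n. Qed.

Let a_ge0 : 0 <= a.
Proof. by rewrite divr_ge0 //; have := tauR; lra. Qed.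

Let a_lt1 : a < 1.
Proof. by rewrite ltr_pdivrMr; have := tauR; lra. Qed.

Let C1 : R := 4 * c ^- r * 6 ^+ r.
Let C2 : R := 4 * c ^- r * BH `^ q.

(** Every fibre has at least D/2 elements, so the n values of [e k g1] satisfy n <= 2N/D. With
    selection probability c n^(-a) in group g1, both averaged estimates turn into inequalities
    between N and D. *)
Lemma steep_class (I : finType) (u : I -> G -> R[i]) (K : finType) (mult : K -> I -> nat)
    (A : K -> R[i]) (B : R) (S : {set K}) (e : K -> 'I_r -> I) (alpha D : R) :
  chaos d u mult A B -> (forall k, k \in S -> arranged mult p k (e k)) ->
  0 < alpha -> 0 < D -> (0 < #|S|)%N ->
  (forall k, k \in S -> alpha <= cmod (A k)) ->
  (forall i, #|[set k in S | e k g1 == i]|%:R <= D) ->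
  (forall k, k \in S -> D <= 2 * #|[set k' in S | e k' g1 == e k g1]|%:R) ->
  #|S|%:R `^ (1 - a) * D `^ (a - 2^-1) <= C1 * (B / alpha) /\
  #|S|%:R `^ (1 - a) * D `^ a <= C2 * (B / alpha) `^ q.
Proof.
move=> [hu hdi hs ho hi hB] ar al0 D0 S0 hal hD hD2.
have B0 : 0 <= B by apply: le_trans (cmod_ge0 _) (hB 0).
set N : R := #|S|%:R; have N0 : 0 < N by rewrite ltr0n.
pose V1 : {set I} := [set e k g1 | k in S].
pose n : R := #|V1|%:R.
have n1 : 1 <= n.
  rewrite ler1n; have /card_gt0P[k kS] := S0.
  by apply/card_gt0P; exists (e k g1); exact: imset_f.
have n0 : 0 < n by rewrite (lt_le_trans ltr01).
have nN : n <= 2 * (N / D).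
  rewrite mulrA ler_pdivlMr //.
  have -> : N = \sum_(i in V1) #|[set k in S | e k g1 == i]|%:R.
    rewrite /N -sum1_card (partition_big (fun k => e k g1) (fun i => i \in V1)) /=; last first.
      by move=> k kS; exact: imset_f.
    rewrite natr_sum; apply: eq_bigr => i _; rewrite -sum1_card; congr (_%:R).
    by apply: eq_bigl => k; rewrite [RHS]finset.in_set.
  rewrite mulr_sumr mulr_natl -sumr_const; apply: ler_sum => i /imsetP[k kS ->].
  exact: hD2.
pose theta g := if g == g1 then c * n `^ (- a) else c.
pose V g := if g == g1 then V1 else [set: I].
have na1 : n `^ (- a) <= 1.
  by rewrite -[leRHS](powRr0 n) ler_powR // oppr_le0.
have th0 g : 0 < theta g by rewrite /theta; case: ifP => _ //; rewrite mulr_gt0 ?powR_gt0.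
have thc g : theta g <= c.
  by rewrite /theta; case: ifP => // _; rewrite ler_piMr // ltW.
have sumt : \sum_g theta g <= (8 * d)%:R^-1.
  apply: le_trans (rate_sum R d_gt0 r_leq); rewrite mulr_natl -[r in _ *+ r]card_ord -sumr_const.
  by apply: ler_sum => g _; exact: thc.
have small g t : (0 < t)%N -> (t * (d.+1 - p g) <= d)%N ->
    #|V g|%:R ^+ t.-1 * theta g ^+ (2 * t) <= c ^+ 2.
  move=> t0 ht; have [eg|ng] := eqVneq g g1; last first.
    have -> : t = 1%N.
      have := leq_ltn_trans ht (others_flat ng); rewrite ltn_mul2r => /andP[_].
      by case: t t0 {ht} => [|[]].
    by rewrite expr0 mul1r lerXn2r ?nnegrE // ltW.
  rewrite eg in ht *; rewrite /V /theta !eqxx -/n exprMn mulrCA.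
  have ttau : (t <= tau)%N by rewrite /tau leq_divRL // subn_gt0 ltnS (p_leq p_sum).
  apply: le_trans (_ : c ^+ (2 * t) <= _); last first.
    rewrite ler_wiXn2l ?(ltW c_gt0) //; first exact: rate_le1.
    by rewrite leq_pmulr.
  rewrite ler_piMr ?exprn_ge0 ?(ltW c_gt0) //.
  rewrite -!powR_mulrn ?powR_ge0 ?(ltW n0) // -powRrM -powRD_gt0 //.
  rewrite -[leRHS](powRr0 n) ler_powR //.
  (* The exponent of n is t/tau - 1; a is the least value that keeps it nonpositive up to t =
     tau. *)
  have -> : t.-1%:R + - a * (2 * t)%:R = t%:R / tau%:R - 1 :> R.
    rewrite -subn1 natrB // natrM /a; field; have := tauR; lra.
  by rewrite subr_le0 ler_pdivrMr ?mul1r ?ler_nat // (lt_trans ltr01).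
have SV k g : k \in S -> e k g \in V g.
  move=> kS; rewrite /V; case: eqP => [->|_]; last exact: finset.in_setT.
  exact: imset_f.
have prodt : \prod_g theta g = c ^+ r * n `^ (- a).
  rewrite (bigD1 g1) //= {1}/theta eqxx (eq_bigr (fun=> c)) => [|g /negPf ng]; last first.
    by rewrite /theta ng.
  have : \prod_(g < r) c = c ^+ r by rewrite prodr_const card_ord.
  by rewrite (bigD1 g1) //= => <-; rewrite mulrAC.
have cr0 : 0 < c ^+ r by rewrite exprn_gt0.
have na : n `^ a <= 2 * (N / D) `^ a.
  apply: le_trans (_ : (2 * (N / D)) `^ a <= _).
    by apply: ge0_ler_powR nN => //; rewrite nnegrE ?(ltW n0) // ltW // mulr_gt0 // divr_gt0.
  rewrite powRM ?divr_ge0 ?(ltW N0) ?(ltW D0) // ler_wpM2r ?powR_ge0 //.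
  by rewrite -[leRHS]powRr1 //; apply: ler_powR; [rewrite ler1n | exact: ltW].
have transfer (Y Z : R) : 0 <= Z ->
    2^-1 * (c ^+ r * n `^ (- a)) * (N * Y) <= Z -> N `^ (1 - a) * D `^ a * Y <= 4 * c ^- r * Z.
  move=> Z0; rewrite powRN => h.
  have {}h : N * Y <= 2 * c ^- r * (n `^ a * Z).
    move: h; rewrite -ler_pdivlMl; last by rewrite !mulr_gt0 ?invr_gt0 ?powR_gt0.
    move=> /le_trans; apply; rewrite !invfM !invrK le_eqVlt; apply/orP; left; apply/eqP; ring.
  have {}h : N * Y <= 2 * c ^- r * (2 * (N / D) `^ a * Z).
    apply: le_trans h _; rewrite ler_wpM2l ?mulr_ge0 ?invr_ge0 ?exprn_ge0 ?(ltW c_gt0) //.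
    by rewrite ler_wpM2r.
  have NDa : 0 < (N / D) `^ a by rewrite powR_gt0 // divr_gt0.
  rewrite -(ler_pM2l NDa).
  have -> : (N / D) `^ a * (N `^ (1 - a) * D `^ a * Y) = N * Y.
    have -> : N `^ (1 - a) * D `^ a * Y = D `^ a * N `^ (1 - a) * Y by ring.
    rewrite !mulrA -powRM ?divr_ge0 ?(ltW N0) ?(ltW D0) // divfK ?gt_eqF //.
    by rewrite -powRD_gt0 // addrC subrK powRr1 // ltW.
  apply: le_trans h _; rewrite le_eqVlt; apply/orP; left; apply/eqP; ring.
split.
  have := arranged_count hu d_gt0 hdi hs ho hi hB p_gt0 p_sum th0 sumt small
    (rate_small R d_gt0 r_leq) ar SV (ltW al0) (ltW D0) hal hD.
  rewrite prodt mulrCA -/N [alpha * N]mulrC => /transfer h.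
  have {}h := h (mulr_ge0 (sqrtr_ge0 _) (mulr_ge0 (exprn_ge0 _ (ler0n _ _)) B0)).
  have sD0 : 0 < Num.sqrt D by rewrite sqrtr_gt0.
  have sD : D `^ a = D `^ (a - 2^-1) * Num.sqrt D.
    by rewrite -powR12_sqrt ?(ltW D0) // -powRD_gt0 // subrK.
  rewrite mulrA ler_pdivlMr // -(ler_pM2r sD0) /C1; move: h; rewrite sD.
  set x := N `^ _; set y := D `^ _; set z := Num.sqrt D => h.
  have -> : x * y * alpha * z = x * (y * z) * alpha by ring.
  by apply: le_trans h _; rewrite le_eqVlt; apply/orP; left; apply/eqP; ring.
have h := arranged_power_sum hu d_gt0 hdi hs ho hi hB p_gt0 p_sum th0 sumt small
    (rate_small R d_gt0 r_leq) ar SV.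
have {}h : 2^-1 * (c ^+ r * n `^ (- a)) * (N * alpha `^ q) <= (BH * B) `^ q.
  move: h; rewrite prodt mulrA -/q -/BH; apply: le_trans; rewrite ler_wpM2l //.
    by rewrite mulr_ge0 // mulr_ge0 ?powR_ge0 // ltW.
  rewrite mulr_natl -sumr_const; apply: ler_sum => k kS.
  by rewrite ge0_ler_powR ?nnegrE ?cmod_ge0 ?hal ?ltW.
have {}h := transfer _ _ (powR_ge0 _ _) h.
rewrite -(ler_pM2r (powR_gt0 q al0)) -[leRHS]mulrA -powRM ?divr_ge0 ?(ltW al0) //.
by rewrite divfK ?gt_eqF // /C2 -[leRHS]mulrA -powRM // ltW.
Qed.

(** The class with |A_k| near B 2^(-m) and fibres near 2^l contributes at most C3 B^P rho1^m rho2^l.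
    Here rho1 < 1 because the weak type exponent eta is below P, and rho2 < 1 because kappa > 0. *)
Lemma steep_type_bounded : (r * tau <= d)%N -> (1 < r)%N -> type_bounded.
Proof.
move=> rtau r1.
have [kappa /andP[k0 k2a]] := @exponent_gap R d r tau tau_gt1 rtau r1.
rewrite -/a -/q -/P; set eta := _ / (1 - a) => etaP.
pose rho1 : R := 2 `^ (eta - P); pose rho2 : R := 2 `^ (- (kappa / (2 * (1 - a)))).
have two1 : 1 < 2 :> R by rewrite ltr1n.
have b0 : 0 < 1 - a by have := a_lt1; lra.
have pow_lt1 (z : R) : z < 0 -> 0 <= (2 : R) `^ z < 1.
  move=> z0; rewrite powR_ge0 -[z]opprK powRN invf_lt1 ?powR_gt0 //=.
  have one : (1 : R) `^ (- z) = 1 by rewrite powR1.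
  by rewrite -[ltLHS]one gt0_ltr_powR ?oppr_gt0 // nnegrE.
have h1 : 0 <= rho1 < 1 by apply: pow_lt1; lra.
have h2 : 0 <= rho2 < 1 by apply: pow_lt1; rewrite oppr_lt0 !divr_gt0 ?mulr_gt0.
pose lam := 2 * a - kappa.
(* The factors 2^eta and rho2 come from using B/alpha = 2^(m+1) and D = 2^(l+1), one dyadic step
   above m and l. *)
pose C3 : R := (C1 `^ lam * C2 `^ (1 - lam)) `^ (1 - a)^-1 * 2 `^ eta * rho2.
have p4 : 0 < 4 * c ^- r by rewrite mulr_gt0 ?invr_gt0 ?exprn_gt0.
have C10 : 0 < C1 by rewrite mulr_gt0 ?exprn_gt0.
have C20 : 0 < C2 by rewrite mulr_gt0 ?powR_gt0.
have C30 : 0 < C3.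
  by rewrite mulr_gt0 ?powR_gt0 // mulr_gt0 ?powR_gt0 // mulr_gt0 ?powR_gt0.
exists (C3 / (1 - rho2) / (1 - rho1)) => [|I u K mult A B ch S e ar].
  by case/andP: h1; case/andP: h2 => *; rewrite !divr_gt0 // subr_gt0.
have [hu hdi hs ho hi hB] := ch.
have AB k : cmod (A k) <= B := chaos_coefficient_bound hu hdi hs ho hi hB k.
have P0 : 0 < P by exact: lt_le_trans q_gt0 q_le_P.
pose S' := [set k in S | A k != 0].
have -> : \sum_(k in S) cmod (A k) `^ P = \sum_(k in S') cmod (A k) `^ P.
  rewrite (bigID (fun k => A k != 0)) /= [X in _ + X]big1 ?addr0.
    by apply: eq_bigl => k; rewrite [RHS]finset.in_set.
  by move=> k /andP[_ /negPn/eqP ->]; rewrite cmod0 powR0 // gt_eqF.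
have S'P k : k \in S' -> k \in S /\ 0 < cmod (A k).
  by rewrite finset.in_set => /andP[-> An]; rewrite lt_neqAle cmod_ge0 eq_sym cmod_eq0 An.
pose mlev k := trunc_log 2 (Num.truncn (B / cmod (A k))).
have mlevP k : k \in S' ->
    B / 2 ^+ (mlev k).+1 <= cmod (A k) /\ cmod (A k) <= B / 2 ^+ mlev k.
  move=> /S'P[_ Ap]; set f := Num.truncn (B / cmod (A k)).
  have BA : 1 <= B / cmod (A k) by rewrite ler_pdivlMr // mul1r.
  have BA0 : 0 <= B / cmod (A k) by exact: le_trans BA.
  have f0 : (0 < f)%N by rewrite truncn_ge_nat.
  have /andP[fl fu] := truncn_itv BA0.
  have /andP[l1 l2] := trunc_log_bounds (isT : (1 < 2)%N) f0.
  split.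
    rewrite ler_pdivrMr ?exprn_gt0 // -ler_pdivrMl // mulrC (le_trans (ltW fu)) //.
    by rewrite -natrX ler_nat.
  rewrite ler_pdivlMr ?exprn_gt0 // mulrC -ler_pdivlMr // (le_trans _ fl) //.
  by rewrite -natrX ler_nat.
have B0 : 0 <= B by apply: le_trans (cmod_ge0 _) (hB 0).
have -> : C3 / (1 - rho2) / (1 - rho1) * B `^ P = (C3 * B `^ P / (1 - rho2)) / (1 - rho1) by ring.
apply: (geometric_layers (level := mlev) _ h1) => [|m].
  by rewrite divr_ge0 ?mulr_ge0 ?powR_ge0 ?(ltW C30) //; case/andP: h2 => _ ?; rewrite subr_ge0 ltW.
(* mlev k is the dyadic size of B / |A k|; Sm is then split according to the
   dyadic size of the number of monomials with the same first index. *)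
pose Sm := [set k in S' | mlev k == m].
pose deg k := #|[set k' in Sm | e k' g1 == e k g1]|.
have -> : \sum_(k in S' | mlev k == m) cmod (A k) `^ P = \sum_(k in Sm) cmod (A k) `^ P.
  by apply: eq_bigl => k; rewrite [RHS]finset.in_set.
have -> : C3 * B `^ P / (1 - rho2) * rho1 ^+ m = (C3 * B `^ P * rho1 ^+ m) / (1 - rho2) by ring.
have rho10 : 0 <= rho1 by case/andP: h1.
have rho20 : 0 <= rho2 by case/andP: h2.
apply: (geometric_layers (level := fun k => trunc_log 2 (deg k)) _ h2) => [|l].
  by rewrite mulr_ge0 ?exprn_ge0 // mulr_ge0 ?powR_ge0 // ltW.
pose T := [set k in Sm | trunc_log 2 (deg k) == l].
have -> : \sum_(k in Sm | trunc_log 2 (deg k) == l) cmod (A k) `^ P = \sum_(k in T) cmod (A k) `^ P.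
  by apply: eq_bigl => k; rewrite [RHS]finset.in_set.
have [->|/finset.set0Pn[k1 k1T]] := eqVneq T finset.set0.
  by rewrite big_set0 mulr_ge0 ?exprn_ge0 // mulr_ge0 ?exprn_ge0 // mulr_ge0 ?powR_ge0 // ltW.
have TP k : k \in T -> [/\ k \in S', mlev k = m & trunc_log 2 (deg k) = l].
  by rewrite finset.in_set finset.in_set => /andP[/andP[-> /eqP ->] /eqP ->].
have Bp : 0 < B by have [/S'P[_ h] _ _] := TP _ k1T; exact: lt_le_trans (AB k1).
(* The degree depends only on [e k g1], so T is a union of whole fibres of Sm. *)
have degT k : k \in T -> #|[set k' in T | e k' g1 == e k g1]| = deg k.
  move=> kT; have [_ _ lk] := TP k kT; apply: eq_card => k'.
  rewrite [LHS]finset.in_set [RHS]finset.in_set.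
  have [ek|_] := eqVneq (e k' g1) (e k g1); rewrite ?andbF // !andbT finset.in_set.
  have -> : deg k' = deg k by rewrite /deg ek.
  by rewrite lk eqxx andbT.
have deg0 k : k \in T -> (0 < deg k)%N.
  move=> kT; apply/card_gt0P; exists k; rewrite finset.in_set eqxx andbT.
  by move: kT; rewrite finset.in_set => /andP[].
have ch' := steep_class (S := T) (e := e) (alpha := B / 2 ^+ m.+1) (D := 2 ^+ l.+1) ch.
have [] := ch'.
- by move=> k /TP[/S'P[kS _] _ _]; exact: ar.
- by rewrite divr_gt0 ?exprn_gt0.
- by rewrite exprn_gt0.
- by apply/card_gt0P; exists k1.
- by move=> k /TP[/mlevP[h _] mk _]; move: h; rewrite mk.
- move=> i; have [->|/finset.set0Pn[k]] := eqVneq [set k in T | e k g1 == i] finset.set0.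
    by rewrite cards0 exprn_ge0.
  rewrite finset.in_set => /andP[kT /eqP <-]; rewrite degT //.
  have /andP[_ h] := trunc_log_bounds (isT : (1 < 2)%N) (deg0 k kT).
  have [_ _ lk] := TP k kT; rewrite lk in h.
  by rewrite -natrX ler_nat ltnW.
- move=> k kT; rewrite degT //.
  have /andP[h _] := trunc_log_bounds (isT : (1 < 2)%N) (deg0 k kT).
  have [_ _ lk] := TP k kT; rewrite lk in h.
  by rewrite exprS ler_pM2l // -natrX ler_nat.
have -> : B / (B / 2 ^+ m.+1) = 2 ^+ m.+1 by rewrite invf_div mulrCA divff ?mulr1 // gt_eqF.
move=> e1 e2.
have N0 : (0 : R) < #|T|%:R by rewrite ltr0n; apply/card_gt0P; exists k1.
have pw0 n : (0 : R) < 2 ^+ n by rewrite exprn_gt0.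
have lam01 : 0 <= 2 * a - kappa <= 1.
  have t0 : 0 < tau%:R :> R by exact: lt_trans tauR.
  have a2 : 2 * a = 1 - tau%:R^-1 by rewrite /a; field; rewrite gt_eqF.
  have ti : 0 <= tau%:R^-1 :> R by rewrite invr_ge0 ltW.
  by rewrite subr_ge0 k2a /=; move: k0 a2 ti; lra.
have := interpolation_bound N0 (pw0 _) (pw0 _) C10 C20 a_lt1 lam01 e1 e2.
rewrite -/eta -/lam => h.
have pwX n (z : R) : (2 ^+ n) `^ z = (2 `^ z) ^+ n by exact: powR_exprn.
rewrite !pwX -/rho2 in h.
apply: le_trans (_ : #|T|%:R * (B / 2 ^+ m) `^ P <= _).
  rewrite mulr_natl -sumr_const; apply: ler_sum => k /TP[/mlevP[_ hk] mk _].
  by rewrite mk in hk; rewrite ge0_ler_powR ?nnegrE ?divr_ge0 ?cmod_ge0 ?(ltW P0) // ltW.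
have eB : (B / 2 ^+ m) `^ P = B `^ P / (2 `^ P) ^+ m.
  by rewrite -pwX -[in RHS](divfK (lt0r_neq0 (pw0 m)) B) [in RHS]powRM
    ?divr_ge0 ?(ltW (pw0 m)) // mulfK // gt_eqF ?powR_gt0.
have er : rho1 ^+ m = (2 `^ eta) ^+ m / (2 `^ P) ^+ m.
  by rewrite -exprVn -exprMn -powRN -powRD_gt0.
rewrite eB er; set Q := (2 `^ P) ^+ m.
have Q0 : 0 < Q by rewrite exprn_gt0 // powR_gt0.
have BQ0 : 0 <= B `^ P / Q by rewrite divr_ge0 ?powR_ge0 // ltW.
apply: le_trans (ler_wpM2r BQ0 h) _.
by rewrite /C3 !exprS le_eqVlt; apply/orP; left; apply/eqP; ring.
Qed.

End Steep.

End TypeBounds.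

Section CommonTypes.
Variables (R : realType) (G : zmodType) (d : nat).
Hypothesis d_gt0 : (0 < d)%N.

(** Exponents other than a largest one p_g1 are at most d/2, hence flat. The r - 1 others are at
    least 1, so r <= d+1-p_g1 and r tau <= d. If d = 1 then tau = 1, and the steep case does not
    arise. *)
Lemma mixed_type_bounded (r : nat) (p : 'I_r -> nat) :
  (forall g, (0 < p g)%N) -> (\sum_g p g)%N = d -> (1 < r)%N || (d == 1%N) ->
  type_bounded R G d p.
Proof.
move=> p0 ps r1.
have [g0 _] : exists g0 : 'I_r, true.
  case: r p p0 ps {r1} => [|r'] p p0 ps; last by exists ord0.
  by have := d_gt0; rewrite -ps big_ord0.
have := @arg_maxnP _ g0 predT p isT; case=> g1 _ /(_ _ isT) hmax.
have flat g : g != g1 -> (d < 2 * (d.+1 - p g))%N.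
  by move=> ng; have := p_leq2 ps ng; have := hmax g; lia.
have [t1|t1] := leqP (d %/ (d.+1 - p g1)) 1.
  apply: flat_type_bounded => // g; have [->|/flat //] := eqVneq g g1.
  rewrite -ltn_divLR ?ltnS // subn_gt0 ltnS; exact: p_leq ps _.
have pr : (p g1 + r.-1 <= d)%N.
  rewrite -ps (bigD1 g1) //= leq_add2l.
  apply: leq_trans (_ : \sum_(g | g != g1) 1 <= _)%N; last exact: leq_sum.
  by rewrite sum1_card cardC1 card_ord.
have r2 : (1 < r)%N.
  case/orP: r1 => // /eqP d1; have := p0 g1; move: t1 pr; rewrite d1.
  by case: (p g1) => [|[|x]] //; rewrite ?divn1 //; lia.
apply: (steep_type_bounded R G d_gt0 p0 ps flat t1) => //.
apply: leq_trans (leq_trunc_div d (d.+1 - p g1)).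
by rewrite mulnC leq_mul2l; lia.
Qed.

End CommonTypes.

(** * Pure powers *)

Section Diagonal.
Variables (R : realType) (G : zmodType) (d : nat).
Hypothesis d_gt1 : (1 < d)%N.

Let d_gt0 : (0 < d)%N. Proof. exact: ltnW. Qed.
Variables (I : finType) (u : I -> G -> R[i]) (K : finType) (mult : K -> I -> nat).
Variables (A : K -> R[i]) (B : R).
Hypothesis ch : chaos d u mult A B.

Let P : R := (2 * d)%:R / (d + 1)%:R.

Definition diagonal (k : K) : bool := [exists j, mult k j == d].

Let P_gt1 : 1 < P.
Proof. by rewrite ltr_pdivlMr ?mul1r ?ltr_nat ?ltr0n; lia. Qed.

Let P_gt0 : 0 < P. Proof. exact: lt_trans P_gt1. Qed.

Let mult_diag k j i : mult k j = d -> mult k i = if i == j then d else 0%N.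
Proof.
move=> kj; case: eqP => [->//|/eqP ij]; have := chaos_sum ch k.
by rewrite (bigD1 j) //= (bigD1 i) //= kj; lia.
Qed.

Let diag_uniq k k' j : mult k j = d -> mult k' j = d -> k = k'.
Proof.
by move=> kj kj'; apply: (chaos_inj ch) => i; rewrite (mult_diag i kj) (mult_diag i kj').
Qed.

(** The normalization runs over all monomials, as the error terms involve coefficients off the
    diagonal. *)
Let T : R := \sum_k cmod (A k) `^ P.
Hypothesis T_gt0 : 0 < T.
Let tau : R := T `^ P^-1.
Let y k : R := cmod (A k) `^ P / T.
Let s : R := P^-1.

Let tau_gt0 : 0 < tau. Proof. exact: powR_gt0. Qed.

Let y_ge0 k : 0 <= y k.
Proof. by rewrite divr_ge0 ?powR_ge0 // ltW. Qed.

Let y_sum : \sum_k y k = 1.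
Proof. by rewrite -mulr_suml divff // gt_eqF. Qed.

Let A_y k : cmod (A k) = tau * y k `^ s.
Proof.
rewrite -powRM ?(ltW T_gt0) // /y mulrCA divff ?gt_eqF // mulr1 -powRrM divff ?gt_eqF //.
by rewrite powRr1 ?cmod_ge0.
Qed.

Let s01 : 0 <= s <= 1.
Proof. by rewrite invr_ge0 (ltW P_gt0) invf_le1 // ltW. Qed.

Let s_lt1 : s < 1.
Proof. by rewrite invf_lt1. Qed.

Let kd j : option K := [pick k | mult k j == d].
Let x j : R := if kd j is Some k then y k else 0.

Let kdP j k : kd j = Some k -> mult k j = d.
Proof. by rewrite /kd; case: pickP => // k' /eqP h [<-]. Qed.

Let x_ge0 j : 0 <= x j.
Proof. by rewrite /x; case: (kd j). Qed.

Let x_sum : \sum_j x j = \sum_(k | diagonal k) y k.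
Proof.
have -> : \sum_j x j = \sum_j \sum_(k | mult k j == d) y k.
  apply: eq_bigr => j _; rewrite /x /kd; case: pickP => [k /eqP kj|none].
    rewrite (big_pred1 k) // => k'; apply/eqP/eqP => [kj'|-> //]; exact: diag_uniq kj' kj.
  by rewrite big_pred0.
rewrite (exchange_big_dep predT) //= [RHS]big_mkcond; apply: eq_bigr => k _.
case: ifP => [/existsP[j /eqP kj]|/negbT]; last first.
  by rewrite negb_exists => /forallP h; rewrite big_pred0 // => j; exact: negPf.
rewrite (big_pred1 j) // => i; rewrite (mult_diag i kj).
by have [->|ij] := eqVneq i j; rewrite /= ?eqxx // (negPf ij) (ltn_eqF d_gt0).
Qed.

Let x_sum1 : \sum_j x j <= 1.
Proof.
rewrite x_sum -y_sum [leLHS]big_mkcond; apply: ler_sum => k _; by case: ifP.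
Qed.

Let x_nontrivial j : x j != 0 -> ~~ trivial_power u j d.
Proof.
rewrite /x; case E : (kd j) => [k|]; last by rewrite eqxx.
by move=> _; apply: (chaos_order ch (k := k)); rewrite (kdP E) d_gt0 leqnn.
Qed.

Let h (mu : {ffun I -> option bool}) : R := \prod_j (if mu j is Some _ then 2^-1 else 1).

Let h_ge0 mu : 0 <= h mu.
Proof. by apply: prodr_ge0 => j _; case: (mu j) => // _; rewrite invr_ge0. Qed.

Let supported (mu : {ffun I -> option bool}) : bool :=
  [forall j, (mu j != None) ==> (x j != 0)].

Let rel k (mu : {ffun I -> option bool}) : bool :=
  relation u (fun j => (mult k j)%:Z - sign_value (fun=> d) j (mu j)).

Let halvesE (mu : {ffun I -> option bool}) : \prod_j halves R (mu j) = (h mu)%:C%C.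
Proof.
rewrite rmorph_prod; apply: eq_bigr => j _; case: (mu j) => [b|] //=.
by rewrite fmorphV rmorph_nat.
Qed.

(** This sum is what the Riesz product with z_j = 1 on the support of x gives when tested on the
    single monomial k. *)
Let rel_count k : \sum_(mu | rel k mu && supported mu) h mu <= 1.
Proof.
pose z j : R[i] := if x j != 0 then 1 else 0.
have := @sign_transfer _ _ _ u (chaos_hom ch) d (chaos_dissociate ch) (fun=> d) z unit
  (fun=> 1) (fun _ j => (mult k j)%:Z) 1.
set L := (X in cmod X) => H.
have eL : L = (\sum_(mu | rel k mu && supported mu) h mu)%:C%C.
  rewrite rmorph_sum [RHS]big_mkcond; apply: eq_bigr => mu _ /=.
  have -> : \prod_j signed (z j) (mu j) = (supported mu)%:R.
    rewrite /supported; case: forallP => [hs|/existsNP[j /negP hj]].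
      rewrite big1 // => j _; have := implyP (hs j); rewrite /z.
      by case: (mu j) => [b|] // -> //; rewrite signed1.
    rewrite (bigD1 j) //= /z; move: hj; rewrite negb_imply => /andP[mj /negPf ->].
    have -> : signed (0 : R[i]) (mu j) = 0 by case: (mu j) mj => [[|]|] // _; exact: conjc0.
    by rewrite mul0r.
  rewrite halvesE -/(rel k mu) [\sum_(t | _) _]big_mkcond big_const card_unit /= addr0.
  by case: (rel k mu); case: (supported mu); rewrite ?mulr1 ?mulr0.
rewrite eL cmod_real_ge0 in H; last by apply: sumr_ge0.
apply: H => // [j|j|t].
- by rewrite /z; case: ifP; rewrite ?cmod1 ?cmod0.
- by rewrite /z; case: ifP => [/x_nontrivial //|]; rewrite eqxx.
by rewrite big_const card_unit /= addr0 mul1r (monomial_hom (chaos_hom ch) _).1.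
Qed.

(** The quotient of two relations with the same pattern no longer contains the signs, so it relates
    two monomials of the chaos. *)
Let rel_uniq k k' mu : rel k mu -> rel k' mu -> k = k'.
Proof.
move=> /asboolP rk /asboolP rk'.
apply: (chaos_relation_inj (chaos_dissociate ch) (chaos_sum ch) (chaos_order ch) (chaos_inj ch)).
apply/asboolP => t; have hu := chaos_hom ch.
have := rk t; have := rk' t; rewrite /monomial.
have e i : u i t ^ ((mult k i)%:Z - (mult k' i)%:Z) =
    u i t ^ ((mult k i)%:Z - sign_value (fun=> d) i (mu i)) /
    u i t ^ ((mult k' i)%:Z - sign_value (fun=> d) i (mu i)).
  by rewrite invr_expz -expfzDr ?(u_neq0 hu) //; congr (_ ^ _); ring.
by rewrite (eq_bigr _ (fun i _ => e i)) prodf_div => -> ->; rewrite divr1.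
Qed.

Let prod_x (mu : {ffun I -> option bool}) : R := \prod_j (if mu j is Some _ then x j else 1).

Let prod_x_ge0 mu : 0 <= prod_x mu.
Proof. by apply: prodr_ge0 => j _; case: (mu j). Qed.

Let prod_x_sum : \sum_(mu : {ffun I -> option bool}) h mu * prod_x mu <= expR 1.
Proof.
have -> : \sum_(mu : {ffun I -> option bool}) h mu * prod_x mu = \prod_j (1 + x j).
  rewrite [RHS](eq_bigr (fun j => \sum_(m : option bool)
    (if m is Some _ then 2^-1 else 1) * (if m is Some _ then x j else 1))) => [|j _].
    by rewrite bigA_distr_bigA; apply: eq_bigr => mu _; rewrite /h /prod_x -big_split.
  by rewrite big_option big_bool /= mulr1; congr (_ + _); lra.
apply: le_trans (_ : \prod_j expR (x j) <= _).
  by apply: ler_prod => j _; rewrite addr_ge0 //= expR_ge1Dx.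
by rewrite -expR_sum ler_expR.
Qed.

(** With z_j = delta x_j^(1-s) up to phase, a single plus sign at j yields delta tau x_j / 2. Any
    other homogeneous pattern has at least three signs, hence delta^3, and |A_k| times the product
    of the x_j^(1-s) is at most tau (prod x + y_k). The first part is summed over patterns, each of
    which determines k, the second over k by [rel_count]. Residues above d are harmless here,
    because relations are counted and not excluded. *)
Lemma diagonal_bound (delta : R) : 0 < delta <= 1 ->
  \sum_(k | diagonal k) cmod (A k) `^ P <=
  2 / delta * B * T `^ (1 - P^-1) + 2 * delta ^+ 2 * (1 + expR 1) * T.
Proof.
case/andP=> de0 de1.
pose z j : R[i] := if kd j is Some k then (delta * x j `^ (1 - s))%:C%C * phase (A k) else 0.
have x_pow1 j : x j `^ (1 - s) <= 1.
  have x1 : x j <= 1.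
    by apply: le_trans x_sum1; rewrite (bigD1 j) //= lerDl sumr_ge0.
  have {2}<- : (1 : R) `^ (1 - s) = 1 by rewrite powR1.
  by rewrite ge0_ler_powR ?nnegrE ?subr_ge0 ?x_ge0 // ltW.
have zx j : cmod (z j) <= delta * x j `^ (1 - s).
  have pos : 0 <= delta * x j `^ (1 - s) by rewrite mulr_ge0 ?powR_ge0 // ltW.
  rewrite /z; case: (kd j) => [k|]; last by rewrite cmod0.
  by rewrite cmodM cmod_real_ge0 // ler_piMr // cmod_phase.
pose sg (j : I) : option 'I_1 := Some ord0.
pose W (mu : {ffun I -> option bool}) := \prod_j halves R (mu j) * \sum_(t | rel t mu) A t.
pose term (mu : {ffun I -> option bool}) := W mu * \prod_j signed (z j) (mu j).
have bw : cmod (\sum_(mu | homogeneous sg mu) term mu) <= B.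
  apply: homogeneous_projection => rot rot1.
  apply: (@sign_transfer _ _ _ u (chaos_hom ch) d (chaos_dissociate ch) (fun=> d)) => //.
  - move=> j; rewrite /= cmodM rot1 mul1r (le_trans (zx j)) //.
    by rewrite mulr_ile1 ?powR_ge0 ?x_pow1 ?(ltW de0).
  - move=> j /=; rewrite mulf_eq0 negb_or => /andP[_]; rewrite /z.
    case E : (kd j) => [k|]; last by rewrite eqxx.
    by move=> _; apply: (chaos_order ch (k := k)); rewrite (kdP E) d_gt0 leqnn.
  - exact: chaos_bound ch.
have xself (t : R) : 0 <= t -> t `^ (1 - s) * t `^ s = t.
  move=> t0; have [->|tn] := eqVneq t 0.
    by rewrite [X in _ * X]powR0 ?mulr0 // invr_eq0 gt_eqF.
  by rewrite -powRD_gt0 ?subrK ?powRr1 // lt_neqAle eq_sym tn.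
pose single j : {ffun I -> option bool} := plus_sign [set j].
have singleE j i : single j i = if i == j then Some true else None.
  by rewrite ffunE finset.in_set1.
have term_single j : term (single j) = (2^-1 * delta * tau * x j)%:C%C.
  rewrite /term /W (bigD1 j) //= big1 ?mulr1 => [|i /negPf ij]; last by rewrite singleE ij.
  rewrite [X in _ * X](bigD1 j) //= [X in _ * (_ * X)]big1 ?mulr1 => [|i /negPf ij]; last first.
    by rewrite singleE ij.
  rewrite singleE eqxx /halves /signed /z /x.
  case E : (kd j) => [k|]; last by rewrite !mulr0 rmorph0.
  have kj := kdP E.
  rewrite (big_pred1 k) => [|t]; last first.
    have -> : rel t (single j) = relation u (fun i => (mult t i)%:Z - (mult k i)%:Z).
      apply: eq_relation => i; rewrite singleE (mult_diag i kj); by case: ifP.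
    apply/idP/eqP => [/(chaos_relation_inj (chaos_dissociate ch) (chaos_sum ch)
      (chaos_order ch) (chaos_inj ch)) //|->].
    apply/asboolP => w; rewrite /monomial big1 // => i _; by rewrite subrr expr0z.
  rewrite -mulrA [A k * _]mulrCA mul_phase A_y -rmorphM.
  have -> : delta * y k `^ (1 - s) * (tau * y k `^ s) = delta * tau * y k.
    by rewrite mulrACA xself.
  by rewrite -!mulrA [in RHS]rmorphM fmorphV rmorph_nat.
pose err mu := if supported mu then
  delta ^+ 3 * tau * \sum_(k | rel k mu) h mu * (prod_x mu + y k) else 0.
have term_err mu : homogeneous sg mu -> mu \notin [set single j | j in I] ->
    cmod (term mu) <= err mu.
  move=> hom ns; rewrite /err; case: ifPn => [_|]; last first.
    rewrite negb_forall => /existsP[j]; rewrite negb_imply negbK => /andP[mj /eqP xj].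
    have s1 : 1 - s != 0 by rewrite subr_eq0 gt_eqF.
    have zj : z j = 0.
      by apply/eqP; rewrite -cmod_eq0 eq_le cmod_ge0 (le_trans (zx j)) // xj powR0 ?mulr0.
    have s0 : signed (z j) (mu j) = 0.
      by rewrite zj; case: (mu j) mj => [[|]|] // _; exact: conjc0.
    by rewrite /term (bigD1 j) //= s0 mul0r mulr0 cmod0.
  pose a := [set j | (sg j == Some ord0) && (mu j == Some true)].
  pose b := [set j | (sg j == Some ord0) && (mu j == Some false)].
  have ab : #|a| = #|b|.+1 by apply/eqP; exact: (forallP hom ord0).
  have b0 : (0 < #|b|)%N.
    rewrite lt0n; apply: contra ns => /eqP b0.
    have /cards1P[j aj] : #|a| == 1%N by rewrite ab b0.
    apply/imsetP; exists j => //; apply/ffunP => i; rewrite singleE.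
    have : i \notin b by move/eqP: b0; rewrite cards_eq0 => /eqP ->; rewrite finset.in_set0.
    have : (i \in a) = (i == j) by rewrite aj finset.in_set1.
    rewrite !finset.in_set eqxx /= => <-; by case: (mu i) => [[|]|].
  pose sup := [set j | mu j != None].
  have c3 : (3 <= #|sup|)%N.
    have -> : sup = a :|: b.
      apply/setP => j; rewrite finset.in_setU !finset.in_set eqxx /=; by case: (mu j) => [[|]|].
    rewrite cardsU (_ : a :&: b = finset.set0) ?cards0.
      by rewrite subn0 ab; exact: (@leq_add 2 1).
    by apply/setP => j; rewrite finset.in_setI !finset.in_set eqxx /=; case: (mu j) => [[|]|].
  have pz : cmod (\prod_j signed (z j) (mu j)) <= delta ^+ 3 * prod_x mu `^ (1 - s).
    rewrite cmod_prod.
    apply: le_trans (_ : \prod_j ((if mu j is Some _ then delta else 1) *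
        (if mu j is Some _ then x j else 1) `^ (1 - s)) <= _).
      apply: ler_prod => j _; rewrite cmod_ge0 /=.
      by case: (mu j) => [[|]|] //=; rewrite ?cmodJ ?cmod1 ?powR1 ?mulr1.
    rewrite big_split /=.
    have -> : \prod_j (if mu j is Some _ then delta else 1) = delta ^+ #|sup|.
      rewrite -prodr_const [RHS]big_mkcond; apply: eq_bigr => j _; rewrite finset.in_set.
      by case: (mu j).
    have -> : \prod_j (if mu j is Some _ then x j else 1) `^ (1 - s) = prod_x mu `^ (1 - s).
      by rewrite /prod_x powR_prod // => j; case: (mu j).
    by rewrite ler_wpM2r ?powR_ge0 // ler_wiXn2l // ltW.
  rewrite /term cmodM /W cmodM halvesE cmod_real_ge0 ?h_ge0 //.
  apply: le_trans (_ : (h mu * \sum_(k | rel k mu) cmod (A k)) *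
      (delta ^+ 3 * prod_x mu `^ (1 - s)) <= _).
    by apply: ler_pM; rewrite ?mulr_ge0 ?cmod_ge0 ?h_ge0 // ler_wpM2l ?h_ge0 // cmod_sum.
  rewrite [h mu * _]mulr_sumr mulr_suml mulr_sumr; apply: ler_sum => k _; rewrite A_y.
  have -> : h mu * (tau * y k `^ s) * (delta ^+ 3 * prod_x mu `^ (1 - s)) =
      delta ^+ 3 * tau * (h mu * (prod_x mu `^ (1 - s) * y k `^ s)) by ring.
  have c0 : 0 <= delta ^+ 3 * tau by rewrite mulr_ge0 ?exprn_ge0 ?ltW.
  rewrite ler_wpM2l // ler_wpM2l //; exact: weighted_geometric_mean_le.
have single_inj : injective single.
  move=> i j eij; have : single i i = single j i by rewrite eij.
  by rewrite !singleE eqxx; case: eqP.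
have single_hom j : homogeneous sg (single j).
  apply/forallP => g; rewrite (_ : [set i | _ & single j i == Some true] = [set j]).
    rewrite cards1 eqSS eq_sym cards_eq0; apply/eqP/setP => i.
    by rewrite !finset.in_set singleE; case: (i == j); rewrite andbF.
  apply/setP => i; rewrite finset.in_set finset.in_set1 (ord1 g) eqxx singleE /=.
  by case: (i == j).
have main : 2^-1 * delta * tau * \sum_j x j <= B + \sum_mu err mu.
  have -> : 2^-1 * delta * tau * \sum_j x j = cmod (\sum_j term (single j)).
    rewrite (eq_bigr _ (fun j _ => term_single j)) -rmorph_sum cmod_real_ge0 -?mulr_sumr //.
    by rewrite !mulr_ge0 ?sumr_ge0 // ltW.
  have -> : \sum_j term (single j) = \sum_(mu | homogeneous sg mu) term mu -
      \sum_(mu | homogeneous sg mu && (mu \notin [set single j | j in I])) term mu.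
    rewrite (bigID (fun mu => mu \in [set single j | j in I])) /= addrK.
    rewrite -[LHS](big_imset (h := single) term) /=; last by move=> i j _ _; exact: single_inj.
    apply: eq_bigl => mu; case: imsetP => [[j _ ->]|]; rewrite ?andbF // single_hom //.
  apply: le_trans (cmodD _ _) _; rewrite cmodN lerD //.
  apply: le_trans (cmod_sum _ _) _; rewrite [leLHS]big_mkcond; apply: ler_sum => mu _.
  case: ifP => [/andP[hom ns]|_]; first exact: term_err.
  rewrite /err; case: ifP => // _; rewrite mulr_ge0 ?mulr_ge0 ?exprn_ge0 ?(ltW tau_gt0) ?(ltW de0) //.
  by apply: sumr_ge0 => k _; rewrite mulr_ge0 // addr_ge0.
have errs : \sum_mu err mu <= delta ^+ 3 * tau * (expR 1 + 1).
  have -> : \sum_mu err mu = delta ^+ 3 * tau * (\sum_(mu | supported mu)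
      \sum_(k | rel k mu) h mu * prod_x mu + \sum_(mu | supported mu) \sum_(k | rel k mu) h mu * y k).
    rewrite -big_split mulr_sumr [RHS]big_mkcond; apply: eq_bigr => mu _.
    rewrite /err; case: ifP => // _; congr (_ * _); rewrite -big_split.
    by apply: eq_bigr => k _; rewrite mulrDr.
  rewrite ler_wpM2l ?mulr_ge0 ?exprn_ge0 ?(ltW tau_gt0) ?(ltW de0) // lerD //.
    apply: le_trans prod_x_sum; rewrite [leLHS]big_mkcond; apply: ler_sum => mu _.
    have hp0 : 0 <= h mu * prod_x mu by rewrite mulr_ge0.
    case: ifP => // _; case: (pickP (fun k => rel k mu)) => [k rk|none]; last by rewrite big_pred0.
    rewrite (big_pred1 k) // => k'; apply/idP/eqP => [rk'|-> //]; exact: rel_uniq rk' rk.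
  rewrite (exchange_big_dep predT) //= -y_sum; apply: ler_sum => k _.
  rewrite -mulr_suml mulrC ler_piMr //.
  by rewrite (eq_bigl (fun mu => rel k mu && supported mu)) // => mu; rewrite andbC.
have x_T : \sum_j x j = (\sum_(k | diagonal k) cmod (A k) `^ P) / T by rewrite x_sum mulr_suml.
rewrite x_T in main; set T1 := \sum_(k | _) _ in main *.
have tauT : T `^ (1 - P^-1) = T / tau.
  by rewrite powRD_gt0 // powRr1 ?(ltW T_gt0) // powRN.
have TtP : 0 < T / tau by rewrite divr_gt0.
have dn : delta != 0 by rewrite gt_eqF.
have tn : tau != 0 by rewrite gt_eqF.
have Tn : T != 0 by rewrite gt_eqF.
have -> : T1 = (2 / delta * (T / tau)) * (2^-1 * delta * tau * (T1 / T)).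
  by field; rewrite dn tn Tn.
rewrite tauT.
have -> : 2 / delta * B * (T / tau) + 2 * delta ^+ 2 * (1 + expR 1) * T =
    (2 / delta * (T / tau)) * (B + delta ^+ 3 * tau * (expR 1 + 1)).
  by field; rewrite dn tn.
rewrite ler_wpM2l; last by rewrite (le_trans main) // lerD2l.
  by [].
by rewrite mulr_ge0 ?divr_ge0 ?ltW.
Qed.

End Diagonal.

(** * Summation over all types *)

Section Estimate.
Variables (R : realType) (G : zmodType) (d : nat).
Hypothesis d_gt0 : (0 < d)%N.

Let P : R := (2 * d)%:R / (d + 1)%:R.

Let P_gt0 : 0 < P. Proof. by rewrite divr_gt0 ?ltr0n ?muln_gt0 ?addn1. Qed.

Let P_ge1 : 1 <= P.
Proof. by rewrite ler_pdivlMr ?mul1r ?ler_nat ?ltr0n; lia. Qed.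

(** Exponent lists are ordered, so a monomial may have several shapes; this is harmless, since only
    a covering by a number of shapes depending on d is needed. *)
Let shape := {r : 'I_d.+1 & {ffun 'I_r -> 'I_d.+1}}.

Let has_shape (K I : finType) (mult : K -> I -> nat) (k : K) (t : shape) : bool :=
  `[< exists e, arranged mult (fun g => tagged t g : nat) k e >].

Let mixed (t : shape) : bool :=
  [&& [forall g, 0 < tagged t g]%N, (\sum_g tagged t g == d)%N & (1 < tag t)%N || (d == 1%N)].

Let shape_bounds : exists2 C : shape -> R, forall t, 0 < C t &
  forall t (I : finType) (u : I -> G -> R[i]) (K : finType) (mult : K -> I -> nat)
    (A : K -> R[i]) (B : R), mixed t -> chaos d u mult A B ->
  \sum_(k | has_shape mult k t) cmod (A k) `^ P <= C t * B `^ P.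
Proof.
suff h t : exists C : R, 0 < C /\
  forall (I : finType) (u : I -> G -> R[i]) (K : finType) (mult : K -> I -> nat)
    (A : K -> R[i]) (B : R), mixed t -> chaos d u mult A B ->
  \sum_(k | has_shape mult k t) cmod (A k) `^ P <= C * B `^ P.
  by have [C hC] := choice h; exists C => [t|t]; have [] := hC t.
have [/and3P[/forallP p0 /eqP ps r1]|_] := boolP (mixed t); last by exists 1.
have [C C0 hC] := mixed_type_bounded R G d_gt0 p0 ps r1.
exists C; split => // I u K mult A B _ ch.
have [/existsP[k0 /asboolP[e0 _]]|none] := boolP [exists k, has_shape mult k t]; last first.
  rewrite big_pred0 ?mulr_ge0 ?powR_ge0 ?(ltW C0) // => k.
  by apply: contraNF none => hk; apply/existsP; exists k.
have /choice[e he] : forall k, exists e,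
    has_shape mult k t -> arranged mult (fun g => tagged t g : nat) k e.
  move=> k; case E : (has_shape mult k t); last by exists e0.
  by have /asboolP[e he] := E; exists e.
have := hC _ _ _ _ _ _ ch [set k | has_shape mult k t] e.
rewrite (eq_bigl (fun k => has_shape mult k t)) => [|k]; last by rewrite finset.in_set.
by apply=> k; rewrite finset.in_set; exact: he.
Qed.

Let shape_exists (I : finType) (u : I -> G -> R[i]) (K : finType) (mult : K -> I -> nat)
    (A : K -> R[i]) (B : R) k : chaos d u mult A B ->
  ~~ diagonal d mult k || (d == 1%N) -> exists t, mixed t && has_shape mult k t.
Proof.
move=> ch nd; pose X := [set j | (0 < mult k j)%N].
have mk := mult_leq (chaos_sum ch) k.
have sumX : (\sum_(j in X) mult k j = d)%N.
  rewrite -[RHS](chaos_sum ch k) [RHS](bigID (fun j => j \in X)) /= [X in _ = (_ + X)%N]big1 ?addn0 //.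
  by move=> j; rewrite finset.in_set lt0n negbK => /eqP.
have cX : (#|X| < d.+1)%N.
  rewrite ltnS -sumX -sum1_card; apply: leq_sum => j; by rewrite finset.in_set.
pose t : shape := Tagged (fun r : 'I_d.+1 => {ffun 'I_r -> 'I_d.+1})
  (i := Ordinal cX) [ffun g : 'I_#|X| => inord (mult k (enum_val g))].
have tE (g : 'I_#|X|) : tagged t g = mult k (enum_val g) :> nat.
  by rewrite /= ffunE inordK // ltnS.
have Xg (g : 'I_#|X|) : (0 < mult k (enum_val g))%N by have := enum_valP g; rewrite finset.in_set.
exists t; apply/andP; split; last first.
  apply/asboolP; exists (@enum_val I (mem X)); split => [||j].
  - exact: enum_val_inj.
  - by move=> g; rewrite tE.
  - move=> jX; apply/eqP; rewrite -leqn0 leqNgt; apply: contra jX => j0.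
    have jX : j \in X by rewrite finset.in_set.
    by apply/codomP; exists (enum_rank_in jX j); rewrite enum_rankK_in.
have ps : (\sum_(g < #|X|) tagged t g = d)%N.
  rewrite -[RHS]sumX [RHS]big_enum_val; apply: eq_bigr => g _; exact: tE.
apply/and3P; split; [by apply/forallP => g; rewrite tE|exact/eqP|].
case/orP: nd => [nd|->]; last by rewrite orbT.
apply/orP; left; rewrite /= ltnNge; apply: contra nd => X1.
have X0 : (0 < #|X|)%N.
  by rewrite lt0n; apply: contraTneq d_gt0 => /cards0_eq X0; rewrite -sumX X0 big_set0.
have /cards1P[j Xj] : #|X| == 1%N by rewrite eqn_leq X1.
by apply/existsP; exists j; rewrite -[X in _ == X]sumX Xj big_set1.
Qed.

Theorem chaos_coefficient_estimate : exists2 C : R, 0 < C &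
  forall (I : finType) (u : I -> G -> R[i]) (K : finType) (mult : K -> I -> nat)
    (A : K -> R[i]) (B : R), chaos d u mult A B ->
  \sum_k cmod (A k) `^ P <= C * B `^ P.
Proof.
have [Ct Ct0 hCt] := shape_bounds.
pose C0 := \sum_t Ct t.
have C00 : 0 <= C0 by apply: sumr_ge0 => t _; exact: ltW.
(* Makes 2 delta^2 (1 + e) equal to delta, which is at most 1/2, so that T on the right is
   absorbed. *)
pose delta : R := (2 * (1 + expR 1))^-1.
have ex0 : 0 < expR 1 :> R by exact: expR_gt0.
have de0 : 0 < delta by rewrite invr_gt0; lra.
have de1 : delta <= 1 by rewrite invf_le1; lra.
have desq : 2 * delta ^+ 2 * (1 + expR 1) = delta.
  by rewrite /delta; field; rewrite gt_eqF //; lra.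
have de2 : delta <= 2^-1 by rewrite /delta lef_pV2 ?posrE; lra.
exists ((2 * C0 + 4 / delta) `^ P + C0 + 1) => [|I u K mult A B ch].
  by rewrite ltr_wpDl // addr_ge0 // powR_ge0.
have B0 : 0 <= B := le_trans (cmod_ge0 _) (chaos_bound ch 0).
have BP0 : 0 <= B `^ P by exact: powR_ge0.
set T := \sum_k _; have T0 : 0 <= T by apply: sumr_ge0 => k _; exact: powR_ge0.
have covered (Q : pred K) : (forall k, Q k -> ~~ diagonal d mult k || (d == 1%N)) ->
    \sum_(k | Q k) cmod (A k) `^ P <= C0 * B `^ P.
  move=> hQ; rewrite mulr_suml.
  apply: le_trans (_ : \sum_t \sum_(k | mixed t && has_shape mult k t) cmod (A k) `^ P <= _); last first.
    apply: ler_sum => t _; case mt : (mixed t); first exact: (hCt t I u K mult A B mt ch).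
    by rewrite big_pred0 // mulr_ge0 // ltW.
  rewrite (exchange_big_dep predT) //= [leLHS]big_mkcond; apply: ler_sum => k _.
  case: ifP => [Qk|_]; last by apply: sumr_ge0 => t _; exact: powR_ge0.
  have [t ht] := shape_exists ch (hQ k Qk).
  by rewrite (bigD1 t) //= lerDl sumr_ge0 // => t' _; exact: powR_ge0.
have [d1|dn1] := eqVneq d 1%N.
  apply: le_trans (covered predT _) _; first by move=> k _; rewrite d1 eqxx orbT.
  by rewrite ler_wpM2r //; have := powR_ge0 (2 * C0 + 4 / delta) P; lra.
have d2 : (1 < d)%N by rewrite ltn_neqAle eq_sym dn1.
have [T00|Tn] := eqVneq T 0.
  by rewrite T00 mulr_ge0 // !addr_ge0 ?powR_ge0.
have Tp : 0 < T by rewrite lt_neqAle eq_sym Tn.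
have h1 := diagonal_bound d2 ch Tp (delta := delta).
rewrite de0 de1 desq -/P -/T in h1; have {}h1 := h1 isT.
have h2 : \sum_(k | ~~ diagonal d mult k) cmod (A k) `^ P <= C0 * B `^ P.
  by apply: covered => k ->.
have h3 : T <= 2 / delta * B * T `^ (1 - P^-1) + delta * T + C0 * B `^ P.
  by rewrite {1}/T (bigID (diagonal d mult)) /=; exact: lerD.
set Y := T `^ (1 - P^-1) in h3.
have Yp : 0 < Y by exact: powR_gt0.
pose tau := T `^ P^-1.
have tau0 : 0 < tau by exact: powR_gt0.
have tauY : T = tau * Y by rewrite /tau /Y -powRD_gt0 // addrC subrK powRr1.
have tauP : tau `^ P = T by rewrite /tau -powRrM mulVf ?gt_eqF // powRr1.
(* If tau <= B then T <= B^P. Otherwise B^P <= B Y with Y = T^(1-1/P), and division by Y leaves a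
   linear bound for tau. *)
have [tB|Bt] := lerP tau B.
  rewrite -tauP; apply: le_trans (_ : B `^ P <= _).
    by rewrite ge0_ler_powR ?nnegrE ?(ltW P_gt0) ?(ltW tau0).
  by rewrite ler_peMl //; have := powR_ge0 (2 * C0 + 4 / delta) P; lra.
have BPY : B `^ P <= B * Y.
  have [->|Bn] := eqVneq B 0; first by rewrite powR0 ?gt_eqF // mul0r.
  have Bp : 0 < B by rewrite lt_neqAle eq_sym Bn.
  have -> : B `^ P = B * B `^ (P - 1) by rewrite -{2}[B]powRr1 // -powRD_gt0 // addrC subrK.
  rewrite ler_wpM2l //.
  have -> : Y = tau `^ (P - 1).
    by rewrite /tau -powRrM /Y; congr (_ `^ _); rewrite mulrBr mulr1 mulVf ?gt_eqF.
  by rewrite ge0_ler_powR ?nnegrE ?(ltW Bt) ?(ltW tau0) // subr_ge0.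
have h4 : tau <= (2 * C0 + 4 / delta) * B.
  rewrite -(ler_pM2r Yp) -tauY.
  have : delta * T <= 2^-1 * T by rewrite ler_wpM2r.
  have : C0 * B `^ P <= C0 * (B * Y) by rewrite ler_wpM2l.
  have -> : (2 * C0 + 4 / delta) * B * Y = 2 * (C0 * (B * Y)) + 2 * (2 / delta * B * Y) by ring.
  by move: h3; lra.
have c0 : 0 <= 2 * C0 + 4 / delta by rewrite addr_ge0 ?mulr_ge0 ?invr_ge0 // ltW.
rewrite -tauP; apply: le_trans (_ : ((2 * C0 + 4 / delta) * B) `^ P <= _).
  by rewrite ge0_ler_powR ?nnegrE ?(ltW P_gt0) ?(ltW tau0) ?mulr_ge0.
by rewrite powRM // ler_wpM2r //; lra.
Qed.

End Estimate.

(** * Haar measure and characters *)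

Section EssentialSupremum.
Local Open Scope classical_set_scope.
Variables (R : realType) (G : topologicalZmodType).
Variable mu : probability (borelType G) R.
Hypothesis cG : compact [set: G].
Hypothesis hmu : is_haar mu.

Lemma open_translate (a : G) (O : set G) : open O -> open [set a + x | x in O].
Proof.
move=> oO; have -> : [set a + x | x in O] = (fun y => y - a) @^-1` O.
  rewrite eqEsubset; split => [_ [x Ox <-]|y Oy]; first by rewrite /= addrAC subrr add0r.
  by exists (y - a) => //; rewrite addrC subrK.
apply: open_comp => // y _.
apply: (@continuous_comp _ _ _ (fun y : G => (y, a)) (fun z : G * G => z.1 - z.2)).
  by apply: cvg_pair; [exact: cvg_id|exact: cvg_cst].
exact: sub_continuous.
Qed.

(** By compactness finitely many translates of a nonempty O cover G; they are null by invariance,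
    against total mass 1. *)
Lemma open_null_eq0 (O : set G) : open O -> mu O = 0%E -> O = set0.
Proof.
move=> oO O0; apply/eqP/negPn/negP => /set0P[x0 Ox0].
have mO (U : set G) : open U -> measurable (U : set (borelType G)).
  by move=> oU; apply: sub_sigma_algebra.
have [D _ cov] : finite_subset_cover [set: G] (fun y => [set (y - x0) + x | x in O]) [set: G].
  pose Gp : ptopologicalType := HB.pack G (isPointed.Build G 0).
  have : @cover_compact Gp [set: G] by rewrite -compact_cover; exact: cG.
  apply=> [y _|y _]; first exact: open_translate.
  by exists y => //=; exists x0 => //; rewrite subrK.
have neg : mu.-negligible ([set: G] : set (borelType G)).
  apply: (@negligibleS _ (borelType G) R mu _ _ cov); rewrite /cover bigcup_fset.
  elim/big_ind : _ => [|U V|y _]; [exact: negligible_set0|exact: negligibleU|].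
  apply/negligibleP; first by apply: mO; exact: open_translate.
  case: hmu => trans _ _; rewrite -O0; apply: trans; exact: mO.
have null : mu [set: borelType G] = 0%E := measure_negligible measurableT neg.
by have := probability_setT mu; rewrite null => /eqP; rewrite eq_sym onee_eq0.
Qed.

(** The set where f exceeds the norm is open and null, hence empty. *)
Lemma le_Lnorm_pinfty (f : G -> R) x : continuous f -> 0 <= f x ->
  ((f x)%:E <= Lnorm mu +oo (fun x => (f x)%:E))%E.
Proof.
move=> cf fx; rewrite leNgt; apply/negP => Lf; set L := Lnorm _ _ _ in Lf.
have mT : mu [set: borelType G] = 1%E := probability_setT mu.
have Lfin : L \is a fin_num by rewrite ge0_fin_numE ?Lnorm_ge0 // (lt_trans Lf) ?ltry.
have eL : L = ess_sup mu (abse \o (fun x => (f x)%:E)).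
  rewrite /L unlock; case: ifPn => // /negP[].
  by apply: lt_le_trans lte01 _; rewrite -mT.
pose O := [set y | fine L < f y].
have oO : open O by apply: (open_comp (D := [set t | fine L < t])) => [y _|]; [exact: cf|exact: open_gt].
have O0 : mu O = 0%E.
  apply: measure_negligible; first exact: sub_sigma_algebra.
  have [N [mN N0 sN]] := ess_sup_ge mu (abse \o (fun x => (f x)%:E)).
  exists N; split => // y Oy; apply: sN => /=; apply/negP; rewrite -ltNge -eL -(fineK Lfin).
  by rewrite lte_fin (lt_le_trans Oy) // ler_norm.
have : O x by rewrite /O /= -lte_fin fineK.
by rewrite (open_null_eq0 oO O0).
Qed.

End EssentialSupremum.

Section Continuity.
Local Open Scope classical_set_scope.
Variables (R : realType) (G : topologicalType).

Lemma continuous_cmod (Q : G -> R[i]^o) : continuous Q -> continuous (fun x => cmod (Q x) : R).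
Proof.
move=> cQ x; apply/cvgrPdist_lt => eps e0.
have /cvgrPdist_lt/(_ eps%:C%C) := cQ x; rewrite ltcR => /(_ e0).
apply: filterS => y; rewrite -[X in X -> _]/(is_true (`|(Q x - Q y : R[i])| < eps%:C%C)) cmodE ltcR.
apply: le_lt_trans.
have h (z w : R[i]) : cmod z - cmod w <= cmod (z - w).
  by rewrite lerBlDr -{1}(subrK w z) cmodD.
rewrite ler_norml lerNl opprB h andbT; have := h (Q y) (Q x).
by rewrite -(cmodN (Q y - Q x)) opprB.
Qed.

Lemma continuous_sum_prod (T J : finType) (P : pred T) (a : T -> R[i]) (f : T -> J -> G -> R[i]^o) :
  (forall t j, continuous (f t j)) ->
  continuous (fun x => (\sum_(t | P t) a t * \prod_j f t j x) : R[i]^o).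
Proof.
move=> cf.
have cprod (w : seq J) t : continuous (fun x => (\prod_(j <- w) f t j x) : R[i]^o).
  elim: w => [|j w IH] x; under eq_fun do rewrite ?big_nil ?big_cons.
    exact: cst_continuous.
  by apply: cvgM; [exact: cf|exact: IH].
elim: (index_enum T) => [|t s IH] x; under eq_fun do rewrite ?big_nil ?big_cons.
  exact: cst_continuous.
case: (P t); last exact: IH.
by apply: cvgD; [apply: cvgM; [exact: cvg_cst|exact: cprod]|exact: IH].
Qed.

End Continuity.

Section CountMem.

Lemma sum_count_mem (T : finType) (s : seq T) : (\sum_j count_mem j s = size s)%N.
Proof.
elim: s => [|x s IH] /=; first by rewrite big1.
rewrite big_split IH -add1n; congr (_ + _)%N => /=; rewrite (bigD1 x) //= eqxx big1 // => j jx.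
by rewrite eq_sym (negPf jx).
Qed.

Lemma prod_count_mem (R : comRingType) (T : finType) (F : T -> R) (s : seq T) :
  \prod_j F j ^+ count_mem j s = \prod_(j <- s) F j.
Proof.
elim: s => [|x s IH]; first by rewrite big_nil big1.
rewrite big_cons -IH /= (bigD1 x) //= eqxx exprS [in RHS](bigD1 x) //= mulrA.
by congr (_ * _); apply: eq_bigr => j jx; rewrite eq_sym (negPf jx).
Qed.

End CountMem.

(** * From a dissociated system of characters to a finite chaos *)

Section CharacterChaos.
Local Open Scope classical_set_scope.
Variables (R : realType) (d : nat) (G : topologicalZmodType).
Variable gamma : nat -> G -> cplx R.
Hypothesis hgamma : forall i, is_character (gamma i).
Hypothesis hdiss : dissociated_system d gamma.
Variable N : nat.
Let u (j : 'I_N.+1) : G -> R[i] := gamma j.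

Lemma character_unimodular i : unimodular_hom (gamma i : G -> R[i]).
Proof.
have [_ h1 h2] := hgamma i; split => [x|x y]; last exact: h2.
by apply: complexI; rewrite -cmodE; exact: h1.
Qed.

Lemma character_dissociate : dissociate u d.
Proof.
move=> l ld /asboolP rel j; have [ginj dis] := hdiss.
pose A : set (G -> cplx R) := range (u : 'I_N.+1 -> G -> cplx R).
have uinj : injective u by move=> i i' /ginj/val_inj.
(* Carries exponents from indices over to characters; by injectivity of [gamma] the sum has a single
   term at each [u i]. *)
pose k (chi : G -> cplx R) : int := \sum_(i < N.+1 | `[< u i = chi >]) l i.
have kE i : k (u i) = l i.
  rewrite /k (big_pred1 i) // => i'; apply/asboolP/eqP => [/uinj //|-> //].
have finA : finite_set A by apply: finite_image; exact: finite_finset.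
have subA : A `<=` range gamma by move=> _ [i _ <-]; exists i.
have [_ /(_ k) h] := dis A finA subA.
apply/asboolP => x; rewrite -kE; apply: h; last by exists j.
- by move=> _ [i _ <-]; rewrite kE.
- move=> y; rewrite (@reindex_fsbig _ _ _ _ _ (u : _ -> G -> cplx R) [set` predT] A); last first.
    split=> [i _|i i' _ _|_ [i _ <-]]; [by exists i|exact: uinj|by exists i].
  rewrite -[RHS](rel y) -(bigfs _ (r := index_enum 'I_N.+1)) ?index_enum_uniq // => [|i _]; last first.
    by rewrite mem_index_enum.
  by apply: eq_bigr => i _; rewrite kE.
Qed.

(** A trivial positive power n bounds the order of the character by n, against the strict inequality
    in [chaos_index]. *)
Lemma chaos_index_trivial_power (k : d.-tuple 'I_N.+1) j n :
  chaos_index gamma k -> (0 < n <= count_mem j k)%N -> ~~ trivial_power u j n.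
Proof.
case/andP=> _ /forallP/(_ j) lt /andP[n0 nk]; apply/asboolP => tr.
have : (char_order (gamma j) <= (count_mem j k)%:R%:E)%E.
  apply: le_trans (_ : (n%:R%:E <= _)%E); last by rewrite lee_fin ler_nat.
  by apply: ereal_inf_lbound; exists n.
by rewrite leNgt lt.
Qed.

Lemma chaos_index_inj (k k' : d.-tuple 'I_N.+1) : chaos_index gamma k -> chaos_index gamma k' ->
  (fun j => count_mem j k) =1 (fun j => count_mem j k') -> k = k'.
Proof.
case/andP=> sk _ /andP[sk' _] e.
have pe : perm_eq k k' by apply/allP => j _; apply/eqP; exact: e.
apply: val_inj; apply: (inj_map val_inj).
exact: (sorted_eq leq_trans anti_leq sk sk' (perm_map _ pe)).
Qed.

(** Passing to the subtype of admissible tuples makes the order and injectivity conditions hold for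
    every index of the chaos. *)
Lemma character_chaos (a : d.-tuple 'I_N.+1 -> cplx R) (B : R) :
  (forall x, cmod (chaos_poly gamma a x) <= B) ->
  chaos d u (fun (k : {k : d.-tuple 'I_N.+1 | k \in [pred k | chaos_index gamma k]}) j =>
    count_mem j (val k)) (fun k => a (val k)) B.
Proof.
move=> hB; have valK (k : {k : d.-tuple 'I_N.+1 | k \in [pred k | chaos_index gamma k]}) :
  chaos_index gamma (val k) := valP k.
split => [j|||k j n|k k' e|x].
- exact: character_unimodular.
- exact: character_dissociate.
- by move=> k; rewrite sum_count_mem size_tuple.
- exact: chaos_index_trivial_power.
- by apply: val_inj; apply: chaos_index_inj.
have := hB x; congr (cmod _ <= _); rewrite /chaos_poly.
transitivity (\sum_(k in [pred k | chaos_index gamma k])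
  (a k : R[i]) * monomial u (fun j => (count_mem j k)%:Z) x); last by rewrite big_sub.
apply: eq_bigr => k _; congr (_ * _).
by rewrite /monomial -[RHS]/(\prod_j u j x ^+ count_mem j k) prod_count_mem big_tuple.
Qed.

End CharacterChaos.

Local Open Scope classical_set_scope.
Local Open Scope ring_scope.

Theorem theorem3 (R : realType) (d : nat) (hd : (1 <= d)%N)
  (G : topologicalZmodType) (hG : hausdorff_space G) (cG : compact [set: G])
  (mu : probability (borelType G) R) (hmu : is_haar mu)
  (gamma : nat -> G -> cplx R)
  (hgamma : forall i, is_character (gamma i))
  (hdiss : dissociated_system d gamma) :
  exists C : R, 0 < C /\
    forall (N : nat) (a : d.-tuple 'I_N.+1 -> cplx R),
      (((\sum_(k : d.-tuple 'I_N.+1 | chaos_index gamma k)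
           cmod (a k) `^ ((2 * d)%:R / (d + 1)%:R))
         `^ ((d + 1)%:R / (2 * d)%:R))%:E
       <= C%:E * Lnorm mu +oo (fun x => (cmod (chaos_poly gamma a x))%:E))%E.
Proof.
have [C C0 hC] := chaos_coefficient_estimate R G hd.
have d1 : (0 : R) < (d + 1)%:R by rewrite ltr0n addn1.
have d2 : (0 : R) < (2 * d)%:R by rewrite ltr0n muln_gt0.
have iP : (d + 1)%:R / (2 * d)%:R = ((2 * d)%:R / (d + 1)%:R)^-1 :> R by rewrite invf_div.
exists (C `^ ((d + 1)%:R / (2 * d)%:R)); split; first exact: powR_gt0.
move=> N a; set L := Lnorm _ _ _.
have cQ : continuous (fun x => cmod (chaos_poly gamma a x)).
  apply: continuous_cmod; apply: continuous_sum_prod => k j.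
  by have [] := hgamma (tnth k j).
(* The finite averages behind the estimate evaluate the polynomial at single points, so the norm
   must be a bound everywhere, not just almost everywhere. *)
have leL x : ((cmod (chaos_poly gamma a x))%:E <= L)%E.
  by apply: (le_Lnorm_pinfty cG hmu cQ); exact: cmod_ge0.
have [Linf|Lfin] := eqVneq L +oo%E.
  by rewrite Linf gt0_muley ?lee_fin ?lte_fin ?powR_gt0 // leey.
have LE : L = (fine L)%:E by rewrite fineK // ge0_fin_numE ?Lnorm_ge0 // ltey.
have L0 : 0 <= fine L by rewrite fine_ge0 // Lnorm_ge0.
have leB x : cmod (chaos_poly gamma a x) <= fine L by rewrite -lee_fin -LE.
have est := hC _ _ _ _ _ _ (character_chaos hgamma hdiss leB).
rewrite LE -EFinM lee_fin.
have S0 : 0 <= \sum_(k : d.-tuple 'I_N.+1 | chaos_index gamma k)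
    cmod (a k) `^ ((2 * d)%:R / (d + 1)%:R).
  by apply: sumr_ge0 => k _; exact: powR_ge0.
rewrite -(big_sub [pred k | chaos_index gamma k]
  (fun k => cmod (a k) `^ ((2 * d)%:R / (d + 1)%:R))) in est.
apply: le_trans (_ : (C * fine L `^ ((2 * d)%:R / (d + 1)%:R)) `^ ((d + 1)%:R / (2 * d)%:R) <= _).
  by rewrite ge0_ler_powR ?nnegrE // ?divr_ge0 ?mulr_ge0 ?powR_ge0 // ltW.
by rewrite powRM ?powR_ge0 ?(ltW C0) // -powRrM iP mulfV ?powRr1 // mulf_neq0 ?invr_neq0 ?gt_eqF.
Qed.
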